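(* The affine index polynomial is a concordance invariant of virtual knots and of compatible virtual links (with integral affine labelings), in the following sense. (1) (Knots) If $K$ and $K'$ are virtually concordant oriented virtual knots, then $P_K(t)=P_{K'}(t)$. (2) (Links) Let $L$ and $L'$ be compatible oriented virtual link diagrams that are connected by a genus zero virtual concordance in which all critical points (births, saddles, deaths) can be paired in canceling pairs, each pair consisting either of a death (maximum) and a saddle or of a saddle and a birth (minimum). Then for every integer affine labeling $C$ of $L$ there is an integer affine labeling $C'$ of $L'$ that corresponds to $C$ along the concordance, and $P_{(L,C)}(t)=P_{(L',C')}(t)$.
   Context: Virtual diagrams. A virtual knot or link diagram is an oriented closed curve (or several) generically immersed in the plane, with each double point marked either as a classical crossing (with over/under information) or as a virtual crossing (no over/under information). Virtual isotopy is the equivalence relation generated by planar isotopy, the classical Reidemeister moves I, II, III (on classical crossings), and the detour move: any consecutive sub-arc of the diagram containing only virtual crossings may be erased and redrawn along any other generic path with the same endpoints, all of its crossings with the rest of the diagram being declared virtual. A virtual knot or link is a virtual isotopy class of diagrams. Affine labeling. An arc of a diagram is an oriented edge running from one classical crossing to the next classical crossing (it may pass through virtual crossings, where its label is unchanged); a component with no classical crossings is a single arc. An (integer) affine labeling assigns an integer to each arc so that at every classical crossing, drawn with both strands oriented upward, if the left incoming arc is labeled $a$ and the right incoming arc is labeled $b$, then the right outgoing arc (the continuation of the left incoming one) is labeled $a-1$ and the left outgoing arc (the continuation of the right incoming one) is labeled $b+1$. Over/under information plays no role in this rule. Every virtual knot diagram has an affine labeling, unique up to adding a constant integer to all labels.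 Compatibility. For two components $A,B$ of a diagram, each classical crossing between them contributes $+1$ or $-1$ to the algebraic intersection number of $A$ with $B$, according to whether (tangent of $A$, tangent of $B$) is a positively or negatively oriented basis of the plane (ignoring over/under; virtual crossings are not counted). A multi-component diagram is compatible if every component has total algebraic intersection number zero with the rest of the diagram. A multi-component diagram admits an affine labeling if and only if it is compatible. Weights and polynomial. At a classical crossing $c$, drawn with both strands oriented upward, let $a$ be the label of the left incoming arc and $b$ the label of the right incoming arc, and put $W_+(c)=a-(b+1)$ and $W_-(c)=b-(a-1)$. Let $\mathrm{sgn}(c)=\pm1$ be the usual sign of the crossing (with both strands oriented upward, $+1$ if the over-strand goes from bottom left to top right). The weight is $W(c)=W_+(c)$ if $\mathrm{sgn}(c)=+1$ and $W(c)=W_-(c)$ if $\mathrm{sgn}(c)=-1$. For a diagram $L$ with affine labeling $C$, $$P_{(L,C)}(t)=\sum_{c}\mathrm{sgn}(c)\,\bigl(t^{W(c)}-1\bigr)\in\mathbb{Z}[t,t^{-1}],$$ the sum being over all classical crossings. For a knot diagram $K$ this does not depend on the labeling and is written $P_K(t)$; it is the affine index polynomial. Cobordism and concordance. Two oriented virtual knots or links are virtually cobordant if one is obtained from the other by a finite sequence of virtual isotopies, births (introduction of an isolated unknotted circle disjoint from the diagram), deaths (removal of such a circle), and oriented saddle moves (two oppositely oriented arcs adjacent in the plane are replaced by the two oppositely oriented arcs obtained by the oriented resmoothing of that site). Such a sequence determines an abstract compact oriented surface (its schema): a product for each isotopy, a disc attached for each birth or death, and a band attached for each saddle, with boundary the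 two given links. The genus of the cobordism is the genus of this abstract surface. A virtual concordance is a cobordism of genus zero connecting the two knots or links; in the case of knots the schema is a connected genus zero surface with the two knots as boundary, and the pairing condition of part (2) is then automatically satisfied. The pairing condition in part (2) means that births, saddles and deaths form canceling pairs of critical points of the schema, each pair being an amalgamation of a trivial circle into, or a splitting off of a trivial circle from, the rest of the concordance; after canceling all pairs the schema is a product, so every component of the schema is an annulus joining one component of $L$ to one component of $L'$. Corresponding labelings. A labeling $C'$ of $L'$ corresponds to $C$ along the concordance if all intermediate diagrams can be given integer affine labelings, beginning with $C$ and ending with $C'$, such that: under Reidemeister moves and detour moves the labels outside the region of the move are unchanged (the labels inside are then uniquely determined); a newly born circle carries some constant integer label, with all other labels unchanged; at a saddle move the two arcs involved carry the same label and the new diagram inherits the labels; at a death the remaining labels are unchanged. *)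

(* Defs.v *)
From Stdlib Require Import ClassicalEpsilon.
From HB Require Import structures.
From mathcomp Require Import all_boot all_order all_algebra.

Set Implicit Arguments.
Unset Strict Implicit.
Unset Printing Implicit Defensive.

Import GRing.Theory Num.Theory.

(* A generic plane picture, in general position with respect to the height    *)
(* function, is read from bottom to top as a word of events: local minima     *)
(* (Cup), local maxima (Cap) and double points (Cross), one per height.  The  *)
(* layer (i, g) is the event g with exactly i strands passing to its left.    *)
(* The two branches at a double point are called "slash" (bottom left to top  *)
(* right) and "backslash" (bottom right to top left).                         *)
Inductive crossing_kind := SlashOver | BackslashOver | Virtual.

(* Cup o creates two strands, the left one oriented upward iff o = true.      *)
Inductive event := Cup of bool | Cap | Cross of crossing_kind.

Definition layer := (nat * event)%type.
Definition word := seq layer.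

Definition is_classical (k : crossing_kind) : bool :=
  if k is Virtual then false else true.

(* The mirror image in a vertical line, which exchanges slash and backslash.  *)
Definition flip (k : crossing_kind) : crossing_kind :=
  match k with
  | SlashOver => BackslashOver
  | BackslashOver => SlashOver
  | Virtual => Virtual
  end.

Definition ins (g : event) : nat := if g is Cup _ then 0 else 2.
Definition outs (g : event) : nat := if g is Cap then 0 else 2.

(* A horizontal section is the sequence of the orientations (true = upward)   *)
(* of the strands it meets, from left to right.                               *)
Definition apply_event (g : event) (s : seq bool) : option (seq bool) :=
  match g, s with
  | Cup o, [::] => Some [:: o; ~~ o]
  | Cap, [:: a; b] => if a != b then Some [::] else None
  | Cross _, [:: a; b] => Some [:: b; a]
  | _, _ => None
  end.

Definition apply_layer (l : layer) (s : seq bool) : option (seq bool) :=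
  let: (i, g) := l in
  if i <= size s then
    omap (fun s' => take i s ++ s' ++ drop (i + ins g) s)
         (apply_event g (take (ins g) (drop i s)))
  else None.

Fixpoint run (w : word) (s : seq bool) : option (seq bool) :=
  if w is l :: w' then obind (run w') (apply_layer l s) else Some s.

Definition closed_word (w : word) : bool := run w [::] == Some [::].

(* An oriented virtual link diagram.                                          *)
Record diagram := Diagram { word_of :> word; word_of_closed : closed_word word_of }.

(* The point (j, i) is the i-th point, from the left, of the section just     *)
(* above the first j events; every strand of the diagram contains points.     *)
Definition point := (nat * nat)%type.

Definition section (D : word) (j : nat) : seq bool :=
  odflt [::] (run (take j D) [::]).

Definition points (D : word) : seq point :=
  flatten [seq [seq (j, i) | i <- iota 0 (size (section D j))]
          | j <- iota 0 (size D).+1].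

(* Pairs of consecutive points between which no classical crossing is         *)
(* traversed, for the layer l between the sections of index j and j.+1; s is  *)
(* the section of index j.                                                    *)
Definition layer_arc_links (j : nat) (s : seq bool) (l : layer) :
    seq (point * point) :=
  let: (i, g) := l in
  [seq ((j, x), (j.+1, x)) | x <- iota 0 i]
  ++ [seq ((j, x), (j.+1, x - ins g + outs g))
     | x <- iota (i + ins g) (size s - (i + ins g))]
  ++ match g with
     | Cup _ => [:: ((j.+1, i), (j.+1, i.+1))]
     | Cap => [:: ((j, i), (j, i.+1))]
     | Cross Virtual =>
         [:: ((j, i), (j.+1, i.+1)); ((j, i.+1), (j.+1, i))]
     | Cross _ => [::]
     end.

(* The four ends of a classical crossing, named after the picture rotated so  *)
(* that both strands are oriented upward, and whether its sign is +1.         *)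
Record crossing := Crossing {
  left_in : point;
  right_out : point; (* the continuation of left_in *)
  right_in : point;
  left_out : point;  (* the continuation of right_in *)
  positive : bool
}.

(* After the rotation, the strand coming from the left is the slash if the    *)
(* two strands are both upward or both downward, and the backslash otherwise. *)
(* The sign is +1 iff the strand coming from the left is the over-strand.     *)
Definition layer_crossing (j : nat) (s : seq bool) (l : layer) :
    option crossing :=
  let: (i, g) := l in
  let p := nth true s i in
  let q := nth true s i.+1 in
  let slash :=
    if p then ((j, i), (j.+1, i.+1)) else ((j.+1, i.+1), (j, i)) in
  let backslash :=
    if q then ((j, i.+1), (j.+1, i)) else ((j.+1, i), (j, i.+1)) in
  let lr := if p == q then (slash, backslash) else (backslash, slash) in
  let mk sg := Some (Crossing lr.1.1 lr.1.2 lr.2.1 lr.2.2 sg) in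
  match g with
  | Cross SlashOver => mk (p == q)
  | Cross BackslashOver => mk (p != q)
  | _ => None
  end.

Definition indexed_layers (D : word) : seq (nat * layer) :=
  zip (iota 0 (size D)) D.

Definition arc_links (D : word) : seq (point * point) :=
  flatten [seq layer_arc_links jl.1 (section D jl.1) jl.2
          | jl <- indexed_layers D].

Definition crossings (D : word) : seq crossing :=
  pmap (fun jl => layer_crossing jl.1 (section D jl.1) jl.2)
       (indexed_layers D).

Definition curve_links (D : word) : seq (point * point) :=
  arc_links D ++
  flatten [seq [:: (left_in c, right_out c); (right_in c, left_out c)]
          | c <- crossings D].

(* The connected components of the graph with vertices V and edges E (only    *)
(* the edges between vertices in V count), each listed once.                  *)
Definition joined (T : choiceType) (V : seq T) (E : seq (T * T)) :
    rel (seq_sub V) :=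
  connect (fun x y => ((val x, val y) \in E) || ((val y, val x) \in E)).

Definition pieces (T : choiceType) (V : seq T) (E : seq (T * T)) :
    seq (seq T) :=
  [seq [seq val x | x : seq_sub V in A]
  | A : {set seq_sub V} in equivalence_partition (@joined T V E) setT].

(* The components of a link diagram.                                          *)
Definition curves (D : word) : seq (seq point) :=
  pieces (points D) (curve_links D).

Definition is_knot (D : word) : Prop := size (curves D) = 1.

Local Open Scope ring_scope.

(* The tangent of the strand coming from the left, followed by that of the    *)
(* strand coming from the right, is a positively oriented basis.              *)
Definition intersection_number (D : word) (A B : seq point) : int :=
  \sum_(c <- crossings D)
    (((left_in c \in A) && (right_in c \in B))%:Z
     - ((right_in c \in A) && (left_in c \in B))%:Z).

Definition compatible (D : word) : Prop :=
  forall A, A \in curves D ->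
    \sum_(B <- curves D | B != A) intersection_number D A B = 0.

(* Only the values at the points of the diagram matter.                       *)
Definition labeling := point -> int.

(* The first clause says that C is a labeling of the arcs.                    *)
Definition affine_labeling (D : word) (C : labeling) : Prop :=
  (forall x y, (x, y) \in arc_links D -> C x = C y) /\
  (forall j c, onth (crossings D) j = Some c ->
     C (right_out c) = C (left_in c) - 1 /\
     C (left_out c) = C (right_in c) + 1).

Definition sgn (c : crossing) : int := if positive c then 1 else -1.

Definition weight (C : labeling) (c : crossing) : int :=
  let a := C (left_in c) in
  let b := C (right_in c) in
  if positive c then a - (b + 1) else b - (a - 1).

(* Z[t,1/t] is regarded as a subring of the fraction field of Z[t].           *)
Definition laurent_t : {fraction {poly int}} := FracField.tofrac 'X.

Definition affine_polynomial (D : word) (C : labeling) :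
    {fraction {poly int}} :=
  \sum_(c <- crossings D) (sgn c)%:~R * (laurent_t ^ weight C c - 1).

(* A knot diagram has an affine labeling, unique up to an additive constant,  *)
(* and the polynomial does not depend on the one which is chosen.             *)
Definition affine_index_polynomial (K : word) : {fraction {poly int}} :=
  affine_polynomial K (epsilon (inhabits (fun=> 0)) (affine_labeling K)).

Local Close Scope ring_scope.

(* Two words between the same sections, with the same number of strands to    *)
(* their left.  Exchange, the zigzags and the slides generate planar isotopy: *)
(* they are the codimension one accidents of the height function, namely two  *)
(* events at the same height, a degenerate critical point, and a double point *)
(* running through an extremum of one of its branches.                        *)
Inductive isotopy_move : word -> word -> Prop :=
| Exchange i j g h : i + outs g <= j ->
    isotopy_move [:: (i, g); (j, h)] [:: (j - outs g + ins g, h); (i, g)]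
| ZigzagLeft i o :
    isotopy_move [:: (i, Cup o); (i.+1, Cap)] [::]
| ZigzagRight i o :
    isotopy_move [:: (i.+1, Cup o); (i, Cap)] [::]
| SlideCap i k :
    isotopy_move [:: (i, Cross k); (i.+1, Cap)]
                 [:: (i.+1, Cross (flip k)); (i, Cap)]
| SlideCup i o k :
    isotopy_move [:: (i.+1, Cup o); (i, Cross k)]
                 [:: (i, Cup o); (i.+1, Cross (flip k))]
| ReidemeisterIRight i o k : is_classical k ->
    isotopy_move [:: (i.+1, Cup o); (i, Cross k); (i.+1, Cap)] [::]
| ReidemeisterILeft i o k : is_classical k ->
    isotopy_move [:: (i, Cup o); (i.+1, Cross k); (i, Cap)] [::]
| ReidemeisterII i k : is_classical k ->
    isotopy_move [:: (i, Cross k); (i, Cross (flip k))] [::]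
(* k12 is the crossing of the first and the second of the three strands, etc; *)
(* when k12 = k23 = flip k13, no strand is above the two others.              *)
| ReidemeisterIII i k12 k13 k23 :
    is_classical k12 -> is_classical k13 -> is_classical k23 ->
    ~ (k12 = k23 /\ k13 = flip k12) ->
    isotopy_move [:: (i, Cross k12); (i.+1, Cross k13); (i, Cross k23)]
                 [:: (i.+1, Cross k23); (i, Cross k13); (i.+1, Cross k12)].

(* A diagram with a marked sub-arc.  The boolean attached to an event tells,  *)
(* for a Cup, whether it belongs to the sub-arc (it is ignored for the other  *)
(* events); End i is an end of the sub-arc on the strand of index i, and does *)
(* not count as an event of the underlying diagram.                           *)
Inductive marked_layer := Event of bool & layer | End of nat.

Definition marked_word := seq marked_layer.

Definition underlying (a : marked_word) : word :=
  pmap (fun l => if l is Event _ l' then Some l' else None) a.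

(* Strands carry their orientation and whether they are marked.  A marked     *)
(* strand has no classical crossing.                                          *)
Definition apply_marked_event (f : bool) (g : event) (s : seq (bool * bool)) :
    option (seq (bool * bool)) :=
  match g, s with
  | Cup o, [::] => Some [:: (o, f); (~~ o, f)]
  | Cap, [:: a; b] =>
      if (a.1 != b.1) && (a.2 == b.2) then Some [::] else None
  | Cross k, [:: a; b] =>
      if is_classical k && (a.2 || b.2) then None else Some [:: b; a]
  | _, _ => None
  end.

Definition apply_marked_layer (l : marked_layer) (s : seq (bool * bool)) :
    option (seq (bool * bool)) :=
  match l with
  | Event f (i, g) =>
      if i <= size s then
        omap (fun s' => take i s ++ s' ++ drop (i + ins g) s)
             (apply_marked_event f g (take (ins g) (drop i s)))
      else None
  | End i =>
      if drop i s is a :: s' then Some (take i s ++ (a.1, ~~ a.2) :: s')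
      else None
  end.

Fixpoint marked_run (a : marked_word) (s : seq (bool * bool)) :
    option (seq (bool * bool)) :=
  if a is l :: a' then obind (marked_run a') (apply_marked_layer l s)
  else Some s.

Definition marked_section (a : marked_word) (k : nat) : seq (bool * bool) :=
  odflt [::] (marked_run (take k a) [::]).

Definition is_marked (s : seq (bool * bool)) (i : nat) : bool :=
  (nth (true, false) s i).2.

Definition unmarked_before (s : seq (bool * bool)) (i : nat) : nat :=
  count (fun x => ~~ x.2) (take i s).

(* What is left when the sub-arc is erased: the events which do not involve   *)
(* it, and its two ends.  LooseEnd i o b is an end at position i, on a strand *)
(* of orientation o, the sub-arc leaving the end downward iff b = true.       *)
Inductive erased_layer :=
| Kept of layer
| LooseEnd of nat & bool & bool.

Definition erase_layer (l : marked_layer) (s : seq (bool * bool)) :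
    option erased_layer :=
  match l with
  | Event f (i, g) =>
      let erased :=
        match g with
        | Cup _ => f
        | Cap => is_marked s i
        | Cross _ => is_marked s i || is_marked s i.+1
        end in
      if erased then None else Some (Kept (unmarked_before s i, g))
  | End i =>
      Some (LooseEnd (unmarked_before s i) (nth (true, false) s i).1
                     (is_marked s i))
  end.

Definition erase (a : marked_word) : seq erased_layer :=
  pmap (fun kl => erase_layer kl.2 (marked_section a kl.1))
       (zip (iota 0 (size a)) a).

(* The points of the underlying diagram which are not erased, each with its   *)
(* height and position in the erased picture.                                 *)
Definition unerased (a : marked_word) : seq (point * point) :=
  flatten
    [seq [seq ((size (underlying (take k a)), i),
               (size (erase (take k a)), unmarked_before (marked_section a k) i))
         | i <- iota 0 (size (marked_section a k))
         & ~~ is_marked (marked_section a k) i]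
    | k <- iota 0 (size a).+1].

(* Having two ends, the marked part is one arc plus possibly some closed      *)
(* curves; the last clause forbids the latter.                                *)
Definition marked_arc (a : marked_word) : Prop :=
  [/\ marked_run a [::] = Some [::],
      count (fun l => if l is End _ then true else false) a = 2 &
      forall A, A \in curves (underlying a) ->
        has (mem (unzip1 (unerased a))) A].

(* Elementary moves of a cobordism.  The word u is below the site of the move *)
(* and the word v is above.                                                   *)
(* - Isotopy u m m' v replaces m by m', or conversely.                        *)
(* - Detour a a' redraws the marked arc of a as that of a'.                   *)
(* - Birth and Death create and remove a circle with i strands to its left.   *)
(* - Saddle u i o b v replaces, if b = true, two vertical strands by a        *)
(*   maximum below a minimum, and does the reverse if b = false.              *)
Inductive move :=
| Isotopy of word & word & word & word
| Detour of marked_word & marked_word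
| Birth of word & nat & bool & word
| Death of word & nat & bool & word
| Saddle of word & nat & bool & bool & word.

Definition circle (i : nat) (o : bool) : word := [:: (i, Cup o); (i, Cap)].
Definition turnbacks (i : nat) (o : bool) : word := [:: (i, Cap); (i, Cup o)].

Definition site (mv : move) : word * word * word * word :=
  match mv with
  | Isotopy u m m' v => (u, m, m', v)
  | Detour a a' => ([::], underlying a, underlying a', [::])
  | Birth u i o v => (u, [::], circle i o, v)
  | Death u i o v => (u, circle i o, [::], v)
  | Saddle u i o b v =>
      if b then (u, [::], turnbacks i o, v) else (u, turnbacks i o, [::], v)
  end.

Definition source (mv : move) : word :=
  let: (u, m, _, v) := site mv in u ++ m ++ v.
Definition target (mv : move) : word :=
  let: (u, _, m', v) := site mv in u ++ m' ++ v.

(* The second clause says that the new strands fit, with their orientations,  *)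
(* in the place of the old ones; for a saddle, it forces the two arcs to have *)
(* opposite orientations.                                                     *)
Definition valid_move (mv : move) : Prop :=
  [/\ closed_word (source mv),
      let: (u, m, m', _) := site mv in
      obind (run m) (run u [::]) = obind (run m') (run u [::]) &
      match mv with
      | Isotopy _ m m' _ => isotopy_move m m' \/ isotopy_move m' m
      | Detour a a' => [/\ marked_arc a, marked_arc a' & erase a = erase a']
      | _ => True
      end].

(* x in the source and y in the target are the same point, not moved by mv.   *)
Definition same_point (mv : move) (x y : point) : bool :=
  [&& x \in points (source mv), y \in points (target mv) &
    match mv with
    | Detour a a' =>
        has (fun xe => (xe.1 == x) && ((y, xe.2) \in unerased a')) (unerased a)
    | _ =>
        let: (u, m, m', _) := site mv in
        ((x.1 <= size u) && (y == x)) ||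
        ((size u + size m <= x.1) && (y == (x.1 - size m + size m', x.2)))
    end].

(* M is a sequence of moves leading from D to D'.                             *)
Fixpoint cobordism (D : word) (M : seq move) (D' : word) : Prop :=
  if M is mv :: M' then
    [/\ valid_move mv, source mv = D & cobordism (target mv) M' D']
  else D = D'.

Definition movie (D : word) (M : seq move) (k : nat) : word :=
  nth [::] (D :: map target M) k.

(* The schema is described by the points (k, x) of its levels, x being a      *)
(* point of the k-th diagram of the movie.  A birth or death caps off a       *)
(* circle which is linked to no point of the diagram before or after it.      *)
Definition schema_points (D : word) (M : seq move) : seq (nat * point) :=
  flatten [seq [seq (k, x) | x <- points (movie D M k)]
          | k <- iota 0 (size M).+1].

Definition schema_links (D : word) (M : seq move) :
    seq ((nat * point) * (nat * point)) :=
  flatten [seq [seq ((k, e.1), (k, e.2)) | e <- curve_links (movie D M k)]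
          | k <- iota 0 (size M).+1]
  ++ flatten [seq [seq ((kmv.1, e.1), (kmv.1.+1, e.2))
                  | e <- [seq (x, y) | x <- points (source kmv.2),
                                       y <- points (target kmv.2)]
                  & same_point kmv.2 e.1 e.2]
             | kmv <- zip (iota 0 (size M)) M].

(* The connected components of the part of the schema between the diagrams of *)
(* index k and k'.                                                            *)
Definition schema_between (D : word) (M : seq move) (k k' : nat) :
    seq (seq (nat * point)) :=
  pieces [seq x <- schema_points D M | k <= x.1 <= k'] (schema_links D M).

Definition schema (D : word) (M : seq move) : seq (seq (nat * point)) :=
  schema_between D M 0 (size M).

Definition is_extremum (mv : move) : bool :=
  match mv with Birth _ _ _ _ | Death _ _ _ _ => true | _ => false end.
Definition is_saddle (mv : move) : bool :=
  if mv is Saddle _ _ _ _ _ then true else false.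

(* The schema is obtained from annuli by attaching discs and bands.           *)
Definition euler_char (M : seq move) : int :=
  ((count is_extremum M)%:Z - (count is_saddle M)%:Z)%R.

(* A compact oriented surface with c components, b boundary circles and genus *)
(* g (the sum of the genera of its components) has Euler characteristic       *)
(* 2c - 2g - b.                                                               *)
Definition has_genus (D : word) (M : seq move) (g : nat) : Prop :=
  (euler_char M =
     (2 * size (schema D M))%:Z - (2 * g)%:Z
     - (size (curves D) + size (curves (movie D M (size M))))%:Z)%R.

Definition connected_schema (D : word) (M : seq move) : Prop :=
  size (schema D M) = 1.

Definition knots_concordant (K K' : word) : Prop :=
  exists M, [/\ cobordism K M K', connected_schema K M & has_genus K M 0].

(* One point on each of the two vertical strands (b = true), respectively of  *)
(* the maximum and of the minimum (b = false), involved in a saddle.          *)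
Definition feet (u : word) (i : nat) (b : bool) : point * point :=
  if b then ((size u, i), (size u, i.+1))
  else ((size u, i), ((size u).+2, i)).

(* The move of index e (birth or death) and the move of index s (saddle) are  *)
(* a canceling pair.  If e is a birth, the saddle attaches to the rest of the *)
(* surface a piece of the part of the schema below it, which contains the     *)
(* circle born at e and no component of the initial diagram (so that, after   *)
(* cancellation of the other pairs, this piece is a trivial circle capped by  *)
(* a disc), the two feet of the saddle not being both in that piece.  If e is *)
(* a death, the same holds upside down.                                       *)
Definition canceling_pair (D : word) (M : seq move) (e s : nat) : Prop :=
  match onth M e, onth M s with
  | Some (Birth u i _ _), Some (Saddle u' i' _ b _) =>
      let f := feet u' i' b in
      exists2 A, A \in schema_between D M 0 s &
        [/\ (e.+1, ((size u).+1, i)) \in A,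
            all (fun x => x.1 != 0) A &
            ((s, f.1) \in A) != ((s, f.2) \in A)]
  | Some (Death u i _ _), Some (Saddle u' i' _ b _) =>
      let f := feet u' i' (~~ b) in
      exists2 A, A \in schema_between D M s.+1 (size M) &
        [/\ (e, ((size u).+1, i)) \in A,
            all (fun x => x.1 != size M) A &
            ((s.+1, f.1) \in A) != ((s.+1, f.2) \in A)]
  | _, _ => False
  end.

Definition indices (p : pred move) (M : seq move) : seq nat :=
  [seq km.1 | km <- zip (iota 0 (size M)) M & p km.2].

Definition critical_points_cancel (D : word) (M : seq move) : Prop :=
  exists pairs : seq (nat * nat),
    [/\ perm_eq (unzip1 pairs) (indices is_extremum M),
        perm_eq (unzip2 pairs) (indices is_saddle M) &
        forall e s, (e, s) \in pairs -> canceling_pair D M e s].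

(* C' corresponds to C along M: all the diagrams of the movie have affine     *)
(* labelings, which agree at the points not moved.  At a saddle, this forces  *)
(* the labels of the two arcs to be equal, as each of them is joined by both  *)
(* new arcs; a newly born circle may have any label.                          *)
Fixpoint corresponds (D : word) (M : seq move) (C C' : labeling) : Prop :=
  affine_labeling D C /\
  if M is mv :: M' then
    exists2 C1 : labeling,
      (forall x y, same_point mv x y -> C x = C1 y) &
      corresponds (target mv) M' C1 C'
  else {in points D, C =1 C'}.

(* Main.v *)
Require Import Defs.
From Stdlib Require Import Classical ClassicalEpsilon.
From mathcomp Require Import all_boot all_order all_algebra.
From mathcomp Require Import ring zify.

Set Implicit Arguments.
Unset Strict Implicit.
Unset Printing Implicit Defensive.

Import Order.TTheory GRing.Theory Num.Theory.

Local Open Scope ring_scope.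

(** The affine index polynomial is a state sum: an affine labeling obeys a
    local rule at each crossing, and each crossing contributes a value which
    depends on its sign and on its two incoming labels. Rule and values satisfy
    the identities of a biquandle with a 2-cocycle, recorded in
    [labeling_rule]. For any such rule a labeling of a diagram extends uniquely
    across a planar isotopy, a Reidemeister move or a detour, and the sum does
    not change ([move_extend], [move_unique], [move_sum]). Births and deaths
    are harmless too, and a saddle only requires its two arcs to carry the same
    label. So everything reduces to choosing, above a given labeling of the
    first diagram, the labels of the new circles in such a way that labels
    agree at every saddle ([good_chain]).

    Suppose that labels are chosen below a saddle. Two situations are favorable
    ([good_saddle]). If a union of components of the schema below the saddle
    misses the initial diagram and contains exactly one of the two feet, adding
    a constant to the labels on it makes the labels of the feet equal. If a
    union of components of the schema above the saddle misses the final diagram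
    and contains exactly one of the two new arcs, the labels of the feet are
    equal already. Indeed the algebraic intersection number of that part with
    the rest of the diagram is itself a state sum, for the rule of
    two-colorings ([coloring_rule]); it is therefore constant along the movie
    above the saddle, and it vanishes at the end. On the other hand, adding
    orientation times label over the colored strands of a horizontal section
    and following the result from the bottom to the top of the picture shows
    that this intersection number is, up to sign, the difference of the labels
    of the feet: a discrete form of Stokes' formula ([saddle_stokes]).

    For links, the canceling pairs provide such unions of components at once
    ([cancel_good]). For knots they come from genus zero. A graph with c
    components has 2^c two-colorings that are constant on components, so
    injections between sets of colorings compare numbers of components
    ([pieces_count]). In this way the genus of the part of the schema below a
    level is seen not to decrease when the level rises, and that of the part
    above a level not to decrease when the level sinks ([extension_count]).
    When the total genus is zero, equality holds at each saddle in both
    inequalities. From below, this means that the feet are separated below the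
    saddle or the new arcs lie on different curves; from above, that the new
    arcs are separated above the saddle or the feet lie on different curves. A
    saddle cannot both join two curves and produce two curves, again by Stokes'
    formula ([feet_separated]); so one of the favorable situations occurs, up
    to complementing a coloring to make it vanish on the knot at the end
    ([genus_zero_good]).

    The polynomial of a knot refers to some affine labeling, which has to
    exist. A diagram has as many links as points, and setting one link of a
    knot aside does not disconnect its points, by Stokes' formula for constant
    labels; the other links then form a tree, so that some labels satisfy them
    all, and Stokes' formula for these labels gives the last link
    ([knot_labeling]). Two labelings of a knot differ by a constant, which the
    polynomial ignores ([knot_polynomial_unique]). *)

(** * Labeling rules and labeled sections *)

(** A strand labeled x becomes [shift o x] when it crosses a strand of
    orientation o which starts on its left, whichever passes over. The shifts
    play the part of a biquandle, and the axioms on values are those which make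
    their sum insensitive to kinks and to a pair of crossings which undo each
    other. Invariance under simultaneous shifts is what the third Reidemeister
    move uses. Besides the affine rule itself, the rules with zero shift are
    used: they describe integers, or colors, constant along curves. *)
Record labeling_rule := LabelingRule {
  label : eqType;
  shift : bool -> label -> label;
  value : zmodType;
  crossing_value : bool -> label -> label -> value;
  shiftK : forall o, cancel (shift o) (shift (~~ o));
  crossing_value_shift : forall s o l r,
    crossing_value s (shift o l) (shift o r) = crossing_value s l r;
  crossing_value_kink : forall s l, crossing_value s l (shift false l) = 0;
  crossing_value_undo : forall s l r,
    crossing_value s l r
    + crossing_value (~~ s) (shift true r) (shift false l) = 0 }.

Arguments shift {l} o x : rename.

Section Transport.

Variable r : labeling_rule.
Notation X := (label r).
Notation strand := (bool * X)%type.
Implicit Types (S T : seq strand) (rows : seq (seq strand)) (w : word).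

Lemma shiftKV o : cancel (@shift r (~~ o)) (shift o).
Proof. by move=> x; rewrite -{1}(negbK o) shiftK. Qed.

Lemma shift_inj o : injective (@shift r o).
Proof. exact: can_inj (shiftK o). Qed.

Lemma shiftC p q (x : X) : shift p (shift q x) = shift q (shift p x).
Proof.
by case: p; case: q => //; rewrite (shiftK true x) (shiftK false x).
Qed.

(** For a crossing rotated so that both strands go up, the strand coming from
    the left loses a unit and the other gains one. Undoing the rotation, the
    change of a label, read from bottom to top, depends only on the orientation
    of the other strand and on the side from which it comes. *)
Definition cross (k : crossing_kind) (A B : strand) : seq strand :=
  if is_classical k
  then [:: (B.1, shift A.1 B.2); (A.1, shift (~~ B.1) A.2)] else [:: B; A].

Definition event_step (g : event) (S T : seq strand) : Prop :=
  match g, S with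
  | Cup o, _ => exists x, T = [:: (o, x), (~~ o, x) & S]
  | Cap, [:: A, B & S'] => B = (~~ A.1, A.2) /\ T = S'
  | Cross k, [:: A, B & S'] => T = cross k A B ++ S'
  | _, _ => False
  end.

(** Recursion on the position i, rather than a cut of the section at i, makes a
    layer at position i.+1 the same as a layer at position i with one more
    strand on the left; local moves need then be studied at position 0 only. *)
Fixpoint step_at (i : nat) (g : event) (S T : seq strand) : Prop :=
  match i, S, T with
  | 0, _, _ => event_step g S T
  | i'.+1, A :: S', B :: T' => A = B /\ step_at i' g S' T'
  | _, _, _ => False
  end.

Definition step (l : layer) := step_at l.1 l.2.

Definition kind_sign (k : crossing_kind) (p q : bool) : bool :=
  if k is SlashOver then p == q else p != q.

(** The value refers to the incoming labels of the rotated picture. For a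
    strand oriented downward this is the label above the crossing, which is
    obtained from the label below by the shift. *)
Definition cross_value (k : crossing_kind) (A B : strand) : value r :=
  if ~~ is_classical k then 0 else
  let s := kind_sign k A.1 B.1 in
  match A.1, B.1 with
  | true, true => crossing_value s A.2 B.2
  | false, false => crossing_value s (shift true A.2) (shift false B.2)
  | true, false => crossing_value s (shift true B.2) A.2
  | false, true => crossing_value s B.2 (shift false A.2)
  end.

Definition event_value (g : event) (S : seq strand) : value r :=
  if g is Cross k then if S is [:: A, B & _] then cross_value k A B else 0
  else 0.

Definition step_value (l : layer) (S : seq strand) : value r :=
  event_value l.2 (drop l.1 S).

(** The rows are the labeled sections above each of the layers of w, the
    section S below the first one being excluded. *)
Fixpoint lpath (w : word) (S : seq strand) rows : Prop :=
  match w, rows with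
  | [::], [::] => True
  | l :: w', T :: rows' => step l S T /\ lpath w' T rows'
  | _, _ => False
  end.

Fixpoint lpath_value (w : word) (S : seq strand) rows : value r :=
  match w, rows with
  | l :: w', T :: rows' => step_value l S + lpath_value w' T rows'
  | _, _ => 0
  end.

Lemma lpath_size w S rows : lpath w S rows -> size rows = size w.
Proof. by elim: w S rows => [|l w IH] S [|T rows] //= [_ /IH ->]. Qed.

Lemma lpath_cat u v S ru rv : size ru = size u ->
  lpath (u ++ v) S (ru ++ rv) <-> lpath u S ru /\ lpath v (last S ru) rv.
Proof.
elim: u S ru => [|l u IH] S [|T ru] //= => [_|[e]]; first by split=> // -[].
by rewrite IH //; tauto.
Qed.

Lemma lpath_value_cat u v S ru rv : size ru = size u ->
  lpath_value (u ++ v) S (ru ++ rv)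
  = lpath_value u S ru + lpath_value v (last S ru) rv.
Proof.
elim: u S ru => [|l u IH] S [|T ru] //= => [_|[e]]; first by rewrite add0r.
by rewrite IH // addrA.
Qed.

(** Sliding a double point through an extremum of the first strand replaces
    this strand by its other branch, of opposite orientation and with the label
    found on the other side of the crossing. The rotated picture is the same. *)
Lemma cross_value_slide k p q (a b : X) :
  cross_value k (p, a) (q, b)
  = cross_value (flip k) (q, b) (~~ p, shift (~~ q) a).
Proof.
rewrite /cross_value; case: k => //=; case: p; case: q => //=;
by rewrite ?(shiftK true) ?(shiftK false).
Qed.

Lemma cross_value_kink k p (a : X) :
  cross_value k (p, a) (p, shift (~~ p) a) = 0.
Proof.
rewrite /cross_value; case: k => //=; case: p => //=;
by rewrite crossing_value_kink.
Qed.

(** The form of the cocycle identity in which the labels of the second crossing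
    are only known up to equations, as the orientations of the strands produce
    them in four different shapes. *)
Lemma crossing_value_cancel s t l l2 m m2 : t = ~~ s ->
  l2 = shift true m -> m2 = shift false l ->
  crossing_value s l m + crossing_value t l2 m2 = 0 :> value r.
Proof. by move=> -> -> ->; apply: crossing_value_undo. Qed.

Lemma cross_value_undo k p q (a b : X) :
  cross_value k (p, a) (q, b)
  + cross_value (flip k) (q, shift p b) (p, shift (~~ q) a) = 0.
Proof.
rewrite /cross_value; case: k => /=; rewrite ?addr0 //; case: p; case: q => /=;
by apply: crossing_value_cancel; rewrite ?(shiftK true) ?(shiftK false).
Qed.

Lemma cross_value_shift k p q o (a b : X) :
  cross_value k (p, shift o a) (q, shift o b) = cross_value k (p, a) (q, b).
Proof.
rewrite /cross_value; case: k => //=; case: p; case: q => //=;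
by rewrite ?[shift _ (shift o _)]shiftC crossing_value_shift.
Qed.

Definition indent : word -> word := map (fun l => (l.1.+1, l.2)).

Lemma lpath_indent w A S rows :
  lpath (indent w) (A :: S) rows <->
  exists2 rows', rows = map (cons A) rows' & lpath w S rows'.
Proof.
split.
  elim: w S rows => [|[i g] w IH] S [|T rows] //=; first by exists [::].
  case; case: T => //= B T [<- st] /IH [rows' -> pw].
  by exists (T :: rows').
case=> rows' ->; elim: w S rows' => [|[i g] w IH] S [|T rows'] //= [st pw].
by split=> //; apply: IH.
Qed.

Lemma lpath_indent_nil w rows : w <> [::] -> ~ lpath (indent w) [::] rows.
Proof. by case: w => [|l w] //= _; case: rows => [|T rows] //= [[]]. Qed.

Lemma lpath_value_indent w A S rows :
  lpath_value (indent w) (A :: S) (map (cons A) rows) = lpath_value w S rows.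
Proof.
by elim: w S rows => [|[i g] w IH] S [|T rows] //=; rewrite IH.
Qed.

Lemma last_map_cons (A : strand) S rows :
  last (A :: S) (map (cons A) rows) = A :: last S rows.
Proof. by rewrite last_map. Qed.

Lemma apply_layer_indent (l : layer) o s :
  apply_layer (l.1.+1, l.2) (o :: s) = omap (cons o) (apply_layer l s).
Proof.
by case: l => i g /=; rewrite ltnS; case: ifP => //= _; case: apply_event.
Qed.

Lemma run_indent w o s : run (indent w) (o :: s) = omap (cons o) (run w s).
Proof.
elim: w s => [|l w IH] s //.
rewrite [indent _]/= [LHS]/= -/(apply_layer (l.1.+1, l.2) (o :: s))
  apply_layer_indent [RHS]/=.
by case: (apply_layer l s) => //= s'; apply: IH.
Qed.

Lemma run_indent_nil w s : run (indent w) [::] = Some s -> w = [::].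
Proof. by case: w => [|[i g] w]. Qed.

(** The second word is required to fit between the same orientations; without
    this, a zigzag could not replace the empty word. *)
Definition transports (m m' : word) := forall S rows,
  lpath m S rows -> run m' (unzip1 S) = Some (unzip1 (last S rows)) ->
  exists rows', [/\ lpath m' S rows', last S rows' = last S rows &
    lpath_value m' S rows' = lpath_value m S rows].

Definition rigid (m : word) := forall S rows rows',
  lpath m S rows -> lpath m S rows' -> last S rows = last S rows' ->
  rows = rows'.

Lemma transports_indent m m' : transports m m' ->
  transports (indent m) (indent m').
Proof.
move=> tr [|A S] rows.
  case: m tr => [|l m] tr; last by move=> /lpath_indent_nil; case.
  case: rows => //= _ /run_indent_nil ->; by exists [::].
case/lpath_indent=> rows' -> pm; rewrite last_map_cons /= run_indent.
case E: run => [s|] //= [es]; rewrite {}es in E.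
have [rows'' [p1 p2 p3]] := tr _ _ pm E.
exists (map (cons A) rows''); rewrite last_map_cons p2 !lpath_value_indent;
  split=> //.
by apply/lpath_indent; exists rows''.
Qed.

Lemma rigid_indent m : rigid m -> rigid (indent m).
Proof.
move=> ri [|A S] rows rows'.
  by case: m ri => [|l m] ri; [case: rows rows' => [|? ?] [] |
    move=> /lpath_indent_nil; case].
case/lpath_indent=> r1 -> p1 /lpath_indent [r2 -> p2].
by rewrite !last_map_cons => -[/(ri _ _ _ p1 p2) ->].
Qed.

End Transport.

(** * Planar isotopy and Reidemeister moves transport labels *)

Section LocalMoves.

Variable r : labeling_rule.
Notation X := (label r).
Notation strand := (bool * X)%type.
Implicit Types (S T : seq strand) (rows : seq (seq strand)) (w : word).

Lemma lpath0 S rows : lpath (r := r) [::] S rows <-> rows = [::].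
Proof. by case: rows. Qed.

Lemma lpath2 l l' S rows : lpath [:: l; l'] S rows <->
  exists T T', [/\ rows = [:: T; T'], step l S T & step l' T T'].
Proof.
split; last by case=> T [T' [-> ? ?]] /=.
by case: rows => [|T [|T' [|? ?]]] //= [] // ? [] // ? _; exists T, T'.
Qed.

Lemma lpath3 l l' l'' S rows : lpath [:: l; l'; l''] S rows <->
  exists T T' T'', [/\ rows = [:: T; T'; T''], step l S T, step l' T T' &
    step l'' T' T''].
Proof.
split; last by case=> T [T' [T'' [-> ? ? ?]]] /=.
by case: rows => [|T [|T' [|T'' [|? ?]]]] //= [] // ? [] // ? [] // ? _;
  exists T, T', T''.
Qed.

Lemma step_skip2 j h A B S T : step (j.+2, h) [:: A, B & S] T <->
  exists2 T', T = [:: A, B & T'] & step (j, h) S T'.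
Proof.
split; last by case=> T' ->.
by case: T => [|A' [|B' T]] //= [->]; [case | case=> -> ?; exists T].
Qed.

(** Two distant events do not see each other; the higher one is moved by the
    strands which the lower one creates or removes. *)
Lemma exchange_forth j g h : (outs g <= j)%N ->
  transports r [:: (0, g); (j, h)] [:: ((j - outs g + ins g)%N, h); (0, g)].
Proof.
move=> le S rows /lpath2 [T [T' [-> s1 s2]]] _.
suff [U s3 [s4 ev]] : exists2 U, step ((j - outs g + ins g)%N, h) S U &
  step (0, g) U T' /\ step_value (0, g) S + step_value (j, h) T =
  step_value ((j - outs g + ins g)%N, h) S + step_value (0, g) U.
  by exists [:: U; T']; split=> //=; rewrite !addr0 ev.
case: g le s1 => [o||k]; [case: j s2 => [|[|j]] //|move=> _|case: j s2 =>
  [|[|j]] //].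
- move=> s2 _ /= [x eT]; rewrite {}eT in s2 *; have [T1 -> s3] :=
  iffLR (step_skip2 _ _ _ _ _ _) s2.
  exists T1; rewrite !(subSS, subn0, addn0) //; split; first by exists x.
  by rewrite /step_value /= !(addr0, add0r).
- case: S => [|A [|B S]] //= [eB eT]; rewrite {}eT {}eB in s2 *.
  exists [:: A, (~~ A.1, A.2) & T']; rewrite subn0 addn2 //; split=> //.
  by rewrite /step_value /= !(addr0, add0r).
- case: S => [|A [|B S]] //= s2 _ eT; rewrite {}eT in s2 *.
  rewrite !(subSS, subn0) addn2.
  have [B' [A' eAB]] : exists B' A', cross k A B = [:: B'; A'].
    by rewrite /cross; case: ifP => _; do 2!eexists.
  rewrite eAB in s2 *; have [T1 -> s3] := iffLR (step_skip2 _ _ _ _ _ _) s2.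
  exists [:: A, B & T1]; first by apply/step_skip2; exists T1.
  by rewrite /step /= eAB /step_value /= addrC.
Qed.

Lemma exchange_back j g h : (outs g <= j)%N ->
  transports r [:: ((j - outs g + ins g)%N, h); (0, g)] [:: (0, g); (j, h)].
Proof.
move=> le S rows /lpath2 [U [T' [-> s1 s2]]] _.
suff [T s3 [s4 ev]] : exists2 T, step (0, g) S T &
  step (j, h) T T' /\ step_value (0, g) S + step_value (j, h) T =
  step_value ((j - outs g + ins g)%N, h) S + step_value (0, g) U.
  by exists [:: T; T']; split=> //=; rewrite !addr0 ev.
case: g le s1 s2 => [o||k]; [case: j => [|[|j]] //|move=> _|case: j => [|[|j]]
  //].
- rewrite !(subSS, subn0, addn0) => _ s1 /= [x ->].
  exists [:: (o, x), (~~ o, x) & S]; first by exists x.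
  by rewrite /step_value /= !(addr0, add0r).
- rewrite subn0 addn2; case: S => [|A [|B S]] // s1; first by case: U s1 =>
  // ? ? [].
  have [T1 -> s3] := iffLR (step_skip2 _ _ _ _ _ _) s1 => -[-> ->].
  exists S => //; split=> //.
  by rewrite /step_value /= !(addr0, add0r).
- rewrite !(subSS, subn0) addn2; case: S => [|A [|B S]] // _ s1;
  first by case: U s1 => // ? ? [].
  have [T1 -> s3] := iffLR (step_skip2 _ _ _ _ _ _) s1 => -> /=.
  have [B' [A' eAB]] : exists B' A', cross k A B = [:: B'; A'].
    by rewrite /cross; case: ifP => _; do 2!eexists.
  exists (cross k A B ++ S) => //; rewrite eAB; split=> //.
  by rewrite /step_value /= addrC.
Qed.

Lemma zigzagL_path o S rows : lpath [:: (0, Cup o); (1, Cap)] S rows ->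
  exists A S', [/\ S = A :: S', A.1 = o &
    rows = [:: [:: A, (~~ A.1, A.2), A & S']; S]].
Proof.
case/lpath2=> T [T' [-> [x ->]]].
case: S T' => [|[a y] S] [|B T'] //= []; first by move=> _ [].
move=> <- [[-> <-]]; rewrite negbK => <-.
by exists (o, y), T'.
Qed.

Lemma zigzagR_path o S rows : lpath [:: (1, Cup o); (0, Cap)] S rows ->
  exists A S', [/\ S = A :: S', A.1 = ~~ o &
    rows = [:: [:: A, (~~ A.1, A.2), A & S']; S]].
Proof.
case/lpath2=> T [T' [-> ]].
case: S T => [|[a y] S] [|B T] //= [<- [x ->]] [[-> ->] ->]; rewrite ?negbK.
by exists (a, y), S; rewrite ?negbK.
Qed.

Lemma kinkR_path o k S rows : is_classical k ->
  lpath [:: (1, Cup o); (0, Cross k); (1, Cap)] S rows ->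
  exists A S', [/\ S = A :: S', A.1 = o &
    let x := shift (~~ o) A.2 in
    rows = [:: [:: A, (o, x), (~~ o, x) & S']; [:: A, (o, x), (~~ o, x) & S'];
      S]].
Proof.
move=> ck /lpath3 [T [T' [T'' [->]]]].
case: S T => [|[a y] S] [|B T] //= [<- [x ->]]; rewrite /step /= /cross ck /= =>
  ->.
case: T'' => [|C T''] //= [<-] [[e ->] ->].
have {e} e : a = o by case: (o) (a) e => [] [].
rewrite e; exists (o, y), S; split=> //; by rewrite shiftKV.
Qed.

Lemma kinkL_path o k S rows : is_classical k ->
  lpath [:: (0, Cup o); (1, Cross k); (0, Cap)] S rows ->
  exists A S', [/\ S = A :: S', A.1 = ~~ o &
    let x := shift (~~ o) A.2 in
    rows = [:: [:: (o, x), (~~ o, x), A & S']; [:: (o, x), (~~ o, x), A & S'];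
      S]].
Proof.
move=> ck /lpath3 [T [T' [T'' [-> [x ->]]]]].
case: S T' => [|[a y] S] [|B T'] //=; first by case.
rewrite /step /= /cross ck /= => -[<- ->] /= [[-> <-]] ->.
by exists (~~ o, y), S; split; rewrite // shiftK.
Qed.

Local Ltac run_simpl := rewrite /=; do 4 (rewrite ?drop0 ?take0 /=).

Lemma transports_to_zigzagL o : transports r [::] [:: (0, Cup o); (1, Cap)].
Proof.
move=> S rows /lpath0 ->; case: S => [|[a x] S] //=.
run_simpl; case: ifP => //= /eqP ne _.
have -> : a = o by case: (o) a ne => [] [].
exists [:: [:: (o, x), (~~ o, x), (o, x) & S]; (o, x) :: S]; split=> //=.
  by rewrite /step /=; split; [exists x | rewrite negbK].
by rewrite /step_value /= !addr0.
Qed.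

Lemma transports_to_zigzagR o : transports r [::] [:: (1, Cup o); (0, Cap)].
Proof.
move=> S rows /lpath0 ->; case: S => [|[a x] S] //=.
run_simpl; case: ifP => //= ne _.
have -> : a = ~~ o by case: (o) a ne => [] [].
exists [:: [:: (~~ o, x), (o, x), (~~ o, x) & S]; (~~ o, x) :: S]; split=> //=.
  by rewrite /step /=; split; [split=> //; exists x | rewrite negbK].
by rewrite /step_value /= !addr0.
Qed.

Lemma transports_to_kinkR o k : is_classical k ->
  transports r [::] [:: (1, Cup o); (0, Cross k); (1, Cap)].
Proof.
move=> ck S rows /lpath0 ->; case: S => [|[a x] S] //=.
run_simpl; case: ifP => //= ne _.
have -> : a = o by case: (o) a ne => [] [].
set y := shift (~~ o) x.
exists [:: [:: (o, x), (o, y), (~~ o, y) & S];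
  [:: (o, x), (o, y), (~~ o, y) & S]; (o, x) :: S]; split=> //.
  by rewrite /= /step /= /cross ck /= shiftKV; split=> //; split=> //; exists y.
by rewrite /= /step_value /= cross_value_kink !addr0.
Qed.

Lemma transports_to_kinkL o k : is_classical k ->
  transports r [::] [:: (0, Cup o); (1, Cross k); (0, Cap)].
Proof.
move=> ck S rows /lpath0 ->; case: S => [|[a x] S] //=.
run_simpl; case: ifP => //= ne _.
have -> : a = ~~ o by case: (o) a ne => [] [].
set y := shift (~~ o) x.
exists [:: [:: (o, y), (~~ o, y), (~~ o, x) & S];
  [:: (o, y), (~~ o, y), (~~ o, x) & S]; (~~ o, x) :: S]; split=> //.
  rewrite /= /step /= /cross ck /= shiftK; split; first by exists y.
  by split.
rewrite /= /step_value /= -(shiftK (~~ o) x) -/y.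
by rewrite cross_value_kink !addr0.
Qed.

Lemma transports_to_undo k : is_classical k ->
  transports r [::] [:: (0, Cross k); (0, Cross (flip k))].
Proof.
move=> ck S rows /lpath0 ->; case: S => [|[p a] [|[q b] S]] //= _.
exists [:: cross k (p, a) (q, b) ++ S; [:: (p, a), (q, b) & S]].
have ck' : is_classical (flip k) by case: (k) ck.
rewrite /= /step /= /cross ck /= ck'; split=> //.
  by rewrite shiftK shiftKV.
by rewrite /step_value /= addr0 cross_value_undo.
Qed.

Lemma transports_from_zigzagL o : transports r [:: (0, Cup o); (1, Cap)] [::].
Proof.
move=> S rows /zigzagL_path [A [S' [-> eA ->]]] _.
by exists [::]; split=> //=; rewrite /step_value /= !addr0.
Qed.

Lemma transports_from_zigzagR o : transports r [:: (1, Cup o); (0, Cap)] [::].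
Proof.
move=> S rows /zigzagR_path [A [S' [-> eA ->]]] _.
by exists [::]; split=> //=; rewrite /step_value /= !addr0.
Qed.

Lemma transports_from_kinkR o k : is_classical k ->
  transports r [:: (1, Cup o); (0, Cross k); (1, Cap)] [::].
Proof.
move=> ck S rows /(kinkR_path ck) [[a x] [S' [-> /= -> ->]]] _.
by exists [::]; split=> //=; rewrite /step_value /= cross_value_kink !addr0.
Qed.

Lemma transports_from_kinkL o k : is_classical k ->
  transports r [:: (0, Cup o); (1, Cross k); (0, Cap)] [::].
Proof.
move=> ck S rows /(kinkL_path ck) [[a x] [S' [-> /= -> ->]]] _.
exists [::]; split=> //=; rewrite /step_value /= -{2}(shiftK (~~ o) x).
by rewrite cross_value_kink !addr0.
Qed.

Lemma undo_path k S rows : is_classical k ->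
  lpath [:: (0, Cross k); (0, Cross (flip k))] S rows ->
  exists A B S', S = [:: A, B & S'] /\ rows = [:: cross k A B ++ S'; S].
Proof.
move=> ck /lpath2 [T [T' [->]]].
have ck' : is_classical (flip k) by case: (k) ck.
case: S => [|[p a] [|[q b] S]] // -> /=; rewrite /cross ck /= /step /= /cross
  ck' /= => ->.
by exists (p, a), (q, b), S; rewrite shiftK shiftKV.
Qed.

Lemma transports_from_undo k : is_classical k ->
  transports r [:: (0, Cross k); (0, Cross (flip k))] [::].
Proof.
move=> ck S rows /(undo_path ck) [[p a] [[q b] [S' [-> ->]]]] _.
exists [::]; split=> //=.
by rewrite /step_value /= /cross ck /= addr0 cross_value_undo.
Qed.

Lemma flip_classical k : is_classical (flip k) = is_classical k.
Proof. by case: k. Qed.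

Lemma flipK : involutive flip.
Proof. by case. Qed.

Lemma slide_cap_forth k : transports r
  [:: (0, Cross k); (1, Cap)] [:: (1, Cross (flip k)); (0, Cap)].
Proof.
move=> S rows /lpath2 [T [T' [-> ]]].
case: S => [|[p a] [|[q b] S]] //= ->; rewrite /cross.
case ck: (is_classical k); case: S => [|[o c] S]; case: T' => [|D T'] //= [];
  try by move=> _ [].
- move=> <- [[-> ->] ->] _.
  exists [:: [:: (p, a), (~~ p, a), (q, shift p b) & S]; (q, shift p b) :: S].
  split=> //=.
    by rewrite /step /= /cross flip_classical ck /= negbK shiftKV.
  by rewrite /step_value /= !addr0 [RHS]cross_value_slide.
- move=> <- [[-> ->] ->] _.
  exists [:: [:: (p, a), (~~ p, a), (q, b) & S]; (q, b) :: S].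
  by split; rewrite //= ?/step_value /step /= /cross /cross_value flip_classical
    ck /= ?addr0.
Qed.

Lemma slide_cap_back k : transports r
  [:: (1, Cross (flip k)); (0, Cap)] [:: (0, Cross k); (1, Cap)].
Proof.
move=> S rows /lpath2 [T [T' [-> ]]].
case: S T => [|[p a] [|[q b] [|[o c] S]]] [|D T] //= [] // <-.
rewrite /step /= /cross flip_classical /=.
case ck: (is_classical k) => /= -> [[-> ea]] -> _.
- exists [:: [:: (q, shift p b), (p, shift (~~ q) a), (~~ p, c) & S];
  (q, shift p b) :: S].
  rewrite -ea shiftK negbK; split=> //.
  by rewrite /step_value /= !addr0 cross_value_slide shiftK.
- exists [:: [:: (q, b), (p, a), (~~ p, c) & S]; (q, b) :: S].
  rewrite -ea; split; by rewrite //= ?/step_value /step /= /cross /cross_value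
    ?flip_classical ck /= ?addr0.
Qed.

Lemma slide_cup_forth o k : transports r
  [:: (1, Cup o); (0, Cross k)] [:: (0, Cup o); (1, Cross (flip k))].
Proof.
move=> S rows /lpath2 [T [T' [-> ]]].
case: S T => [|[p a] S] [|D T] //= [<- [x ->]].
rewrite /step /= /cross; case ck: (is_classical k) => /= -> _.
- exists [:: [:: (o, shift p x), (~~ o, shift p x), (p, a) & S];
    [:: (o, shift p x), (p, shift (~~ o) a), (~~ o, x) & S]].
  split=> //=.
    rewrite /step /= /cross flip_classical ck /= shiftK.
    by split; [exists (shift p x)|split].
  by rewrite /step_value /= !addr0 !add0r cross_value_slide flipK negbK shiftK.
- exists [:: [:: (o, x), (~~ o, x), (p, a) & S]; [:: (o, x), (p, a), (~~ o, x) &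
  S]].
  split; rewrite //= ?/step_value /step /= /cross /cross_value ?flip_classical
    ck /= ?addr0 //.
  by split; [exists x|split].
Qed.

Lemma slide_cup_back o k : transports r
  [:: (0, Cup o); (1, Cross (flip k))] [:: (1, Cup o); (0, Cross k)].
Proof.
move=> S rows /lpath2 [T [T' [-> ]]].
case: T' => [|D T'] [x -> /=]; case: S => [|[p a] S] /=; try by case.
rewrite /step /= /cross flip_classical => -[<-]; case ck: (is_classical k) =>
  /= -> _.
- exists [:: [:: (p, a), (o, shift (~~ p) x), (~~ o, shift (~~ p) x) & S];
    [:: (o, x), (p, shift (~~ o) a), (~~ o, shift (~~ p) x) & S]].
  split=> //=.
    rewrite /step /= ?/cross ?ck /= shiftKV.
    by split; [split=> //; exists (shift (~~ p) x)|split].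
  by rewrite /step_value /= !addr0 !add0r [RHS]cross_value_slide flipK negbK.
- exists [:: [:: (p, a), (o, x), (~~ o, x) & S]; [:: (o, x), (p, a), (~~ o, x) &
  S]].
  split; rewrite //= ?/step_value /step /= /cross /cross_value ?flip_classical
    ?ck /= ?addr0 //.
  by split; [split=> //; exists x|split].
Qed.

Lemma add3_rev (V : zmodType) (x y z : V) : x + (y + z) = z + (y + x).
Proof. by rewrite addrC (addrC y) -addrA. Qed.

(** At each of the three crossings, the two incoming labels are those of the
    other side of the move, up to a common shift by the third strand. So the
    three values are permuted, whatever the over and under information is. *)
Lemma triangle_forth k12 k13 k23 :
  is_classical k12 -> is_classical k13 -> is_classical k23 ->
  transports r [:: (0, Cross k12); (1, Cross k13); (0, Cross k23)]
               [:: (1, Cross k23); (0, Cross k13); (1, Cross k12)].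
Proof.
move=> c12 c13 c23 S rows /lpath3 [T [T' [T'' [->]]]].
case: S => [|[p a] [|[q b] S]] // -> /=; rewrite /cross c12 /=.
case: S T' => [|[o c] S] [|D T'] //=; try by move=> -[].
rewrite /step /= /cross c13 /= => -[<- ->] /=; rewrite c23 /= => -> _.
exists [:: [:: (p, a), (o, shift q c), (q, shift (~~ o) b) & S];
  [:: (o, shift p (shift q c)), (p, shift (~~ o) a), (q, shift (~~ o) b) & S];
  [:: (o, shift p (shift q c)), (q, shift p (shift (~~ o) b)),
      (p, shift (~~ q) (shift (~~ o) a)) & S]].
split.
- by rewrite /= /step /= /cross ?c23 /= ?c13 ?c12 /=.
- by rewrite /= [shift p (shift q _)]shiftC [shift p (shift _ b)]shiftC
  [shift _ (shift _ a)]shiftC.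
rewrite /= /step_value /= !addr0.
rewrite (cross_value_shift k23) (cross_value_shift k12).
by rewrite -(cross_value_shift k13 p o (~~ q) a) shiftK add3_rev.
Qed.

Lemma triangle_back k12 k13 k23 :
  is_classical k12 -> is_classical k13 -> is_classical k23 ->
  transports r [:: (1, Cross k23); (0, Cross k13); (1, Cross k12)]
     [:: (0, Cross k12); (1, Cross k13); (0, Cross k23)].
Proof.
move=> c12 c13 c23 S rows /lpath3 [T [T' [T'' [->]]]].
case: S T => [|[p a] [|[q b] [|[o c] S]]] [|A T] //= []; try by move=> _ [].
move=> <-; rewrite /step /= /cross c23 => -> /=; rewrite c13 /= => ->.
case: T'' => [|B T''] //= [<- ->] _.
exists [:: [:: (q, shift p b), (p, shift (~~ q) a), (o, c) & S];
  [:: (q, shift p b), (o, shift p c), (p, shift (~~ o) (shift (~~ q) a)) & S];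
  [:: (o, shift q (shift p c)), (q, shift (~~ o) (shift p b)),
      (p, shift (~~ o) (shift (~~ q) a)) & S]].
split.
- by rewrite /= /step /= /cross ?c23 /= ?c13 ?c12 /=.
- by rewrite c12 /= [shift q (shift p _)]shiftC [shift _ (shift p b)]shiftC
  [shift _ (shift _ a)]shiftC.
rewrite /= /step_value /= !addr0.
rewrite (cross_value_shift k23) (cross_value_shift k12).
by rewrite -(cross_value_shift k13 p o (~~ q) a) shiftK add3_rev.
Qed.

End LocalMoves.

(** * Labels inside a move are determined by its boundary *)

Section Rigidity.

Variable r : labeling_rule.
Notation X := (label r).
Notation strand := (bool * X)%type.
Implicit Types (S T : seq strand) (rows : seq (seq strand)) (w : word).

Definition is_cup (g : event) := if g is Cup _ then true else false.
Definition is_cap (g : event) := if g is Cap then true else false.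

Lemma step_determined l S T T' :
  ~~ is_cup l.2 -> step (r := r) l S T -> step l S T' -> T = T'.
Proof.
case: l => i g /= ng; elim: i S T T' => [|i IH] S T T'.
  case: g ng => //= [_ | k _]; case: S => [|A [|B S]] //; last by move=> -> ->.
  by case=> _ -> [_ ->].
case: S T T' => [|A S] [|B T] [|C T'] //= [<- s1] [<- s2].
by rewrite (IH _ _ _ s1 s2).
Qed.

Lemma cross_inj k A B A' B' (S S' : seq strand) :
  cross k A B ++ S = cross k A' B' ++ S' -> [:: A, B & S] = [:: A', B' & S'].
Proof.
case: A B A' B' => [p a] [q b] [p' a'] [q' b']; rewrite /cross.
case: ifP => _ /= [eq e1 ep e2 eS]; last by rewrite eq e1 ep e2 eS.
by subst q' p'; rewrite eS (shift_inj e1) (shift_inj e2).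
Qed.

Lemma step_injective l S S' T :
  ~~ is_cap l.2 -> step (r := r) l S T -> step l S' T -> S = S'.
Proof.
case: l => i g /= ng; elim: i S S' T => [|i IH] S S' T.
  case: g ng => //= [o|k] _; first by move=> [x ->] [y [_ _ ->]].
  by case: S => [|A [|B S]] //; case: S' => [|A' [|B' S']] // -> /cross_inj.
case: S S' T => [|A S] [|A' S'] [|B T] // [-> s1] [-> s2].
by rewrite (IH _ _ _ s1 s2).
Qed.

(** Only a minimum leaves a freedom in the labels when a picture is read
    upward. *)
Lemma rigid_cupless w : all (fun l => ~~ is_cup l.2) w -> rigid r w.
Proof.
move=> nw S rows rows' p p' _; elim: w nw S rows rows' p p' => [|l w IH] /=.
  by move=> _ S [|? ?] [|? ?].
case/andP=> nl nw S [|T rows] [|T' rows'] // [s p] [s' p'].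
by rewrite (step_determined nl s s') in p *; rewrite (IH nw _ _ _ p p').
Qed.

(** If the second event is not a maximum, the labels between the two events are
    found by reading downward. *)
Lemma rigid_pair l l' : ~~ is_cup l.2 || ~~ is_cap l'.2 -> rigid r [:: l; l'].
Proof.
move=> n S rows rows' /lpath2 [T [T' [-> s s']]] /lpath2 [U [U' [-> u u']]] /=
  e.
rewrite -{}e in u' *; congr [:: _; _]; case/orP: n => n.
  exact: step_determined n s u.
exact: step_injective n s' u'.
Qed.

Lemma rigid0 : rigid r [::].
Proof. exact: rigid_cupless. Qed.

Lemma rigid_exchange_forth j g h : (outs g <= j)%N ->
  rigid r [:: (0, g); (j, h)].
Proof.
case: (boolP (~~ is_cup g || ~~ is_cap h)) => [ne _|]; first exact: rigid_pair.
case: g h => [o||k] [o'||k'] //= _; case: j => [|[|j]] // _.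
move=> S rows rows' /lpath2 [T [T' [-> [x ->] s']]] /lpath2
  [U [U' [-> [y ->] u']]] /=.
have [V -> _] := iffLR (step_skip2 _ _ _ _ _ _) s'.
have [W -> _] := iffLR (step_skip2 _ _ _ _ _ _) u'.
by case=> -> _ ->.
Qed.

Lemma rigid_exchange_back j g h : (outs g <= j)%N ->
  rigid r [:: ((j - outs g + ins g)%N, h); (0, g)].
Proof.
case: (boolP (~~ is_cup h || ~~ is_cap g)) => [ne _|]; first exact: rigid_pair.
case: g h => [o||k] [o'||k'] //= _ _; rewrite subn0 addn2.
move=> S rows rows' /lpath2 [T [T' [-> s s']]] /lpath2 [U [U' [-> u u']]] /= e.
subst U'; case: S s u => [|A [|B S]] s u; first by case: T s {s'} => // ? ? [].
  by case: T s {s'} => // ? [|? ?] [].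
have [V eT _] := iffLR (step_skip2 _ _ _ _ _ _) s.
have [W eU _] := iffLR (step_skip2 _ _ _ _ _ _) u.
by subst T U; move: s' u' => /= [_ ->] [_ ->].
Qed.

Lemma rigid_zigzagL o : rigid r [:: (0, Cup o); (1, Cap)].
Proof.
by move=> S rows rows' /zigzagL_path [A [S' [-> _ ->]]] /zigzagL_path
  [A' [S'' [[-> ->] _ ->]]].
Qed.

Lemma rigid_zigzagR o : rigid r [:: (1, Cup o); (0, Cap)].
Proof.
by move=> S rows rows' /zigzagR_path [A [S' [-> _ ->]]] /zigzagR_path
  [A' [S'' [[-> ->] _ ->]]].
Qed.

Lemma rigid_kinkR o k : is_classical k ->
  rigid r [:: (1, Cup o); (0, Cross k); (1, Cap)].
Proof.
by move=> ck S rows rows' /(kinkR_path ck) [A [S' [-> _ ->]]] /(kinkR_path ck)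
  [A' [S'' [[-> ->] _ ->]]].
Qed.

Lemma rigid_kinkL o k : is_classical k ->
  rigid r [:: (0, Cup o); (1, Cross k); (0, Cap)].
Proof.
by move=> ck S rows rows' /(kinkL_path ck) [A [S' [-> _ ->]]] /(kinkL_path ck)
  [A' [S'' [[-> ->] _ ->]]].
Qed.

Definition interchangeable (m m' : word) :=
  [/\ transports r m m', transports r m' m, rigid r m & rigid r m'].

Lemma interchangeable_indent (i : nat) (F F' : nat -> word) :
  (forall i : nat, F i.+1 = indent (F i)) ->
    (forall i : nat, F' i.+1 = indent (F' i)) ->
  interchangeable (F 0%N) (F' 0%N) -> interchangeable (F i) (F' i).
Proof.
move=> eF eF' F0; elim: i => // i [t t' g g']; rewrite eF eF'.
by split; [exact: transports_indent | exact: transports_indent |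
  exact: rigid_indent | exact: rigid_indent].
Qed.

(** Each move at position i is the same move at position 0 with i strands added
    on the left. *)
Lemma isotopy_interchangeable m m' : isotopy_move m m' -> interchangeable m m'.
Proof.
case=> {m m'} [i j g h le | i o | i o | i k | i o k | i o k ck | i o k ck
  | i k ck | i k12 k13 k23 c12 c13 c23 _].
- have -> : j = (i + (j - i))%N by rewrite subnKC // (leq_trans _ le) //
  leq_addr.
  have {le} : (outs g <= j - i)%N by rewrite leq_subRL ?(leq_trans _ le) //
    leq_addr.
  move: (j - i)%N => {}j le.
  have -> : (i + j - outs g + ins g = i + (j - outs g + ins g))%N by lia.
  apply: (@interchangeable_indent i (fun i => [:: (i, g); ((i + j)%N, h)])
    (fun i => [:: ((i + (j - outs g + ins g))%N, h); (i, g)])) => //.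
  rewrite add0n; split; [exact: exchange_forth | exact: exchange_back
    | exact: rigid_exchange_forth | exact: rigid_exchange_back].
- apply: (@interchangeable_indent i (fun i => [:: (i, Cup o); (i.+1, Cap)])
  (fun=> [::])) => //.
  split; [exact: transports_from_zigzagL | exact: transports_to_zigzagL
    | exact: rigid_zigzagL | exact: rigid0].
- apply: (@interchangeable_indent i (fun i => [:: (i.+1, Cup o); (i, Cap)])
  (fun=> [::])) => //.
  split; [exact: transports_from_zigzagR | exact: transports_to_zigzagR
    | exact: rigid_zigzagR | exact: rigid0].
- apply: (@interchangeable_indent i (fun i => [:: (i, Cross k); (i.+1, Cap)])
    (fun i => [:: (i.+1, Cross (flip k)); (i, Cap)])) => //.
  split; [exact: slide_cap_forth | exact: slide_cap_back
    | exact: rigid_cupless | exact: rigid_cupless].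
- apply: (@interchangeable_indent i (fun i => [:: (i.+1, Cup o); (i, Cross k)])
    (fun i => [:: (i, Cup o); (i.+1, Cross (flip k))])) => //.
  split; [exact: slide_cup_forth | exact: slide_cup_back
    | exact: rigid_pair | exact: rigid_pair].
- apply: (@interchangeable_indent i
    (fun i => [:: (i.+1, Cup o); (i, Cross k); (i.+1, Cap)]) (fun=> [::])) =>
      //.
  split; [exact: transports_from_kinkR | exact: transports_to_kinkR
    | exact: rigid_kinkR | exact: rigid0].
- apply: (@interchangeable_indent i
    (fun i => [:: (i, Cup o); (i.+1, Cross k); (i, Cap)]) (fun=> [::])) => //.
  split; [exact: transports_from_kinkL | exact: transports_to_kinkL
    | exact: rigid_kinkL | exact: rigid0].
- apply: (@interchangeable_indent i
    (fun i => [:: (i, Cross k); (i, Cross (flip k))]) (fun=> [::])) => //.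
  split; [exact: transports_from_undo | exact: transports_to_undo
    | exact: rigid_cupless | exact: rigid0].
- apply: (@interchangeable_indent i
    (fun i => [:: (i, Cross k12); (i.+1, Cross k13); (i, Cross k23)])
    (fun i => [:: (i.+1, Cross k23); (i, Cross k13); (i.+1, Cross k12)])) => //.
  split; [exact: triangle_forth | exact: triangle_back
    | exact: rigid_cupless | exact: rigid_cupless].
Qed.

End Rigidity.

(** * Labelings of a diagram are paths of labeled sections *)

Section Labels.

Variable r : labeling_rule.
Notation X := (label r).
Notation strand := (bool * X)%type.
Implicit Types (S T : seq strand) (rows : seq (seq strand)) (w : word).
Implicit Types (f : nat -> X) (s : seq bool) (C : point -> X).

Definition crossing_rule C (c : crossing) : bool :=
  (C (right_out c) == shift false (C (left_in c)))
  && (C (left_out c) == shift true (C (right_in c))).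

Definition labels (D : word) C : bool :=
  all (fun e => C e.1 == C e.2) (arc_links D)
  && all (crossing_rule C) (crossings D).

Definition state_sum (D : word) C : value r :=
  \sum_(c <- crossings D)
    crossing_value (positive c) (C (left_in c)) (C (right_in c)).

Definition event_rule (i : nat) (g : event) s f f' : Prop :=
  match g with
  | Cup _ => f' i = f' i.+1
  | Cap => f i = f i.+1
  | Cross k => if is_classical k
      then f' i = shift (nth true s i) (f i.+1)
        /\ f' i.+1 = shift (~~ nth true s i.+1) (f i)
      else f' i = f i.+1 /\ f' i.+1 = f i
  end.

(** The links and the crossing of one layer, in terms of the labels f and f' of
    the sections below and above it. *)
Definition layer_rule (i : nat) (g : event) s f f' : Prop :=
  [/\ forall x, (x < i)%N -> f x = f' x,
      forall x, (i + ins g <= x < size s)%N -> f x = f' (x - ins g + outs g)%N &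
      event_rule i g s f f'].

Fixpoint attach f s : seq strand :=
  if s is o :: s' then (o, f 0) :: attach (fun i => f i.+1) s' else [::].

Lemma eq_attach f f' s : (forall x, (x < size s)%N -> f x = f' x) ->
  attach f s = attach f' s.
Proof.
elim: s f f' => [|o s IH] f f' //= e; rewrite e //; congr (_ :: _).
by apply: IH => x lx; apply: e.
Qed.

Lemma attach_inj f f' s : attach f s = attach f' s ->
  forall x, (x < size s)%N -> f x = f' x.
Proof.
elim: s f f' => [|o s IH] f f' //= [e0 /IH e] [|x] //=; exact: e.
Qed.

Lemma unzip1_attach f s : unzip1 (attach f s) = s.
Proof. by elim: s f => [|o s IH] f //=; rewrite IH. Qed.

Lemma size_attach f s : size (attach f s) = size s.
Proof. by rewrite -[in RHS](unzip1_attach f s) size_map. Qed.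

Lemma attach_of f S x0 :
  (forall i, (i < size S)%N -> f i = (nth (true, x0) S i).2) ->
    attach f (unzip1 S) = S.
Proof.
elim: S f => [|[o x] S IH] f //= e; rewrite (e 0) //; congr (_ :: _).
by apply: IH => i li; apply: (e i.+1).
Qed.

Lemma nth_attach f s i x0 : (i < size s)%N ->
  (nth (true, x0) (attach f s) i).2 = f i.
Proof. by elim: s f i => [|o s IH] f [|i] //= /IH ->. Qed.

Lemma layer_ruleS i g o s f f' :
  layer_rule i.+1 g (o :: s) f f' <->
  f 0 = f' 0 /\ layer_rule i g s (fun i => f i.+1) (fun i => f' i.+1).
Proof.
split=> [[e1 e2 e3]|[e0 [e1 e2 e3]]].
  split; [exact: e1|split] => // x lx; first exact: e1.
  rewrite e2; last by rewrite /= ltnS; case: (g) lx => *; lia.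
  by rewrite subSn ?addSn //; lia.
split=> // [[|x]|[|x]] //; first exact: e1.
move=> lx; have {}lx : (i + ins g <= x < size s)%N by [].
by rewrite subSn ?addSn ?e2 //; move: lx; lia.
Qed.

Lemma layer_rule_step i g s s' f f' : apply_layer (i, g) s = Some s' ->
  layer_rule i g s f f' <-> step (r := r) (i, g) (attach f s) (attach f' s').
Proof.
elim: i s s' f f' => [|i IH] s s' f f'; last first.
  case: s => [|o s] //.
  rewrite (apply_layer_indent (i, g)); case E: apply_layer => [s1|] //= [<-] /=.
  rewrite layer_ruleS (IH _ _ (fun i => f i.+1) (fun i => f' i.+1) E).
  by split=> [[-> ?]|[[->] ?]].
case: g => [o||k] /=; rewrite drop0 ?take0 /=.
- case=> <- /=; split.
    case=> _ e2 /= e; exists (f' 1%N); rewrite e; do 2!congr (_ :: _).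
    by apply: eq_attach => x lx; rewrite (e2 x) /= ?subn0 ?addn2 ?add0n.
  case=> x [e0 e1 e]; split=> [//|y|/=]; last by rewrite e0 e1.
  by rewrite /= subn0 addn2 => /(attach_inj (esym e)).
- case: s => [|a [|b s]] //=; rewrite take0; case: ifP => //= ne [<-].
  rewrite drop0; have -> : b = ~~ a by case: (a) (b) ne => [] [].
  split.
    case=> _ e2 /= ->; split=> //.
    by apply: eq_attach => x lx; rewrite (e2 x.+2) //= ?subn2 ?addn0.
  case=> [[e1]] e; split=> [//|[|[|x]] // lx|/=]; last by rewrite e1.
  by rewrite subn2 addn0 /=; apply: (attach_inj (esym e)).
- case: s => [|a [|b s]] //=; rewrite take0 => -[<-] /=; rewrite drop0.
  split.
    case=> _ e2 /=; have -> : attach (fun i => f' i.+2) s = attach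
      (fun i => f i.+2) s.
      by apply: eq_attach => x lx; rewrite (e2 x.+2) //= subn2 addn2.
    by rewrite /step /= /cross; case: ifP => _ [-> ->].
  rewrite /step /= /cross => e; split=> [//|[|[|x]] // lx|/=].
    rewrite subn2 addn2 /=; move: e.
    by case: is_classical => -[_ _ e]; apply: (attach_inj (esym e)).
  by move: e; case: is_classical => -[-> ->].
Qed.

Definition layer_labels C j s (l : layer) : bool :=
  all (fun e => C e.1 == C e.2) (layer_arc_links j s l)
  && oapp (crossing_rule C) true (layer_crossing j s l).

(** For a classical crossing, the left and right, in and out ends are permuted
    by the rotation; this is where the rotated description of crossings is
    matched with the description from bottom to top. *)
Lemma layer_labelsP C j s l : reflect
  (layer_rule l.1 l.2 s (fun i => C (j, i)) (fun i => C (j.+1, i)))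
  (layer_labels C j s l).
Proof.
case: l => i g; rewrite /layer_labels [layer_arc_links _ _ _]/= !all_cat.
rewrite !all_map -andbA -andbA; apply: (iffP and3P).
  case=> /allP /= e1 /allP /= e2 e3; split=> /=.
  - by move=> x lx; apply/eqP/e1; rewrite mem_iota.
  - by move=> x lx; apply/eqP/e2; rewrite mem_iota; case: (g) lx => /= *; lia.
  case: g e2 e3 => [o||[]] _ /=; rewrite ?andbT.
  - by move/eqP.
  - by move/eqP.
  - rewrite /crossing_rule; case: (nth true s i); case: (nth true s i.+1) => /=
    /andP[/eqP e /eqP e'];
    rewrite ?e ?e' ?(shiftK true) ?(shiftK false) //.
  - rewrite /crossing_rule; case: (nth true s i); case: (nth true s i.+1) => /=
    /andP[/eqP e /eqP e'];
    rewrite ?e ?e' ?(shiftK true) ?(shiftK false) //.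
  - by case/andP=> /eqP -> /eqP ->.
case=> /= e1 e2 e3; split.
- by apply/allP => x; rewrite mem_iota /= => lx; rewrite e1.
- by apply/allP => x; rewrite mem_iota /= => lx; rewrite e2 //; case: (g) lx =>
  /= *; lia.
case: g e2 e3 => [o||[]] _ /=; rewrite ?andbT.
- by move/eqP.
- by move/eqP.
- rewrite /crossing_rule; case: (nth true s i); case: (nth true s i.+1) => /=
  -[-> ->];
  by rewrite ?(shiftK true) ?(shiftK false) !eqxx.
- rewrite /crossing_rule; case: (nth true s i); case: (nth true s i.+1) => /=
  -[-> ->];
  by rewrite ?(shiftK true) ?(shiftK false) !eqxx.
- by case=> -> ->; rewrite !eqxx.
Qed.

Definition layer_total C j s l : value r :=
  oapp (fun c => crossing_value (positive c) (C (left_in c)) (C (right_in c))) 0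
    (layer_crossing j s l).

Lemma drop_attach f s i :
  drop i (attach f s) = attach (fun x => f (i + x)%N) (drop i s).
Proof. by elim: i s f => [|i IH] [|o s] f //=; rewrite IH. Qed.

Lemma layer_total_step C j s s' l : apply_layer l s = Some s' ->
  layer_labels C j s l ->
  layer_total C j s l = step_value l (attach (fun i => C (j, i)) s).
Proof.
case: l => i g ap /layer_labelsP [_ _ /= ev].
rewrite /layer_total /step_value /= drop_attach.
case: g ap ev => [o||k] //=; case: ifP => // le.
case E: (drop i s) => [|p [|q s1]] //=; rewrite ?take0 //= => _.
have ei x : nth true (drop i s) x = nth true s (i + x)%N by rewrite nth_drop.
have := ei 0%N; have := ei 1%N; rewrite E addn0 addn1 /= => <- <-.
rewrite /cross_value; case: k => //=; case: p {E ei} => /=; case: q => /=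
  -[e1 e2]; rewrite ?e1 ?e2 ?addn0 ?addn1 ?eqxx //=.
Qed.

End Labels.
Arguments labels : clear implicits.
Arguments state_sum : clear implicits.

Section Scan.

Variable A : Type.

(** The sections of a diagram are defined by running an initial segment of the
    word, which is inconvenient for inductions on the word; here the current
    section is carried along. *)
Fixpoint scan (F : nat -> seq bool -> layer -> A) j s (w : word) : seq A :=
  if w is l :: w' then
    F j s l :: scan F j.+1 (odflt [::] (apply_layer l s)) w'
  else [::].

Lemma run_cat u v s : run (u ++ v) s = obind (run v) (run u s).
Proof. by elim: u s => [|l u IH] s //=; case: apply_layer => //=. Qed.

Lemma section_size_cat u w : section (u ++ w) (size u)
  = odflt [::] (run u [::]).
Proof. by rewrite /section take_size_cat. Qed.

Lemma scanE (F : nat -> seq bool -> layer -> A) (D : word) : run D [::] ->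
  [seq F jl.1 (section D jl.1) jl.2 | jl <- indexed_layers D] = scan F 0 [::] D.
Proof.
move=> rD; rewrite /indexed_layers.
suff H w u s : run u [::] = Some s -> run w s ->
  [seq F jl.1 (section (u ++ w) jl.1) jl.2 | jl <- zip (iota (size u) (size w))
    w]
  = scan F (size u) s w by apply: (H D [::]).
elim: w u s => [|l w IH] u s ru //=; case E: apply_layer => [s'|] //= rw.
rewrite section_size_cat ru; congr (_ :: _).
rewrite -cat_rcons -(size_rcons u l); apply: IH => //.
by rewrite -cats1 run_cat ru /= E.
Qed.

Lemma nth_scan F x0 (D : word) j : run D [::] -> (j < size D)%N ->
  nth x0 (scan F 0 [::] D) j = F j (section D j) (nth (0%N, Cap) D j).
Proof.
move=> rD lj; rewrite -scanE //.
have sz : size (indexed_layers D) = size D by rewrite size_zip size_iota minnn.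
rewrite (nth_map (0%N, (0%N, Cap))) ?sz // nth_zip ?size_iota //=.
by rewrite nth_iota.
Qed.

Lemma size_scan F j s w : size (scan F j s w) = size w.
Proof. by elim: w j s => //= l w IH j s; rewrite IH. Qed.

End Scan.

Lemma section_succ (D : word) j : run D [::] -> (j < size D)%N ->
  apply_layer (nth (0%N, Cap) D j) (section D j) = Some (section D j.+1).
Proof.
move=> rD lj; rewrite /section (take_nth (0%N, Cap) lj) -cats1 run_cat /=.
move: rD; rewrite -{1}(cat_take_drop j D) run_cat (drop_nth (0%N, Cap) lj) /=.
by case: (run (take j D) _) => //= s; case: apply_layer.
Qed.

Section Bridge.

Variable r : labeling_rule.
Notation X := (label r).
Notation strand := (bool * X)%type.
Implicit Types (S T : seq strand) (rows : seq (seq strand)) (w : word).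
Implicit Types (f : nat -> X) (s : seq bool) (C : point -> X).

Definition level C (D : word) j : seq strand :=
  attach (fun i => C (j, i)) (section D j).

Definition rows_of C (D : word) := [seq level C D j | j <- iota 1 (size D)].

Definition lrows C := scan (fun j s l =>
  attach (fun i => C (j.+1, i)) (odflt [::] (apply_layer l s))).

Lemma rows_ofE C D : run D [::] -> rows_of C D = lrows C 0 [::] D.
Proof.
move=> rD; apply: (@eq_from_nth _ [::]); rewrite size_map size_iota ?size_scan
  // => j lj.
by rewrite (nth_map 0%N) ?size_iota // nth_iota // nth_scan //= section_succ.
Qed.

Lemma labels_lpath_from C j s w : run w s ->
  all id (scan (layer_labels C) j s w)
  <-> lpath w (attach (fun i => C (j, i)) s) (lrows C j s w).
Proof.
elim: w j s => [|l w IH] j s //=; case E: apply_layer => [s'|] //= rw.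
rewrite -IH //; case: (l) E => i g E.
rewrite -(layer_rule_step _ _ E); split; first by case/andP=> /layer_labelsP.
by case=> h ->; rewrite andbT; apply/layer_labelsP.
Qed.

Lemma all_flatten_map (A B : Type) (p : pred B) (F : A -> seq B) (t : seq A) :
  all p (flatten (map F t)) = all (fun x => all p (F x)) t.
Proof. by elim: t => //= x t IH; rewrite all_cat IH. Qed.

Lemma all_pmap (A B : Type) (p : pred B) (F : A -> option B) (t : seq A) :
  all p (pmap F t) = all (fun x => oapp p true (F x)) t.
Proof. by elim: t => //= x t IH; case: (F x) => //= y; rewrite IH. Qed.

Lemma all_and (A : Type) (p q : pred A) (t : seq A) :
  all p t && all q t = all (fun x => p x && q x) t.
Proof. by elim: t => //= x t <-; rewrite andbACA. Qed.

Lemma labels_scan C D : run D [::] ->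
  labels r D C = all id (scan (layer_labels C) 0 [::] D).
Proof.
move=> rD; rewrite -scanE // all_map.
by rewrite /labels all_flatten_map all_pmap all_and.
Qed.

(** This turns statements on labels of points, of which there are many around
    each move, into statements on successive sections. *)
Lemma labels_lpath C D : run D [::] ->
  labels r D C <-> lpath D [::] (rows_of C D).
Proof.
by move=> rD; rewrite labels_scan // rows_ofE // labels_lpath_from.
Qed.

Lemma state_sum_scan C D : run D [::] ->
  state_sum r D C = \sum_(x <- scan (layer_total C) 0 [::] D) x.
Proof.
move=> rD; rewrite -scanE // big_map /state_sum /crossings.
elim: (indexed_layers D) => [|jl t IH]; rewrite ?big_nil //= big_cons -IH.
rewrite /layer_total; case: layer_crossing => [c|] /=; rewrite ?add0r //.
by rewrite big_cons.
Qed.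

Lemma lpath_value_scan C j s w : run w s ->
  all id (scan (layer_labels C) j s w) ->
  lpath_value w (attach (fun i => C (j, i)) s) (lrows C j s w)
  = \sum_(x <- scan (layer_total C) j s w) x.
Proof.
elim: w j s => [|l w IH] j s /=; first by rewrite big_nil.
case E: apply_layer => [s'|] //= rw /andP[h1 h2].
by rewrite big_cons (layer_total_step E h1) IH.
Qed.

Lemma state_sum_lpath C D : run D [::] -> labels r D C ->
  state_sum r D C = lpath_value D [::] (rows_of C D).
Proof.
move=> rD; rewrite labels_scan // state_sum_scan // rows_ofE // => lC.
by rewrite -(lpath_value_scan rD lC).
Qed.

Lemma step_section l S T : step l S T -> apply_layer l (unzip1 S)
  = Some (unzip1 T).
Proof.
case: l => i g; elim: i S T => [|i IH] S T; last first.
  case: S T => [|A S] [|B T] // [<-] /IH e.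
  by rewrite /= -/(apply_layer (i.+1, g) (A.1 :: unzip1 S))
    (apply_layer_indent (i, g)) e.
case: g => [o||k] /=.
- by case=> x ->; rewrite /= drop0 take0.
- case: S => [|A [|B S]] // [-> ->] /=; rewrite take0 drop0 /=.
  by case: A.1.
- case: S => [|A [|B S]] // -> /=; rewrite take0 drop0 /=.
  by rewrite /cross; case: is_classical.
Qed.

Lemma lpath_run w S rows : lpath w S rows ->
  run w (unzip1 S) = Some (unzip1 (last S rows)).
Proof.
elim: w S rows => [|l w IH] S [|T rows] //= [/step_section -> /IH] //.
Qed.

Definition labeling_of (x0 : X) rows : point -> X :=
  fun p => (nth (true, x0) (nth [::] ([::] :: rows) p.1) p.2).2.

Local Arguments apply_layer : simpl never.

Lemma rows_of_labeling x0 D rows : lpath D [::] rows ->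
  rows_of (labeling_of x0 rows) D = rows.
Proof.
move=> pD; have rD : run D [::] by rewrite (lpath_run pD).
rewrite rows_ofE //.
suff H w C j0 S rs : lpath w S rs ->
    (forall j i, C (j0 + j, i)%N = (nth (true, x0) (nth [::] (S :: rs) j)
      i).2) ->
    lrows C j0 (unzip1 S) w = rs by exact: (H D _ 0%N [::]).
elim: w C j0 S rs {pD rD} => [|l w IH] C j0 S [|T rs] //= [st pw] hC.
rewrite /lrows [LHS]/= (step_section st) /=; congr (_ :: _).
  by apply: (@attach_of _ _ _ x0) => i _; rewrite -(hC 1%N) addn1.
by apply: IH => // j i; rewrite addSnnS hC.
Qed.

Lemma labels_of_lpath x0 D rows : lpath D [::] rows ->
  labels r D (labeling_of x0 rows).
Proof.
by move=> pD; apply/labels_lpath; rewrite ?rows_of_labeling // (lpath_run pD).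
Qed.

Lemma mem_points D (x : point) :
  (x \in points D) = (x.1 <= size D)%N && (x.2 < size (section D x.1))%N.
Proof.
apply/flatten_mapP/andP => [[j]|[l1 l2]].
  by rewrite mem_iota add0n ltnS => /= lj /mapP[i]; rewrite mem_iota => /=
    li ->.
exists x.1; first by rewrite mem_iota.
by apply/mapP; exists x.2; rewrite ?mem_iota //; case: (x).
Qed.

Lemma eq_attach_cast f f' s s' : s = s' ->
  (forall x, (x < size s)%N -> f x = f' x) ->
    attach (r := r) f s = attach f' s'.
Proof. by move=> <-; apply: eq_attach. Qed.

Lemma labels_ext C C' D : run D [::] -> {in points D, C =1 C'} ->
  labels r D C = labels r D C'.
Proof.
move=> rD e; apply/idP/idP => /labels_lpath -/(_ rD) h; apply/labels_lpath =>
  //;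
  move: h; congr lpath; apply/eq_in_map => j; rewrite mem_iota => lj;
  apply: eq_attach => i li; rewrite e // mem_points /= li andbT; lia.
Qed.

Lemma state_sum_ext C C' D : run D [::] -> labels r D C ->
  {in points D, C =1 C'} ->
  state_sum r D C = state_sum r D C'.
Proof.
move=> rD lC e; rewrite !state_sum_lpath //; last by rewrite -(labels_ext rD e).
congr lpath_value; apply/eq_in_map => j; rewrite mem_iota => lj.
apply: eq_attach => i li; rewrite e // mem_points /= li andbT; lia.
Qed.

End Bridge.

(** * Moves supported at a site *)

Definition agree (X : Type) (mv : move) (C C' : point -> X) : Prop :=
  forall x y, same_point mv x y -> C x = C' y.

Definition feet_agree (X : Type) (mv : move) (C : point -> X) : Prop :=
  if mv is Saddle u i _ b _ then C (feet u i b).1 = C (feet u i b).2 else True.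

Definition circle_label (X : Type) (mv : move) (C : point -> X) (x : X) :
  Prop :=
  if mv is Birth u i _ _ then C ((size u).+1, i) = x else True.

Definition site_point u m m' v (x y : point) : bool :=
  [&& x \in points (u ++ m ++ v), y \in points (u ++ m' ++ v) &
      ((x.1 <= size u)%N && (y == x)) ||
      ((size u + size m <= x.1)%N && (y == ((x.1 - size m + size m')%N, x.2)))].

Section SitePoints.

Variables (u m m' v : word) (s1 s2 : seq bool).
Hypotheses (ru : run u [::] = Some s1) (rm : run m s1 = Some s2)
  (rv : run v s2 = Some [::]).

Lemma site_run : run (u ++ m ++ v) [::] = Some [::].
Proof. by rewrite run_cat ru /= run_cat rm. Qed.

Lemma site_section_low j : (j <= size u)%N ->
  section (u ++ m ++ v) j = section (u ++ m' ++ v) j.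
Proof.
by move=> lj; rewrite /section !takel_cat.
Qed.

Lemma site_section_high j :
  section (u ++ m ++ v) (size u + size m + j)
  = odflt [::] (run (take j v) s2).
Proof.
rewrite /section take_cat ltnNge -addnA leq_addr /= addKn.
by rewrite take_cat ltnNge leq_addr /= addKn !run_cat ru /= run_cat rm.
Qed.

End SitePoints.

Section SiteMoves.

Variable r : labeling_rule.
Notation X := (label r).
Notation strand := (bool * X)%type.
Implicit Types (S T : seq strand) (rows : seq (seq strand)) (w : word).
Implicit Types (C : point -> X).

Lemma size_rows_of C D : size (rows_of C D) = size D.
Proof. by rewrite size_map size_iota. Qed.

Lemma level_nth C D j : (j <= size D)%N ->
  level C D j = nth [::] ([::] :: rows_of C D) j.
Proof.
case: j => [|j] lj; first by rewrite /level /section take0.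
by rewrite /= (nth_map 0%N) ?size_iota // nth_iota.
Qed.

Lemma nth_cat_last (A : Type) (x S : A) (a b : seq A) j :
  nth x (S :: a ++ b) (size a + j) = nth x (last S a :: b) j.
Proof. by elim: a S => [|y a IH] S //=; rewrite -IH. Qed.

Lemma rows_of_split u m v C : run (u ++ m ++ v) [::] ->
  labels r (u ++ m ++ v) C ->
  exists ru rm rv, [/\ rows_of C (u ++ m ++ v) = ru ++ rm ++ rv,
    size ru = size u,
    size rm = size m & [/\ lpath u [::] ru, lpath m (last [::] ru) rm,
      lpath v (last (last [::] ru) rm) rv & state_sum r (u ++ m ++ v) C
      = lpath_value u [::] ru + (lpath_value m (last [::] ru) rm
        + lpath_value v (last (last [::] ru) rm) rv)]].
Proof.
move=> rD lC; rewrite state_sum_lpath //.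
have /labels_lpath -/(_ rD) p := lC.
have sz := size_rows_of C (u ++ m ++ v).
rewrite !size_cat in sz; move: p sz.
set R := rows_of _ _ => p sz.
have [ru [rm [rv [eR e1 e2]]]] : exists ru rm rv,
    [/\ R = ru ++ rm ++ rv, size ru = size u & size rm = size m].
  exists (take (size u) R), (take (size m) (drop (size u) R)),
    (drop (size m) (drop (size u) R)).
  by rewrite !cat_take_drop !size_takel // ?size_drop sz ?addKn leq_addr.
exists ru, rm, rv; rewrite eR in p *; split=> //.
have [p1 p23] := iffLR (lpath_cat _ _ _ e1) p.
have [p2 p3] := iffLR (lpath_cat _ _ _ e2) p23.
by split=> //; rewrite lpath_value_cat // lpath_value_cat.
Qed.

Lemma eq_level_points C C' D D' j j' : level C D j = level C' D' j' ->
  section D j = section D' j' /\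
  forall i, (i < size (section D j))%N -> C (j, i) = C' (j', i).
Proof.
rewrite /level => e; have e1 : section D j = section D' j'.
  by rewrite -(unzip1_attach (fun i => C (j, i)) (section D j)) e unzip1_attach.
by split=> //; rewrite -e1 in e; apply: attach_inj e.
Qed.

(** The points which a move does not affect are those of the sections below and
    above its site, so that agreement there is equality of labeled sections. *)
Lemma agree_rows u m m' v s1 s2 C C' :
  run u [::] = Some s1 -> run m s1 = Some s2 -> run m' s1 = Some s2 ->
  run v s2 = Some [::] ->
  (forall x y, site_point u m m' v x y -> C x = C' y) <->
  (forall j, (j <= size u)%N -> level C (u ++ m ++ v) j
    = level C' (u ++ m' ++ v) j) /\
  (forall j, (j <= size v)%N -> level C (u ++ m ++ v) (size u + size m + j)
                             = level C' (u ++ m' ++ v) (size u + size m' + j)).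
Proof.
move=> ru rm rm' rv; split=> [h|[h1 h2] [j i] y].
  split=> j lj.
    apply: eq_attach_cast; first exact: site_section_low.
    move=> i li; apply: h; rewrite /site_point !mem_points /= !size_cat
      -(site_section_low m m' v lj).
    by rewrite li lj eqxx !(leq_trans lj) ?leq_addr.
  have e : section (u ++ m ++ v) (size u + size m + j)
    = section (u ++ m' ++ v) (size u + size m' + j)
      by rewrite (site_section_high v ru rm) (site_section_high v ru rm').
  apply: eq_attach_cast => // i li; apply: h.
  rewrite /site_point !mem_points /= -e li !andbT !size_cat.
  apply/and3P; split; try lia.
  apply/orP; right; rewrite leq_addr /=; apply/eqP; congr pair; lia.
case/and3P; rewrite !mem_points /= => /andP[lj li] /andP[lj' li'] /orP[|]
  /andP[l1 /eqP ey]; subst y.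
  by have [_] := eq_level_points (h1 j l1); apply.
have ej : j = (size u + size m + (j - (size u + size m)))%N by rewrite subnKC.
have ej' : (j - size m + size m' = size u + size m' + (j - (size u + size m)))%N
  by lia.
have lv : (j - (size u + size m) <= size v)%N by move: lj; rewrite !size_cat;
  lia.
have [_] := eq_level_points (h2 _ lv); rewrite -ej -ej'; exact.
Qed.

End SiteMoves.

Section SiteTransport.

Variable r : labeling_rule.
Notation X := (label r).
Notation strand := (bool * X)%type.
Implicit Types (S T : seq strand) (rows : seq (seq strand)) (w : word).
Implicit Types (C : point -> X).

Variables (u m m' v : word) (s1 s2 : seq bool).
Hypotheses (ru : run u [::] = Some s1) (rm : run m s1 = Some s2)
  (rm' : run m' s1 = Some s2) (rv : run v s2 = Some [::]).

Let agree_site C C' := forall x y, site_point u m m' v x y -> C x = C' y.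

Lemma level_low C D j R R' : rows_of C D = R ++ R' -> (j <= size R)%N ->
  level C D j = nth [::] ([::] :: R) j.
Proof.
move=> e lj; rewrite level_nth; last by rewrite -(size_rows_of C) e size_cat
  (leq_trans lj) ?leq_addr.
by rewrite e; case: j lj => //= j lj; rewrite nth_cat lj.
Qed.

Lemma level_mid C D j Ra Rb Rc : rows_of C D = Ra ++ Rb ++ Rc ->
  (j < size Rb)%N ->
  level C D (size Ra + j.+1) = nth [::] Rb j.
Proof.
move=> e lj; rewrite level_nth; last by rewrite -(size_rows_of C) e !size_cat
  leq_add2l ltn_addr.
by rewrite e nth_cat_last /= nth_cat lj.
Qed.

Lemma level_high C D j Ra Rb Rc : rows_of C D = Ra ++ Rb ++ Rc ->
  (j <= size Rc)%N ->
  level C D (size Ra + size Rb + j)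
  = nth [::] (last (last [::] Ra) Rb :: Rc) j.
Proof.
move=> e lj; rewrite level_nth; last by rewrite -(size_rows_of C) e !size_cat
  -addnA !leq_add2l.
by rewrite e -addnA !nth_cat_last.
Qed.

Lemma eq_levels C C' D D' : D = D' ->
  rows_of C D = rows_of C' D' -> {in points D, C =1 C'}.
Proof.
move=> <- e [j i]; rewrite mem_points /= => /andP[lj li].
have : level C D j = level C' D j by rewrite !level_nth ?e.
by case/eq_level_points=> _; apply.
Qed.

Lemma eq_rows_low (Ra Ra' : seq (seq strand)) : size Ra = size Ra' ->
  (forall j, (j <= size Ra)%N -> nth [::] ([::] :: Ra) j
    = nth [::] ([::] :: Ra') j) ->
  Ra = Ra'.
Proof.
move=> sz h; apply: (@eq_from_nth _ [::]) => // j lj; exact: (h j.+1).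
Qed.

(** Two labelings which agree outside the site consist of the same labeled
    sections below and above it, and their sums differ only by the
    contributions of the two words m and m'. *)
Lemma site_rows C C' : labels r (u ++ m ++ v) C -> labels r (u ++ m' ++ v) C' ->
  agree_site C C' ->
  exists Ra Rm Rm' Rb,
  [/\ rows_of C (u ++ m ++ v) = Ra ++ Rm ++ Rb,
      rows_of C' (u ++ m' ++ v) = Ra ++ Rm' ++ Rb,
      size Ra = size u /\ size Rm' = size m',
      [/\ lpath m (last [::] Ra) Rm, lpath m' (last [::] Ra) Rm' &
       last (last [::] Ra) Rm = last (last [::] Ra) Rm'] &
      state_sum r (u ++ m ++ v) C - lpath_value m (last [::] Ra) Rm =
      state_sum r (u ++ m' ++ v) C' - lpath_value m' (last [::] Ra) Rm'].
Proof.
move=> lC lC' /(agree_rows _ _ ru rm rm' rv) [h1 h2].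
have rD := site_run ru rm rv; have rD' := site_run ru rm' rv.
have [|Ra [Rm [Rb [e sa sm [pa pm pb v1]]]]] := rows_of_split _ lC;
  first by rewrite rD.
have [|Ra' [Rm' [Rb' [e' sa' sm' [pa' pm' pb' v2]]]]] := rows_of_split _ lC';
  first by rewrite rD'.
have eRa : Ra' = Ra.
  apply/esym/eq_rows_low; rewrite ?sa ?sa' // => j lj.
  by rewrite -(level_low e) ?sa // -(level_low e') ?sa' // h1.
subst Ra'; have sb : size Rb = size v by rewrite (lpath_size pb).
have sb' : size Rb' = size v by rewrite (lpath_size pb').
have hb j : (j <= size v)%N ->
  nth [::] (last (last [::] Ra) Rm :: Rb) j = nth [::]
    (last (last [::] Ra) Rm' :: Rb') j.
  move=> lj; rewrite -(level_high e) ?sb // -(level_high e') ?sb' //.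
  by rewrite sa sm sm' h2.
have el := hb 0%N isT; rewrite /= in el.
have eb : Rb' = Rb.
  apply/esym/(@eq_from_nth _ [::]); rewrite ?sb ?sb' // => j lj;
    exact: (hb j.+1).
subst Rb'; exists Ra, Rm, Rm', Rb; split=> //.
by rewrite v1 v2 el [lpath_value m _ _ + _]addrC [lpath_value m' _ _ + _]addrC
  !addrA !addrK.
Qed.

(** P collects what is to be remembered of the labels inside the site; it is
    needed for the label of a newly born circle. *)
Lemma site_extend C (P : seq (seq strand) -> Prop) : labels r (u ++ m ++ v) C ->
  (forall rows, lpath m (level C (u ++ m ++ v) (size u)) rows ->
     last (level C (u ++ m ++ v) (size u)) rows
       = level C (u ++ m ++ v) (size u + size m) ->
     exists rows', [/\ lpath m' (level C (u ++ m ++ v) (size u)) rows',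
       last (level C (u ++ m ++ v) (size u)) rows'
         = last (level C (u ++ m ++ v) (size u)) rows & P rows']) ->
  exists C', [/\ labels r (u ++ m' ++ v) C', agree_site C C' &
    exists2 rows', P rows' & forall j, (j < size m')%N ->
      level C' (u ++ m' ++ v) (size u + j.+1) = nth [::] rows' j].
Proof.
move=> lC hP; have rD := site_run ru rm rv.
have [|Ra [Rm [Rb [e sa sm [pa pm pb _]]]]] := rows_of_split _ lC;
  first by rewrite rD.
have el : level C (u ++ m ++ v) (size u) = last [::] Ra.
  rewrite (level_low e) ?sa //; rewrite -sa.
  by have := nth_cat_last [::] [::] Ra [::] 0; rewrite cats0 addn0.
have sb : size Rb = size v by rewrite (lpath_size pb).
have el2 : level C (u ++ m ++ v) (size u + size m) = last (last [::] Ra) Rm.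
  by have := level_high e (leq0n _); rewrite addn0 sa sm.
rewrite el el2 in hP; have [Rm' [pm' lm' PR]] := hP Rm pm erefl.
have pD : lpath (u ++ m' ++ v) [::] (Ra ++ Rm' ++ Rb).
  apply/lpath_cat => //; split=> //; apply/lpath_cat; first exact: lpath_size
    pm'.
  by rewrite lm'.
pose C' := labeling_of (C (0%N, 0%N)) (Ra ++ Rm' ++ Rb).
have e' : rows_of C' (u ++ m' ++ v) = Ra ++ Rm' ++
  Rb by apply: rows_of_labeling.
have sm' : size Rm' = size m' := lpath_size pm'.
exists C'; split; first exact: labels_of_lpath.
  apply/(agree_rows _ _ ru rm rm' rv); split=> j lj.
    by rewrite (level_low e) ?(level_low e') ?sa.
  by rewrite -sa -sm -sm' (level_high e) ?(level_high e') ?lm' ?sb.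
exists Rm' => // j lj.
by rewrite -sa (level_mid e') // sm'.
Qed.

Lemma site_unique C C1 C2 :
  (forall S rows1 rows2, lpath m' S rows1 -> lpath m' S rows2 ->
    last S rows1 = last S rows2 ->
    (forall j, (j < size m')%N -> level C1 (u ++ m' ++ v) (size u + j.+1)
      = nth [::] rows1 j) ->
    (forall j, (j < size m')%N -> level C2 (u ++ m' ++ v) (size u + j.+1)
      = nth [::] rows2 j) ->
    rows1 = rows2) -> labels r (u ++ m ++ v) C ->
  labels r (u ++ m' ++ v) C1 -> labels r (u ++ m' ++ v) C2 ->
  agree_site C C1 -> agree_site C C2 -> {in points (u ++ m' ++ v), C1 =1 C2}.
Proof.
move=> ri lC l1 l2 a1 a2.
have [Ra [Rm [R1 [Rb [e e1 [sa s1'] [pm p1 el1] _]]]]] := site_rows lC l1 a1.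
have [Ra' [Rm' [R2 [Rb' [e' e2 [sa' s2'] [pm' p2 el2] _]]]]] := site_rows lC l2
  a2.
have ea : Ra' = Ra /\ Rm' ++ Rb' = Rm ++ Rb.
  by move: e'; rewrite e => /eqP; rewrite eqseq_cat ?sa ?sa' // => /andP[/eqP ->
    /eqP ->].
case: ea => ea eb; subst Ra'.
have em : Rm' = Rm /\ Rb' = Rb.
  move/eqP: eb; rewrite eqseq_cat; last by rewrite (lpath_size pm)
    (lpath_size pm').
  by case/andP=> /eqP -> /eqP ->.
case: em => ? ?; subst Rm' Rb'.
apply: eq_levels => //; rewrite e1 e2.
rewrite (ri _ _ _ p1 p2) -?el1 -?el2 // => j lj.
  by rewrite -sa (level_mid e1) ?s1'.
by rewrite -sa' (level_mid e2) ?s2'.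
Qed.

End SiteTransport.

Section SiteWords.

Variable r : labeling_rule.
Notation X := (label r).
Notation strand := (bool * X)%type.
Implicit Types (S T : seq strand) (rows : seq (seq strand)) (w : word).
Implicit Types (C : point -> X).

Lemma circle_path i o S rows : lpath (circle i o) S rows <->
  (i <= size S)%N /\ exists x,
    rows = [:: take i S ++ [:: (o, x), (~~ o, x) & drop i S]; S].
Proof.
elim: i S rows => [|i IH] S rows.
  rewrite take0 drop0 lpath2; split.
    by case=> T [T' [-> [x ->] [_ ->]]]; split=> //; exists x.
  by case=> _ [x ->]; do 2!eexists; split=> //; exists x.
rewrite -[circle _ _]/(indent (circle i o)); case: S => [|A S].
  by split=> [/lpath_indent_nil|[]//]; case.
rewrite lpath_indent; split.
  by case=> rows' -> /IH [lei [x ->]]; split=> //; exists x.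
case=> lei [x ->]; exists [:: take i S ++ [:: (o, x), (~~ o, x) & drop i S];
  S] => //.
by apply/IH; split=> //; exists x.
Qed.

Lemma circle_value i o S rows : lpath (circle i o) S rows ->
  lpath_value (circle i o) S rows = 0.
Proof. by case/circle_path=> _ [x ->]; rewrite /= /step_value /= !addr0. Qed.

(** The labels a of the lower arc and y of the upper arc are unrelated, which
    is why the two feet of a saddle must be given equal labels beforehand. *)
Lemma turnbacks_path i o S rows : lpath (turnbacks i o) S rows <->
  exists L R p a y, [/\ size L = i, S = L ++ [:: (p, a), (~~ p, a) & R] &
    rows = [:: L ++ R; L ++ [:: (o, y), (~~ o, y) & R]]].
Proof.
elim: i S rows => [|i IH] S rows.
  rewrite lpath2; split.
    case=> T [T' [-> ]]; case: S => [|[p a] [|B S]] //= [-> ->] [y ->].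
    by exists [::], S, p, a, y.
  case=> L [R [p [a [y [/size0nil -> -> ->]]]]]; do 2!eexists; split=> //.
  by exists y.
rewrite -[turnbacks _ _]/(indent (turnbacks i o)); case: S => [|A S].
  split=> [/lpath_indent_nil|]; first by case.
  by case=> -[|? ?] [? [? [? [? []]]]].
rewrite lpath_indent; split.
  case=> rows' -> /IH [L [R [p [a [y [sL -> ->]]]]]].
  by exists (A :: L), R, p, a, y; rewrite /= sL.
case=> [[|A' L]] [R [p [a [y []]]]] // [sL] [-> ->] ->.
exists [:: L ++ R; L ++ [:: (o, y), (~~ o, y) & R]] => //.
by apply/IH; exists L, R, p, a, y.
Qed.

Lemma turnbacks_value i o S rows :
  lpath (turnbacks i o) S rows -> lpath_value (turnbacks i o) S rows = 0.
Proof.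
by case/turnbacks_path=> L [R [p [a [y [_ _ ->]]]]]; rewrite /= /step_value /=
  !addr0.
Qed.

Lemma rigid_turnbacks i o : rigid r (turnbacks i o).
Proof. exact: rigid_pair. Qed.

Definition is_detour (mv : move) := if mv is Detour _ _ then true else false.
Lemma valid_site mv u m m' v : valid_move mv -> site mv = (u, m, m', v) ->
  exists s1 s2, [/\ run u [::] = Some s1, run m s1 = Some s2,
    run m' s1 = Some s2
    & run v s2 = Some [::]].
Proof.
rewrite /valid_move /source => -[+ + _] e; rewrite e /closed_word !run_cat.
case: (run u _) => //= s1; rewrite run_cat; case em: (run m s1) => [s2|] //=
  /eqP rv em'.
by exists s1, s2.
Qed.

Lemma same_point_site mv u m m' v x y : ~~ is_detour mv ->
  site mv = (u, m, m', v) ->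
  same_point mv x y = site_point u m m' v x y.
Proof.
rewrite /same_point /source /target /site_point => nd ->.
by case: mv nd => // [? ? ? ?||???|???].
Qed.

End SiteWords.

Section MoveTransport.

Variable r : labeling_rule.
Notation X := (label r).
Notation strand := (bool * X)%type.
Implicit Types (S T : seq strand) (rows : seq (seq strand)) (w : word).
Implicit Types (C : point -> X).

Lemma unzip1_level C D j : unzip1 (level C D j) = section D j.
Proof. exact: unzip1_attach. Qed.

Lemma section_site u w s1 : run u [::] = Some s1 ->
  section (u ++ w) (size u) = s1.
Proof. by move=> e; rewrite section_size_cat e. Qed.

Lemma nth_level C D j i x0 : (i < size (section D j))%N ->
  (nth (true, x0) (level C D j) i).2 = C (j, i).
Proof. exact: nth_attach. Qed.

Lemma run_turnbacks i o S : run (turnbacks i o) (unzip1 S) = Some (unzip1 S) ->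
  exists L R a b, size L = i /\ S = L ++ [:: (o, a), (~~ o, b) & R].
Proof.
elim: i S => [|i IH] S.
  case: S => [|[p a] [|[q b] S]] //=; rewrite ?take0 ?drop0 //=.
  case: ifP => // _ /=; rewrite ?take0 ?drop0 /= => -[<- <-].
  by exists [::], S, a, b.
rewrite -[turnbacks _ _]/(indent (turnbacks i o)); case: S => [|A S] //.
rewrite [unzip1 _]/= run_indent; case E: run => [s|] //= [es].
have [|L [R [a [b [<- eS]]]]] := IH S; first by rewrite E es.
by exists (A :: L), R, a, b; rewrite /= eS.
Qed.

(** An isotopy transports the labels, a birth lets x0 be the label of the
    circle, and at a saddle the equality of the labels of the feet makes the
    new arcs consistent. *)
Lemma site_move_extend mv C (x0 : X) : ~~ is_detour mv -> valid_move mv ->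
  labels r (source mv) C -> feet_agree mv C ->
  exists C', [/\ labels r (target mv) C', agree mv C C' &
    circle_label mv C' x0].
Proof.
move=> nd va; case es: (site mv) => [[[u m] m'] v].
have [s1 [s2 [ru rm rm' rv]]] := valid_site va es.
rewrite /source /target es /= => lC hf.
set S1 := level C (u ++ m ++ v) (size u).
have uS1 : unzip1 S1 = s1 by rewrite unzip1_level (section_site _ ru).
have sS1 : size S1 = size s1 by rewrite -uS1 size_map.
have uS2 rows : lpath m S1 rows -> unzip1 (last S1 rows) = s2.
  by move/lpath_run; rewrite uS1 rm => -[].
suff [P [hP1 hP2]] : exists P : seq (seq strand) -> Prop,
   (forall rows, lpath m S1 rows ->
     last S1 rows = level C (u ++ m ++ v) (size u + size m) ->
     exists rows', [/\ lpath m' S1 rows', last S1 rows' = last S1 rows &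
       P rows']) /\
   (forall C' rows', P rows' -> (forall j, (j < size m')%N ->
      level C' (u ++ m' ++ v) (size u + j.+1) = nth [::] rows' j) ->
      circle_label mv C' x0).
  have [C' [l' a' [rows P' hP']]] := site_extend ru rm rm' rv lC hP1.
  exists C'; split=> //; first by move=> x y;
    rewrite (same_point_site _ _ nd es); apply: a'.
  exact: hP2 P' hP'.
case: mv nd es va hf => //=.
- move=> u' m1 m1' v' _ [? ? ? ?] [_ _ iso] _; subst u' m1 m1' v'.
  exists (fun=> True); split=> // rows p _.
  have tr : transports r m m'.
    by case: iso => /(isotopy_interchangeable r) [].
  by have [|rows' [p' l' _]] := tr _ _ p; [rewrite uS1 uS2|exists rows'].
- move=> u' i o v' _ [? ? ? ?] _ _; subst u' m m' v'.
  exists (fun rows' => (i <= size S1)%N /\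
    rows' = [:: take i S1 ++ [:: (o, x0), (~~ o, x0) & drop i S1]; S1]); split.
    move=> rows /lpath0 -> _; have lei : (i <= size S1)%N.
      by rewrite sS1; move: rm'; rewrite /circle /=; case: ifP.
    exists [:: take i S1 ++ [:: (o, x0), (~~ o, x0) & drop i S1]; S1];
      split=> //.
    by apply/circle_path; split=> //; exists x0.
  move=> C' rows' [lei ->] /(_ 0%N isT); rewrite addn1 /= => e.
  have si : (i < size (take i S1 ++ [:: (o, x0), (~~ o, x0) & drop i S1]))%N.
    by rewrite size_cat size_takel //= addnS ltnS leq_addr.
  rewrite -(@nth_level C' (u ++ circle i o ++ v) _ _ x0); last first.
    by rewrite -(unzip1_level C') e size_map.
  by rewrite e nth_cat size_takel // ltnn subnn.
- move=> u' i o v' _ [? ? ? ?] _ _; subst u' m m' v'.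
  exists (fun=> True); split=> // rows /circle_path[_ [x ->]] _.
  by exists [::].
- move=> u' i o b v' _ es _ hf; exists (fun=> True); split=> // rows p el.
  move: hf; case: b es => -[? ? ? ?] /= hf; subst u' m m' v'.
    move/lpath0: p => -> /=.
    have e12 : s2 = s1 by case: rm.
    have [|L [R [a [b [sL eS]]]]] := @run_turnbacks i o S1; first by rewrite uS1
      rm' e12.
    have li k : (k < 2)%N -> (i + k < size (section (u ++ v) (size u)))%N.
      by move=> ?; rewrite -(unzip1_level C) size_map -/S1 eS size_cat sL /=;
        lia.
    have ea : C (size u, i) = a.
      have := nth_level C a (li 0%N isT); rewrite -/S1 eS addn0 nth_cat sL ltnn
        subnn /=; exact.
    have eb : C (size u, i.+1) = b.
      have := nth_level C a (li 1%N isT); rewrite -/S1 eS addn1 nth_cat sL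
        ltnNge leqnSn /= subSnn /=; exact.
    have eab : a = b by rewrite -ea -eb.
    have p' : lpath (turnbacks i o) (L ++ [:: (o, a), (~~ o, a) & R])
        [:: L ++ R; L ++ [:: (o, a), (~~ o, a) & R]].
      by apply/turnbacks_path; exists L, R, o, a, a.
    by exists [:: L ++ R; L ++ [:: (o, a), (~~ o, a) & R]]; rewrite eS -eab.
  have [L [R [p' [a [y [sL eS eR]]]]]] := iffLR (turnbacks_path _ _ _ _) p.
  have el' := uS2 _ p; rewrite el in el'.
  exists [::]; split=> //; move: el; rewrite eR /= => el.
  have : unzip1 S1 = unzip1 (L ++ [:: (o, y), (~~ o, y) & R]).
    by rewrite uS1 el el'; case: rm' => ->.
  rewrite eS /unzip1 !map_cat /= => /eqP; rewrite eqseq_cat // eqxx /= =>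
    /andP[/eqP ep _].
  have li : (i < size (section (u ++ turnbacks i o ++ v) (size u)))%N.
    by rewrite -(unzip1_level C) size_map -/S1 eS size_cat sL /=; lia.
  have li2 : (i < size (section (u ++ turnbacks i o ++ v) (size u).+2))%N.
    by rewrite -(unzip1_level C) size_map -addn2 -el size_cat sL /=; lia.
  have ea : C (size u, i) = a.
    have := nth_level C a li; rewrite -/S1 eS nth_cat sL ltnn subnn /=; exact.
  have ey : C ((size u).+2, i) = y.
    have := nth_level C a li2; rewrite -addn2 -el nth_cat sL ltnn subnn /=;
      exact.
  by rewrite -ep -ey -hf ea.
Qed.

Definition circles_agree mv C C' : Prop :=
  if mv is Birth u i _ _ then C ((size u).+1, i)
    = C' ((size u).+1, i) else True.

Lemma site_move_unique mv C C1 C2 : ~~ is_detour mv -> valid_move mv ->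
  labels r (source mv) C -> labels r (target mv) C1 ->
    labels r (target mv) C2 ->
  agree mv C C1 -> agree mv C C2 -> circles_agree mv C1 C2 ->
  {in points (target mv), C1 =1 C2}.
Proof.
move=> nd va; case es: (site mv) => [[[u m] m'] v].
have [s1 [s2 [ru rm rm' rv]]] := valid_site va es.
have sp x y := same_point_site x y nd es.
rewrite /source /target es /= => lC l1 l2 a1 a2 hc.
apply: (@site_unique r u m m' v s1 s2 ru rm rm' rv C C1 C2) => //;
  try by move=> x y; rewrite -sp; auto.
case: mv nd es va hc {sp a1 a2} => //=.
- move=> u' m1 m1' v' _ [? ? ? ?] [_ _ iso] _; subst u' m1 m1' v'.
  have ri : rigid r m' by case: iso => /(isotopy_interchangeable r) [].
  by move=> S rows1 rows2 p1 p2 e _ _; apply: ri p1 p2 e.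
- move=> u' i o v' _ [? ? ? ?] _ e; subst u' m m' v'.
  move=> S rows1 rows2 /circle_path[lei [x ->]] /circle_path[_ [y ->]] _.
  move=> /(_ 0%N isT) e1 /(_ 0%N isT) e2.
  have si (z : X) : (i < size (take i S ++ [:: (o, z), (~~ o, z) &
    drop i S]))%N.
    by rewrite size_cat size_takel //= addnS ltnS leq_addr.
  have val C' z : level C' (u ++ circle i o ++ v) (size u + 1)
      = take i S ++ [:: (o, z), (~~ o, z) & drop i S] -> C' ((size u).+1, i)
        = z.
    rewrite addn1 => ez; rewrite -(@nth_level C' (u ++ circle i o ++ v) _ _ z);
      last first.
      by rewrite -(unzip1_level C') ez size_map.
    by rewrite ez nth_cat size_takel // ltnn subnn.
  by rewrite -(val _ _ e1) -(val _ _ e2) e.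
- move=> u' i o v' _ [? ? ? ?] _ _; subst u' m m' v'.
  by move=> S rows1 rows2 /lpath0 -> /lpath0 ->.
- move=> u' i o b v' _ es _ _; case: b es => -[? ? ? ?]; subst u' m m' v'.
    by move=> S rows1 rows2 p1 p2 e _ _; apply: rigid_turnbacks p1 p2 e.
  by move=> S rows1 rows2 /lpath0 -> /lpath0 ->.
Qed.

Lemma site_move_sum mv C C' : ~~ is_detour mv -> valid_move mv ->
  labels r (source mv) C -> labels r (target mv) C' -> agree mv C C' ->
  state_sum r (source mv) C = state_sum r (target mv) C'.
Proof.
move=> nd va; case es: (site mv) => [[[u m] m'] v].
have [s1 [s2 [ru rm rm' rv]]] := valid_site va es.
have sp x y := same_point_site x y nd es.
rewrite /source /target es /= => lC lC' ag.
have [|Ra [Rm [Rm' [Rb [_ _ _ [pm pm' el] ev]]]]] := site_rows ru rm rm' rv lC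
  lC'.
  by move=> x y; rewrite -sp; apply: ag.
suff e : lpath_value m (last [::] Ra) Rm = lpath_value m' (last [::] Ra) Rm'.
  by move: ev; rewrite e => /(addIr _).
case: mv nd es va {sp ag} => //=.
- move=> u' m1 m1' v' _ [? ? ? ?] [_ ex iso]; subst u' m1 m1' v'.
  have [tr ri] : transports r m m' /\ rigid r m'.
    by case: iso => /(isotopy_interchangeable r) [].
  have := lpath_run pm'; rewrite -el => rS.
  have [rows' [p' l' <-]] := tr _ _ pm rS.
  by rewrite (ri _ _ _ p' pm') // l'.
- move=> u' i o v' _ [? ? ? ?] _; subst u' m m' v'.
  by rewrite (circle_value pm'); case: (Rm).
- move=> u' i o v' _ [? ? ? ?] _; subst u' m m' v'.
  by rewrite (circle_value pm); case: (Rm').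
- move=> u' i o b v' _ es _; case: b es => -[? ? ? ?]; subst u' m m' v'.
    by rewrite (turnbacks_value pm'); case: (Rm).
  by rewrite (turnbacks_value pm); case: (Rm').
Qed.

End MoveTransport.

(** * Erasing a marked arc *)

Section Detour.

Variable r : labeling_rule.
Notation X := (label r).
Notation strand := (bool * X)%type.
Notation msection := (seq (bool * bool)).
Implicit Types (S T U V : seq strand) (rows : seq (seq strand)) (w : word).
Implicit Types (C : point -> X) (a : marked_word) (s : msection).

Fixpoint erase_from s a : seq erased_layer :=
  if a is l :: a' then
    oapp (fun e => [:: e]) [::] (erase_layer l s)
    ++ erase_from (odflt [::] (apply_marked_layer l s)) a'
  else [::].

Lemma marked_run_cat a b s :
  marked_run (a ++ b) s = obind (marked_run b) (marked_run a s).
Proof. by elim: a s => [|l a IH] s //=; case: apply_marked_layer => //=. Qed.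

Lemma erase_fromE a : marked_run a [::] -> erase a = erase_from [::] a.
Proof.
move=> rD; rewrite /erase.
suff H b c s : marked_run b [::] = Some s -> marked_run c s ->
  pmap (fun kl => erase_layer kl.2 (marked_section (b ++ c) kl.1))
       (zip (iota (size b) (size c)) c) = erase_from s c by apply: (H [::]).
elim: c b s => [|l c IH] b s rb //=; case E: apply_marked_layer => [s'|] //= rc.
rewrite [marked_section _ _]/marked_section take_size_cat // rb /=.
have -> : pmap (fun kl => erase_layer kl.2 (marked_section (b ++ l :: c) kl.1))
   (zip (iota (size b).+1 (size c)) c) = erase_from s' c.
  rewrite -cat_rcons -(size_rcons b l); apply: IH => //.
  by rewrite -cats1 marked_run_cat rb /= E.
by case: erase_layer.
Qed.

Definition unmarked s S : seq strand := mask [seq ~~ x.2 | x <- s] S.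

Definition loose (i : nat) (A : strand) U V :=
  (i <= size U)%N /\ V = take i U ++ A :: drop i U.

(** The sub-arc has no classical crossing, so that a single label y is found on
    it. It is recorded at the loose ends: below an end the sub-arc is present
    if it leaves the end downward, in which case the unmarked strand appears
    above it, and conversely. *)
Definition erased_step (y : X) (e : erased_layer) U V : Prop :=
  match e with
  | Kept l => step l U V
  | LooseEnd i o b => if b then loose i (o, y) U V else loose i (o, y) V U
  end.

Definition erased_value (e : erased_layer) U : value r :=
  if e is Kept l then step_value l U else 0.

Fixpoint erased_path y (e : seq erased_layer) U rows : Prop :=
  match e, rows with
  | [::], [::] => True
  | l :: e', V :: rows' => erased_step y l U V /\ erased_path y e' V rows'
  | _, _ => False
  end.

Fixpoint erased_path_value (e : seq erased_layer) U rows : value r :=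
  match e, rows with
  | l :: e', V :: rows' => erased_value l U + erased_path_value e' V rows'
  | _, _ => 0
  end.

Definition marks_are (y : X) s S :=
  all (fun p => p.1.2 ==> (p.2.2 == y)) (zip s S).

(** The erased layer seen with one more strand on the left, which shifts it
    only if this strand is unmarked. *)
Definition under (m : bool * bool) (e : erased_layer) : erased_layer :=
  if m.2 then e else
  match e with
  | Kept (i, g) => Kept (i.+1, g)
  | LooseEnd i o b => LooseEnd i.+1 o b
  end.

Definition push (m : bool * bool) (A : strand) U := if m.2 then U else A :: U.

Lemma erased_step_under y m A e U V :
  erased_step y e U V -> erased_step y (under m e) (push m A U) (push m A V).
Proof.
rewrite /under /push; case: (m.2) => //; case: e => [[i g]|i o []] //=.
  by case=> le ->.
by case=> le ->.
Qed.

Lemma erased_step_under_inv y m A e U V' :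
  erased_step y (under m e) (push m A U) V' ->
  exists2 V, V' = push m A V & erased_step y e U V.
Proof.
rewrite /under /push; case: (m.2); first by exists V'.
case: e => [[i g]|i o []] /=.
- by case: V' => [|B V] //= [<- st]; exists V.
- by case=> le ->; exists (take i U ++ (o, y) :: drop i U).
by rewrite /loose; case: V' => [|B V] [] //= le [-> ->]; exists V.
Qed.

Lemma erased_value_under m A e U :
  erased_value (under m e) (push m A U) = erased_value e U.
Proof.
by rewrite /under /push; case: (m.2) => //; case: e => [[i g]|i o b].
Qed.

Definition indent_marked (l : marked_layer) : marked_layer :=
  match l with Event f (i, g) => Event f (i.+1, g) | End i => End i.+1 end.

Lemma apply_marked_layer_indent l m s :
  apply_marked_layer (indent_marked l) (m :: s)
  = omap (cons m) (apply_marked_layer l s).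
Proof.
case: l => [f [i g]|i] /=; first by rewrite ltnS; case: ifP => // _;
  case: apply_marked_event.
by case: drop.
Qed.

Lemma erase_layer_indent l m s :
  erase_layer (indent_marked l) (m :: s) = omap (under m) (erase_layer l s).
Proof.
case: l => [f [i g]|i] /=; rewrite /unmarked_before /under /=; case: (m.2) =>
  //=;
by case: (match g with Cup _ => f | Cap => is_marked s i | Cross _ => is_marked
  s i || is_marked s i.+1 end).
Qed.

Definition underlying_step (l : marked_layer) S S' : Prop :=
  if l is Event _ l' then step l' S S' else S' = S.

Definition underlying_value (l : marked_layer) S : value r :=
  if l is Event _ l' then step_value l' S else 0.

Definition end_labeled (y : X) (l : marked_layer) S : Prop :=
  if l is End i then (nth (true, y) S i).2 = y else True.

Definition erased_like y l s S s' S' : Prop :=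
  unzip1 s' = unzip1 S' /\
  if erase_layer l s is Some e
  then erased_step y e (unmarked s S) (unmarked s' S')
       /\ underlying_value l S = erased_value e (unmarked s S)
  else unmarked s' S' = unmarked s S /\ underlying_value l S = 0.

Lemma erased_like_indent y l m A s S s' S' : m.1 = A.1 ->
  erased_like y l s S s' S' ->
  erased_like y (indent_marked l) (m :: s) (A :: S) (m :: s') (A :: S').
Proof.
rewrite /erased_like erase_layer_indent /= => -> [-> h]; split=> //.
have ev : underlying_value (indent_marked l) (A :: S) = underlying_value l S.
  by case: l {h} => [f [i g]|i].
rewrite ev -![unmarked (m :: _) (A :: _)]/(_ : seq strand).
have eu t T : unmarked (m :: t) (A :: T) = push m A (unmarked t T).
  by rewrite /unmarked /push /=; case: (m.2).
rewrite !eu; case: erase_layer h => [e|] /= [h1 h2].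
  by rewrite erased_value_under h2; split=> //; apply: erased_step_under.
by rewrite h1.
Qed.

Lemma marked_layer_position_ind (P : marked_layer -> Prop) :
  (forall f g, P (Event f (0%N, g))) -> P (End 0) ->
  (forall l, P l -> P (indent_marked l)) -> forall l, P l.
Proof.
move=> h1 h2 h3 [f [i g]|i]; elim: i => // i; exact: h3.
Qed.

Lemma unmarked_cons m A s S :
  unmarked (m :: s) (A :: S) = push m A (unmarked s S).
Proof. by rewrite /unmarked /push /=; case: (m.2). Qed.

Lemma underlying_step_indent l A S S' :
  underlying_step (indent_marked l) (A :: S) S' ->
  exists2 S1, S' = A :: S1 & underlying_step l S S1.
Proof.
case: l => [f [i g]|i] /=; last by exists S.
by case: S' => [|B S'] //= [-> st]; exists S'.
Qed.

(** Erasing marked strands commutes with each layer: virtual crossings do not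
    change labels, and a marked maximum or minimum disappears. At an end, the
    label of the sub-arc passes to the unmarked strand. *)
Lemma erase_forward y l s s' S S' : apply_marked_layer l s = Some s' ->
  unzip1 s = unzip1 S -> unzip1 s' = unzip1 S' -> underlying_step l S S' ->
  end_labeled y l S ->  erased_like y l s S s' S'.
Proof.
elim/marked_layer_position_ind: l s s' S S' => [f g | |l IH] s s' S S';
  last first.
- case: s S => [|m s] [|A S] //; try by case: (l) => [f [i g]|i].
  rewrite apply_marked_layer_indent; case E: apply_marked_layer => [s1|] //=
    [<-] [e1 e2] e3.
  case/underlying_step_indent=> S1 eS' st; subst S'; case: e3 => _ e3 el.
  apply: erased_like_indent => //; apply: IH => //.
  by case: (l) el => [f [i g]|i].
- case: s S => [|[o k] s] [|[p x] S] //=; rewrite ?drop0 => -[<-] [<- es] _ ->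
  /= ->.
  split; rewrite /= ?es // /unmarked_before /is_marked take0 /= !unmarked_cons
    /push /=.
  by case: k; rewrite /= /loose take0 drop0.
case: g => [o||k].
- rewrite /= ?drop0 ?take0 /= => -[<-] es _ [x ->] _; split; rewrite /= ?es //.
  case: f; rewrite /= /unmarked_before ?take0 !unmarked_cons /push //=.
  split; [by exists x|by []].
- case: s S => [|[o1 k1] [|[o2 k2] s]] [|[p1 x1] [|[p2 x2] S]] //=;
  rewrite ?take0 //.
  case: ifP => //= /andP[_ /eqP /= ek] [<-]; rewrite ek drop0 => -[-> -> es] _
    [[-> ->] ->] _.
  split; rewrite /= ?es // /is_marked /=.
  by case: k2 {ek}; rewrite /= !unmarked_cons /push.
case: s S => [|[o1 k1] [|[o2 k2] s]] [|[p1 x1] [|[p2 x2] S]] //=;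
  rewrite ?take0 //.
case: ifP => //= cl [<-]; rewrite drop0 => -[-> -> es] _ -> _.
rewrite /erased_like /= /is_marked /=; split.
  by rewrite /cross es; case: is_classical.
rewrite /cross /step /= /step_value /= /cross_value; move: cl; case: k1;
  case: k2;
  case ck: (is_classical k) => //= _; rewrite !unmarked_cons /push //=.
  by rewrite /unmarked_before take0 /step /= /cross /step_value /= /cross_value
    ck.
by rewrite /unmarked_before take0 /step /= /cross /step_value /= /cross_value
  ck.
Qed.

Lemma marks_are_cons y m A s S :
  marks_are y (m :: s) (A :: S) = (m.2 ==> (A.2 == y)) && marks_are y s S.
Proof. by []. Qed.

(** From the labels of the erased picture those of the full picture are
    recovered, marked strands being given the label y. A marked minimum is
    labeled y, and no other label has to be guessed. *)
Lemma erase_backward y l s s' S V : apply_marked_layer l s = Some s' ->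
  unzip1 s = unzip1 S -> marks_are y s S ->
  (if erase_layer l s is Some e then erased_step y e (unmarked s S) V
   else V = unmarked s S) ->
  exists S', [/\ underlying_step l S S', unzip1 s' = unzip1 S',
    marks_are y s' S',
    unmarked s' S' = V & end_labeled y l S].
Proof.
elim/marked_layer_position_ind: l s s' S V => [f g | |l IH] s s' S V;
  last first.
- case: s S => [|m s] [|A S] //; try by case: (l) => [f [i g]|i].
  rewrite apply_marked_layer_indent; case E: apply_marked_layer => [s1|] //=
    [<-] [e1 e2].
  rewrite marks_are_cons => /andP[e3 e4]; rewrite erase_layer_indent
    unmarked_cons.
  move=> h; have [V1 eV h1] : exists2 V1, V = push m A V1 &
      if erase_layer l s is Some e then erased_step y e (unmarked s S) V1
      else V1 = unmarked s S.
    case: erase_layer h => [e|] /= h; last by exists (unmarked s S).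
    exact: erased_step_under_inv h.
  have [S' [st es' ms' us' el]] := IH _ _ _ _ E e2 e4 h1.
  exists (A :: S'); rewrite marks_are_cons e3 ms' unmarked_cons us' /= e1 es';
    split=> //.
    by case: (l) st => [f [i g]|i] //= ->.
  by case: (l) el => [f [i g]|i].
- case: s S => [|[o k] s] [|[p x] S] //=; rewrite ?drop0 => -[<-] [<- es].
  rewrite marks_are_cons /= => /andP[e3 e4].
  rewrite /unmarked_before take0 /is_marked /= !unmarked_cons /push /= => h.
  have [ex eV] : x = y /\ V = if k then (o, y) :: unmarked s S else unmarked s
    S.
    case: k e3 h => /= [/eqP -> | _]; rewrite /loose.
      by case=> _ ->; rewrite take0 drop0.
    by case=> _; rewrite take0 drop0 => -[-> ->].
  exists ((o, x) :: S); split=> //; first by rewrite /= es.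
    by rewrite marks_are_cons /= e4 ex eqxx implybT.
  by rewrite unmarked_cons /push /= eV ex; case: (k).
case: g => [o||k].
- rewrite /= ?drop0 ?take0 /= ?drop0 => -[<-] es ms; rewrite /unmarked_before
  take0.
  case: f => /= h.
    exists [:: (o, y), (~~ o, y) & S]; split=> //.
    + by exists y.
    + by rewrite /= es.
    + by rewrite !marks_are_cons /= eqxx.
  case: h => x ->; exists [:: (o, x), (~~ o, x) & S]; split=> //.
  + by exists x.
  + by rewrite /= es.
- case: s S => [|[o1 k1] [|[o2 k2] s]] [|[p1 x1] [|[p2 x2] S]] //=;
  rewrite ?take0 //.
  case: ifP => //= /andP[/eqP eo /eqP /= ek] [<-]; rewrite ek drop0 =>
    -[e1 e2 es].
  rewrite !marks_are_cons /is_marked /unmarked_before take0 /= !unmarked_cons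
    /push /=.
  case: k2 {ek} => /= [/and3P[h1 h2 h3]|ms] h.
    exists S; split=> //; split=> //.
    rewrite -e1 -e2 (eqP h1) (eqP h2); congr pair.
    by move: eo; clear; case: o1; case: o2.
  by case: h => -> ->; exists S.
case: s S => [|[o1 k1] [|[o2 k2] s]] [|[p1 x1] [|[p2 x2] S]] //=;
  rewrite ?take0 //.
case: ifP => //= cl [<-]; rewrite drop0 => -[-> -> es].
rewrite !marks_are_cons /is_marked /unmarked_before take0 /= !unmarked_cons
  /push /=.
case/and3P=> h1 h2 h3 h; exists (cross k (p1, x1) (p2, x2) ++ S); split=> //.
- by rewrite /cross es; case: is_classical.
- move: cl; rewrite /cross; case: is_classical; case: k1 h1 {h}; case: k2 h2 =>
  //= h1 h2 _;
  by rewrite !marks_are_cons /= h3 ?h1 ?h2.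
move: cl h; rewrite /step /= /cross; case ck: (is_classical k); case: (k1);
  case: (k2) => //= _ ->;
by rewrite !unmarked_cons /push /= ?/cross ?ck.
Qed.

End Detour.

(** * The two ends of a marked arc *)

Definition orientation_sign (o : bool) : int := if o then 1 else -1.

Section DetourPaths.

Variable r : labeling_rule.
Notation X := (label r).
Notation strand := (bool * X)%type.
Notation msection := (seq (bool * bool)).
Implicit Types (S T U V : seq strand) (rows : seq (seq strand)) (w : word).
Implicit Types (C : point -> X) (a : marked_word) (s : msection).

(** The sign is that of the change in the oriented number of marked strands
    when the end is passed. *)
Definition ends_at (l : marked_layer) s S : seq (int * X) :=
  if l is End i then
    if drop i (zip s S) is (m, A) :: _
    then [:: ((if m.2 then -1 else 1) * orientation_sign A.1, A.2)] else [::]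
  else [::].

Fixpoint ends a s S rows : seq (int * X) :=
  if a is l :: a' then
    ends_at l s S ++
    let s' := odflt [::] (apply_marked_layer l s) in
    if l is Event _ _ then
      if rows is T :: rows' then ends a' s' T rows' else [::]
    else ends a' s' S rows
  else [::].

Definition marked_sum (x : X) s S : int :=
  \sum_(p <- zip s S) (p.1.2 && (p.2.2 == x))%:R * orientation_sign p.2.1.

Lemma marked_sum_cons x m A s S : marked_sum x (m :: s) (A :: S) =
  (m.2 && (A.2 == x))%:R * orientation_sign A.1 + marked_sum x s S.
Proof. by rewrite /marked_sum /= big_cons. Qed.

Lemma orientation_signN o : orientation_sign (~~ o) = - orientation_sign o.
Proof. by case: o. Qed.

(** The oriented number of marked strands with label x is not changed by
    minima, maxima and virtual crossings, but only by the ends. *)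
Lemma marked_sum_step x l s s' S S' : apply_marked_layer l s = Some s' ->
  unzip1 s = unzip1 S -> underlying_step l S S' ->
  unzip1 s' = unzip1 S' /\
  marked_sum x s' S' = marked_sum x s S + \sum_(e <- ends_at l s S) e.1 *
    (e.2 == x)%:R.
Proof.
move: l s s' S S'; apply: marked_layer_position_ind => [f g||l IH] s s' S S';
  last first.
- case: s S => [|m s] [|A S] //; try by case: (l) => [f [i g]|i].
  rewrite apply_marked_layer_indent; case E: apply_marked_layer => [s1|] //=
    [<-] [e1 e2].
  case/underlying_step_indent=> S1 -> st; have [e3 e4] := IH _ _ _ _ E e2 st.
  rewrite !marked_sum_cons e4 /= e1 e3 -addrA; split=> //; do 2!congr (_ + _).
  by case: (l) => [f [i g]|i].
- case: s S => [|[o k] s] [|[p x1] S] //=; rewrite ?drop0 => -[<-] [<- es] ->.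
  rewrite !marked_sum_cons /= es big_cons big_nil addr0; split=> //=.
  by case: k; case: (x1 == x); rewrite /= ?(mul0r, mul1r, mulr0, mulr1, mulN1r)
    ?add0r ?addr0 // addrC ?addrA ?addNr ?addrN ?add0r ?subrr ?addrK.
case: g => [o||k].
- rewrite /= ?drop0 ?take0 /= ?drop0 => -[<-] es [z ->].
  rewrite !marked_sum_cons /= big_nil addr0 es; split=> //.
  by rewrite orientation_signN addrA -mulrDr subrr mulr0 add0r.
- case: s S => [|[o1 k1] [|[o2 k2] s]] [|[p1 x1] [|[p2 x2] S]] //=;
  rewrite ?take0 //.
  case: ifP => //= /andP[/eqP eo /eqP /= ek] [<-]; rewrite ek drop0 =>
    -[e1 e2 es] [[-> ->] ->].
  rewrite !marked_sum_cons /= big_nil addr0 es; split=> //.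
  by rewrite orientation_signN addrA -mulrDr subrr mulr0 add0r.
case: s S => [|[o1 k1] [|[o2 k2] s]] [|[p1 x1] [|[p2 x2] S]] //=;
  rewrite ?take0 //.
case: ifP => //= cl [<-]; rewrite drop0 => -[-> -> es] ->.
rewrite big_nil addr0; split; first by rewrite /cross; case: is_classical;
  rewrite /= es.
move: cl; rewrite /cross; case: is_classical; case: k1; case: k2 => //= _;
by rewrite !marked_sum_cons /= addrCA.
Qed.

Lemma marked_sum_path x a s s' S rows : marked_run a s = Some s' ->
  unzip1 s = unzip1 S -> lpath (underlying a) S rows ->
  unzip1 s' = unzip1 (last S rows) /\
  marked_sum x s' (last S rows) = marked_sum x s S +
    \sum_(e <- ends a s S rows) e.1 * (e.2 == x)%:R.
Proof.
elim: a s S rows => [|l a IH] s S rows.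
  by case=> <- e; case: rows => //= _; rewrite big_nil addr0.
rewrite [marked_run _ _]/=; case E: apply_marked_layer => [s1|] //= ra es.
have := marked_sum_step x E es; rewrite E /=.
case: l {E} => [f l|i] h; last first.
  have [e1 e2] := h S erefl; move=> p; have [-> ->] := IH _ _ _ ra e1 p.
  by rewrite e2 big_cat addrA.
case: rows => [|T rows] //= [st p]; have [e1 e2] := h T st.
by have [-> ->] := IH _ _ _ ra e1 p; rewrite e2 big_nil addr0.
Qed.

Lemma ends_at_End i s s' S : apply_marked_layer (End i) s = Some s' ->
  unzip1 s = unzip1 S -> unzip1 s' = unzip1 S /\
  exists e z, [/\ ends_at (End i) s S = [:: (e, z)], (e == 1) || (e == -1) &
    forall y, (nth (true, y) S i).2 = z].
Proof.
elim: i s s' S => [|i IH] s s' S; last first.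
  case: s S => [|m s] [|A S] //.
  rewrite (apply_marked_layer_indent (End i)); case E: apply_marked_layer =>
    [s1|] //= [<-] [e1 es].
  by have [e2 h] := IH _ _ _ E es; split; first by rewrite /= e1 e2.
case: s S => [|[o k] s] [|[p x1] S] //=; rewrite ?drop0 => -[<-] [<- es]; split;
  first by rewrite /= es.
by do 2!eexists; split=> //; case: (k); case: (o).
Qed.

Lemma apply_marked_layer_unzip f l s s' : apply_marked_layer (Event f l) s
  = Some s' ->
  apply_layer l (unzip1 s) = Some (unzip1 s').
Proof.
case: l => i g /=; rewrite size_map; case: ifP => //= _.
case E: apply_marked_event => [t|] //= [<-].
suff -> : apply_event g (take (ins g) (drop i (unzip1 s))) = Some (unzip1 t).
  by rewrite /= /unzip1 !map_cat map_take map_drop.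
rewrite /unzip1 -map_drop -map_take.
case: g E => [o||k] /=; case: (take _ _) => [|a1 [|b1 []]] //=.
- by case=> <-.
- by case: eqP => //= ne; case: ifP => // _ [<-].
- by case: ifP => // _ [<-].
Qed.

Lemma event_sections f l s s' S T : apply_marked_layer (Event f l) s
  = Some s' ->
  unzip1 s = unzip1 S -> step l S T -> unzip1 s' = unzip1 T.
Proof.
by move=> /apply_marked_layer_unzip + e /step_section; rewrite e => -> [].
Qed.

Lemma size_ends a s s' S rows : marked_run a s = Some s' ->
  unzip1 s = unzip1 S -> lpath (underlying a) S rows ->
  size (ends a s S rows) = count (fun l => if l is End _ then true else false)
    a /\
  all (fun e => (e.1 == 1) || (e.1 == -1)) (ends a s S rows).
Proof.
elim: a s S rows => [|l a IH] s S rows //.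
rewrite [marked_run _ _]/= [ends _ _ _ _]/=; case E: apply_marked_layer => [s1|]
  //= ra es.
case: l E => [f l|i] E; last first.
  have [e1 [e [z [-> h _]]]] := ends_at_End E es => p.
  by rewrite /= h; have [-> ->] := IH _ _ _ ra e1 p.
case: rows => [|T rows] //= [st p].
exact: IH ra (event_sections E es st) p.
Qed.

(** One would like to follow the arc from one end to the other. It is enough to
    count: the oriented number of marked strands with the label of the first
    end vanishes at the bottom and at the top of the picture, so the second end
    must compensate the first, and it has the same label. *)
Lemma ends_agree a rows : marked_run a [::] = Some [::] ->
  count (fun l => if l is End _ then true else false) a = 2 ->
  lpath (underlying a) [::] rows ->
  exists y, all (fun e => e.2 == y) (ends a [::] [::] rows).
Proof.
move=> ra c2 p; have [sz al] := size_ends (S := [::]) ra erefl p.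
rewrite c2 in sz; case E: ends sz al => [|[e1 z1] [|[e2 z2] []]] //=
  _ /and3P[h1 h2 _].
(* The two ends are counted with the label of the first one. *)
exists z1; rewrite eqxx andbT /=.
have [el] := marked_sum_path z1 (S := [::]) ra erefl p.
have -> : last [::] rows = [::] by case: (last _ _) el.
rewrite E /marked_sum /= !big_cons !big_nil eqxx /= add0r addr0 mulr1.
by case/orP: h1 => /eqP ->; case: (z2 == z1) => //; rewrite mulr0 addr0.
Qed.

(** Several stages of a marked word may lead to the same stage of the erased
    picture; each of them is compared with it, since the agreement of labelings
    across a detour is stated at all unerased points. *)
Definition sections_match a s S rows er :=
  forall k, (k <= size a)%N ->
    unmarked (odflt [::] (marked_run (take k a) s))
             (nth [::] (S :: rows) (size (underlying (take k a))))
    = nth [::] (unmarked s S :: er) (size (erase_from s (take k a))).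

Local Arguments apply_marked_layer : simpl never.
Local Arguments erase_layer : simpl never.

Definition next_rows (l : marked_layer) S rows :=
  if l is Event _ _ then (head [::] rows, behead rows) else (S, rows).

Lemma lpath_next l a S rows : lpath (underlying (l :: a)) S rows ->
  let: (T, rows') := next_rows l S rows in
  [/\ underlying_step l S T, lpath (underlying a) T rows' &
      lpath_value (underlying (l :: a)) S rows
      = underlying_value l S + lpath_value (underlying a) T rows'].
Proof.
case: l => [f l|i] /=; last by rewrite add0r.
by case: rows => [|T rows] //= [].
Qed.

Lemma sections_match_next l a s s1 S T rows rows' er er' :
  apply_marked_layer l s = Some s1 ->
  (T, rows') = next_rows l S rows -> rows <> [::] \/
    ~~ (if l is Event _ _ then true else false) ->
  (if erase_layer l s is Some _ then er = unmarked s1 T :: er'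
   else unmarked s1 T = unmarked s S /\ er = er') ->
  sections_match a s1 T rows' er' -> sections_match (l :: a) s S rows er.
Proof.
move=> E en nr he mt [|k] // lk; have := mt k lk.
rewrite [in X in _ -> X]/= E [in X in _ -> X]/=.
case: l en nr {E lk} he => [f l|i] /= [-> ->] nr.
  case: rows nr => [|T' rows] nr; first by case: nr.
  by case: (erase_layer _ _) => [e ->|[<- ->]].
by move=> ->.
Qed.

(** The equality of the labels of the two ends is what makes the labels of the
    erased picture consistent. *)
Lemma forward_path y a s s' S rows : marked_run a s = Some s' ->
  unzip1 s = unzip1 S -> lpath (underlying a) S rows ->
  all (fun e => e.2 == y) (ends a s S rows) ->
  exists er, [/\ erased_path y (erase_from s a) (unmarked s S) er,
    erased_path_value (erase_from s a) (unmarked s S) er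
      = lpath_value (underlying a) S rows &
    sections_match a s S rows er].
Proof.
elim: a s S rows => [|l a IH] s S rows.
  by move=> _ _; case: rows => // _ _; exists [::]; split=> // -[|k].
rewrite [marked_run _ _]/=; case E: apply_marked_layer => [s1|] // ra es p.
have := lpath_next p; case en: next_rows => [T rows'] [st p' vp] al.
have [el al'] : end_labeled y l S /\ all (fun e => e.2 == y)
  (ends a s1 T rows').
  move: al; rewrite [ends _ _ _ _]/= E all_cat => /andP[].
  case: l E en p {st vp} => [f l|i] E /=; first by case: rows => [|? ?] //
    [<- <-] _ _.
  case=> <- <- _; have [_ [e [z [ee _ hz]]]] := ends_at_End E es.
  rewrite -/(ends_at (End i) s S) ee /= andbT => /eqP <-.
  by split.
have es1 : unzip1 s1 = unzip1 T.
  case: l E st {p vp en al el} => [f l|i] E st; first exact: event_sections E es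
    st.
  by rewrite (ends_at_End E es).1 st.
have nr : rows <> [::] \/ ~~ (if l is Event _ _ then true else false).
  by case: (l) p => [f l'|i]; [case: (rows) => // ? ? _; left|right].
have [_ eh] := erase_forward E es es1 st el.
have [er [pe ve me]] := IH _ _ _ ra es1 p' al'.
case F: (erase_layer l s) eh => [e|] [h1 h2].
  exists (unmarked s1 T :: er); rewrite [erase_from _ _]/= E F /=; split=> //.
    by rewrite vp h2 ve.
  by apply: (sections_match_next E (esym en) nr _ me); rewrite F.
exists er; rewrite [erase_from _ _]/= E F /= -h1; split=> //.
  by rewrite vp h2 add0r ve.
by apply: (sections_match_next E (esym en) nr _ me); rewrite F h1.
Qed.

Lemma backward_path y a s s' S er : marked_run a s = Some s' ->
  unzip1 s = unzip1 S -> marks_are y s S ->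
  erased_path y (erase_from s a) (unmarked s S) er ->
  exists rows, [/\ lpath (underlying a) S rows,
    lpath_value (underlying a) S rows = erased_path_value (erase_from s a)
      (unmarked s S) er &
    sections_match a s S rows er].
Proof.
elim: a s S er => [|l a IH] s S er.
  by move=> _ _ _; case: er => // _; exists [::]; split=> // -[|k].
rewrite [marked_run _ _]/=; case E: apply_marked_layer => [s1|] // ra es ms.
rewrite [erase_from _ _]/= E /= => p.
pose V := if erase_layer l s is Some _ then head [::] er else unmarked s S.
pose er' := if erase_layer l s is Some _ then behead er else er.
have hV : (if erase_layer l s is Some e then erased_step y e (unmarked s S) V
   else V = unmarked s S) : Prop.
  by rewrite /V; case: erase_layer p => //= e; case: er {V er'} => [|U er] //=
    [].
have p' : erased_path y (erase_from s1 a) V er'.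
  by rewrite /V /er'; case: erase_layer p => //= e; case: er {V er' hV} =>
    [|U er] //= [].
have [T [st es1 ms1 uT el]] := erase_backward E es ms hV.
rewrite -uT in p'; have [rows' [pT vT mT]] := IH _ _ _ ra es1 ms1 p'.
have [_ eh] := erase_forward E es es1 st el.
pose rows := if l is Event _ _ then T :: rows' else rows'.
have en : (T, rows') = next_rows l S rows.
  by rewrite /rows; case: (l) st => //= i ->.
have pr : lpath (underlying (l :: a)) S rows.
  by rewrite /rows; case: (l) st => //= i <-.
have vp : lpath_value (underlying (l :: a)) S rows
      = underlying_value l S + lpath_value (underlying a) T rows'.
  by have := lpath_next pr; rewrite -en => -[].
have nr : rows <> [::] \/ ~~ (if l is Event _ _ then true else false).
  by rewrite /rows; case: (l); [left|right].
exists rows; split=> //.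
  rewrite vp vT uT /V /er'; case: erase_layer eh p {hV p' uT} => [e|] [h1 ->]
    /=.
by case: er {V er' mT vT} => [|U er] //=.
  by rewrite add0r.
apply: (sections_match_next E en nr _ mT).
by rewrite uT /V /er'; case: erase_layer p => //= e;
  case: er {V er' hV p' uT vT mT} => [|U er].
Qed.

End DetourPaths.

(** * Detour moves *)

Lemma underlying_cat a b : underlying (a ++ b) = underlying a ++ underlying b.
Proof. by rewrite /underlying pmap_cat. Qed.

Lemma take_underlying a k :
  take (size (underlying (take k a))) (underlying a) = underlying (take k a).
Proof. by rewrite -{2}(cat_take_drop k a) underlying_cat take_size_cat. Qed.

Lemma size_underlying_take a k :
  (size (underlying (take k a)) <= size (underlying a))%N.
Proof. by rewrite -{2}(cat_take_drop k a) underlying_cat size_cat leq_addr. Qed.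

Lemma run_underlying a s s' : marked_run a s = Some s' ->
  run (underlying a) (unzip1 s) = Some (unzip1 s').
Proof.
elim: a s => [|l a IH] s /=; first by case=> ->.
case E: apply_marked_layer => [s1|] //= /IH <-.
case: l E => [f l|i] E /=; first by rewrite (apply_marked_layer_unzip E).
congr run; elim: i s s1 E => [|i IHi] [|[o m] s] s1 //=; rewrite ?drop0.
  by case=> <-.
have := IHi s; rewrite /=; case: (drop i s) => //= x t /(_ _ erefl) e [<-] /=.
by rewrite e.
Qed.

Lemma marked_run_take a k s : marked_run a [::] = Some s ->
  marked_run (take k a) [::] = Some (marked_section a k).
Proof.
by rewrite -{1}(cat_take_drop k a) marked_run_cat /marked_section;
  case: marked_run.
Qed.

Lemma marked_section_unzip a k s : marked_run a [::] = Some s ->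
  unzip1 (marked_section a k)
  = section (underlying a) (size (underlying (take k a))).
Proof.
move=> ra; have rk := marked_run_take k ra.
by rewrite /section take_underlying (run_underlying rk).
Qed.

Lemma mem_unerased a p e : reflect
  (exists k i, [/\ (k <= size a)%N, (i < size (marked_section a k))%N,
     ~~ is_marked (marked_section a k) i,
       p = (size (underlying (take k a)), i) &
     e = (size (erase (take k a)), unmarked_before (marked_section a k) i)])
  ((p, e) \in unerased a).
Proof.
apply: (iffP flatten_mapP) => [[k]|[k [i [lk li um -> ->]]]].
  rewrite mem_iota ltnS => /= lk /mapP [i]; rewrite mem_filter mem_iota => /=
    /andP[um li] [-> ->].
  by exists k, i.
exists k; first by rewrite mem_iota.
by apply/mapP; exists i; rewrite ?mem_filter ?mem_iota ?um.
Qed.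

Section DetourTransport.

Variable r : labeling_rule.
Notation X := (label r).
Notation strand := (bool * X)%type.
Implicit Types (S T U V : seq strand) (C : point -> X) (a : marked_word).

Lemma nth_unmarked (d : strand) s S i : size s = size S -> (i < size s)%N ->
  ~~ is_marked s i ->
  nth d (unmarked s S) (unmarked_before s i) = nth d S i.
Proof.
elim: s S i => [|m s IH] [|A S] [|i] //= [sz] li; rewrite unmarked_cons /push
  /unmarked_before /is_marked /=.
  by move/negPf ->.
move=> um; have := IH S i sz li um; rewrite /unmarked_before.
by case: (m.2).
Qed.

Definition erased_labels C a er :=
  forall k, (k <= size a)%N ->
  unmarked (marked_section a k)
    (level C (underlying a) (size (underlying (take k a))))
  = nth [::] ([::] :: er) (size (erase (take k a))).

Lemma unerased_label (x0 : X) C a er p e : marked_run a [::] = Some [::] ->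
  erased_labels C a er -> (p, e) \in unerased a ->
  C p = (nth (true, x0) (nth [::] ([::] :: er) e.1) e.2).2.
Proof.
move=> ra ec /mem_unerased [k [i [lk li um -> ->]]] /=.
have es := marked_section_unzip k ra.
rewrite -ec // nth_unmarked //.
  by rewrite nth_level // -es size_map.
by rewrite size_attach -es size_map.
Qed.

Lemma erased_labels_of C a er : marked_run a [::] = Some [::] ->
  sections_match a [::] [::] (rows_of C (underlying a)) er ->
    erased_labels C a er.
Proof.
move=> ra mt k lk; have := mt k lk; rewrite (marked_run_take k ra) /=.
rewrite level_nth ?size_underlying_take // => ->; congr (nth _ _ (size _)).
by rewrite erase_fromE // (marked_run_take k ra).
Qed.

(** The labels pass through the erased picture, which is common to both sides
    of the detour. The erased crossings are virtual and contribute nothing. *)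
Lemma detour_transport a a' C : marked_arc a -> marked_arc a' ->
  erase a = erase a' ->
  labels r (underlying a) C ->
  exists C' er, [/\ labels r (underlying a') C', erased_labels C a er,
    erased_labels C' a' er &
    state_sum r (underlying a) C = state_sum r (underlying a') C'].
Proof.
move=> [ra c2 _] [ra' c2' _] ee lC.
have rD : run (underlying a) [::] = Some [::] := run_underlying ra.
have rD' : run (underlying a') [::] = Some [::] := run_underlying ra'.
have p : lpath (underlying a) [::] (rows_of C (underlying a)).
  by apply/labels_lpath; rewrite ?rD.
have [y ay] := ends_agree ra c2 p.
have [er [pe ve me]] := forward_path (S := [::]) ra erefl p ay.
move: pe; rewrite -erase_fromE ?ra // ee erase_fromE ?ra' // => pe.
have [rows' [p' v' m']] := backward_path (S := [::]) ra' erefl isT pe.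
pose C' := labeling_of (C (0%N, 0%N)) rows'.
have e' : rows_of C' (underlying a') = rows' by apply: rows_of_labeling.
have l' : labels r (underlying a') C' by apply: labels_of_lpath.
exists C', er; split=> //.
- exact: erased_labels_of.
- by apply: erased_labels_of; rewrite ?e'.
rewrite !state_sum_lpath ?rD ?rD' // e' v' -ve -erase_fromE ?ra // ee.
by rewrite erase_fromE // ra'.
Qed.

Lemma agree_detour (x0 : X) a a' C C' er : marked_run a [::] = Some [::] ->
  marked_run a' [::] = Some [::] -> erased_labels C a er ->
    erased_labels C' a' er ->
  agree (Detour a a') C C'.
Proof.
move=> ra ra' e e' x y /and3P[_ _ /hasP[[p q] /= h /andP[/eqP <- h']]].
by rewrite (unerased_label x0 ra e h) (unerased_label x0 ra' e' h').
Qed.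

Lemma erased_index a j : marked_run a [::] -> (j <= size (erase a))%N ->
  exists2 k, (k <= size a)%N & size (erase (take k a)) = j.
Proof.
elim/last_ind: a => [|a l IH] ra.
  by case: j => // _; exists 0%N.
have ra' : marked_run a [::] by move: ra; rewrite -cats1 marked_run_cat;
  case: marked_run.
rewrite leq_eqVlt => /orP[/eqP ->|lj]; first by exists (size (rcons a l));
  rewrite ?take_size.
have [|k lk e] := IH ra'; last first.
  exists k; first by rewrite size_rcons leqW.
  by rewrite -cats1 takel_cat.
move: lj; rewrite !erase_fromE // => lj; rewrite -ltnS (leq_trans lj) //.
clear; elim: a [::] => [|l' a IH] s /=.
  by rewrite cats0; case: erase_layer.
by rewrite !size_cat -addnS leq_add2l.
Qed.

Lemma unmarked_index s S n : size s = size S -> (n < size (unmarked s S))%N ->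
  exists i, [/\ (i < size s)%N, ~~ is_marked s i & unmarked_before s i = n].
Proof.
elim: s S n => [|m s IH] [|A S] n //= [sz]; rewrite unmarked_cons /push.
case em: (m.2) => /= ln.
  have [i [li um e]] := IH _ _ sz ln; exists i.+1.
  by rewrite /unmarked_before /= em; split.
case: n ln => [|n] ln; first by exists 0%N; rewrite /is_marked /= em.
have [i [li um e]] := IH _ _ sz ln; exists i.+1.
by rewrite /unmarked_before /= em; split=> //; rewrite -e.
Qed.

(** Equal erased pictures have the same sections, so a point visible in one is
    visible in the other. The labelings serve only to compare the sizes of
    sections. *)
Lemma unerased_realized a a' C C' er p e : marked_run a [::] = Some [::] ->
  marked_run a' [::] = Some [::] -> erase a = erase a' ->
  erased_labels C a er -> erased_labels C' a' er -> (p, e) \in unerased a' ->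
  exists q, (q, e) \in unerased a.
Proof.
move=> ra ra' ee ec ec' /mem_unerased [k [i [lk li um ep eE]]].
have la : (e.1 <= size (erase a))%N.
  rewrite eE ee /= !erase_fromE ?ra' ?(marked_run_take k ra') //.
  have h s : (size (erase_from s (take k a')) <= size (erase_from s a'))%N.
    elim: (a') (k) s => [|l b IH] [|k'] s //=.
    by rewrite !size_cat leq_add2l.
  exact: h.
have [|k1 lk1 e1] := erased_index _ la; first by rewrite ra.
have sz b n : marked_run b [::] = Some [::] ->
    size (marked_section b n) = size (level C (underlying b)
      (size (underlying (take n b)))).
  by move=> rb; rewrite size_attach -(marked_section_unzip n rb) size_map.
have szc (D D' : point -> X) b n : size (level D b n) = size (level D' b n).
  by rewrite !size_attach.
have [|i1 [li1 um1 ei1]] := @unmarked_index (marked_section a k1)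
    (level C (underlying a) (size (underlying (take k1 a)))) e.2 (sz _ _ ra).
  rewrite ec // e1 eE /= -ec' //.
  rewrite /unmarked size_mask; last by rewrite size_map sz // (szc C C').
  rewrite count_map /unmarked_before.
  rewrite -{2}(cat_take_drop i (marked_section a' k)) count_cat
    -[X in (X < _)%N]addn0 ltn_add2l.
  by rewrite (drop_nth (true, false)) //= um.
exists (size (underlying (take k1 a)), i1); apply/mem_unerased.
by exists k1, i1; split=> //; rewrite e1 ei1; case: (e).
Qed.

End DetourTransport.

(** * Connected components and two-colorings *)

Section Pieces.

Variables (T : choiceType) (V : seq T) (E : seq (T * T)).

Definition respects (A : Type) (f : T -> A) : Prop :=
  forall x y, (x, y) \in E -> x \in V -> y \in V -> f x = f y.

Definition linked (x y : seq_sub V) :=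
  ((val x, val y) \in E) || ((val y, val x) \in E).

Lemma joined_sym : connect_sym linked.
Proof. by apply: sym_connect_sym => x y; rewrite /linked orbC. Qed.

Lemma joined_equivalence :
  {in [set: seq_sub V] & &, equivalence_rel (@joined T V E)}.
Proof.
move=> x y z _ _ _; split; first exact: connect0.
by move=> xy; apply: (same_connect joined_sym xy).
Qed.

Lemma respects_joined (A : Type) (f : T -> A) (x y : seq_sub V) :
  respects f -> joined E x y -> f (val x) = f (val y).
Proof.
move=> rf /connectP[p]; elim: p x => [|z p IH] x /= => [_ -> //|/andP[e pz] ey].
rewrite -(IH z) // ; case/orP: e => e; first exact: rf e (valP x) (valP z).
by symmetry; apply: rf e (valP z) (valP x).
Qed.

Lemma piecesP (A : seq T) : reflect
  (exists x : seq_sub V, A = [seq val y | y in [set y | joined E x y]])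
  (A \in pieces V E).
Proof.
have eT x : [set y in setT | joined E x y] = [set y | joined E x y].
  by apply/setP => y; rewrite !inE.
apply: (iffP mapP) => [[B]|[x ->]].
  by rewrite mem_enum => /imsetP[x _ ->] ->; exists x; rewrite eT.
exists [set y in setT | joined E x y]; last by rewrite eT.
by rewrite mem_enum; apply/imsetP; exists x; rewrite ?inE.
Qed.

Lemma mem_piece (x : seq_sub V) t :
  (t \in [seq val y | y in [set y | joined E x y]])
  = if insub t is Some y then joined E x y else false.
Proof.
case: insubP => [y ty <-|ty].
  by rewrite mem_map ?mem_enum ?inE //; exact: val_inj.
by apply/negP => /mapP[y _ e]; move: ty; rewrite e (valP y).
Qed.

Lemma piece_respects A : A \in pieces V E -> respects (fun x => x \in A).
Proof.
case/piecesP=> z -> x y e xV yV; rewrite !mem_piece !insubT /=.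
apply: (same_connect_r joined_sym); apply: connect1.
by rewrite /linked /= e.
Qed.

Lemma piece_constant (A : Type) (f : T -> A) B x y :
  respects f -> B \in pieces V E -> x \in B -> y \in B -> f x = f y.
Proof.
move=> rf /piecesP[z ->]; rewrite !mem_piece.
case: insubP => // x' _ <- zx; case: insubP => // y' _ <- zy.
by rewrite -(respects_joined rf zx) -(respects_joined rf zy).
Qed.

Lemma piece_of x : x \in V -> exists2 A, A \in pieces V E & x \in A.
Proof.
move=> xV; exists [seq val y | y in [set y | joined E (SeqSub xV) y]].
  by apply/piecesP; exists (SeqSub xV).
by rewrite mem_piece insubT /=; apply: connect0.
Qed.

Definition colorings : {set {ffun seq_sub V -> bool}} :=
  [set f : {ffun seq_sub V -> bool} |
    [forall x, forall y, linked x y ==> (f x == f y)]].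

Definition color_of (f : {ffun seq_sub V -> bool}) : T -> bool :=
  fun t => if insub t is Some x then f x else false.

Definition to_color (f : T -> bool) : {ffun seq_sub V -> bool} :=
  [ffun x => f (val x)].

Lemma color_ofK : cancel color_of to_color.
Proof. by move=> f; apply/ffunP => x; rewrite ffunE /color_of valK. Qed.

Lemma mem_colorings (f : T -> bool) : respects f <-> to_color f \in colorings.
Proof.
rewrite inE; split=> [rf|/forallP h x y e xV yV].
  apply/forallP => x; apply/forallP => y; apply/implyP; rewrite !ffunE => /orP[]
    e.
    by rewrite (rf _ _ e (valP x) (valP y)).
  by rewrite (rf _ _ e (valP y) (valP x)).
move/(_ (SeqSub xV))/forallP/(_ (SeqSub yV)): h; rewrite !ffunE /linked /= e /=.
by move/eqP.
Qed.

Lemma color_of_respects f : f \in colorings -> respects (color_of f).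
Proof. by move=> h; apply/mem_colorings; rewrite color_ofK. Qed.

(** A coloring that respects the links amounts to a choice of a set of
    components. *)
Lemma card_colorings : #|colorings| = (2 ^ size (pieces V E))%N.
Proof.
set P := equivalence_partition (@joined T V E) setT.
have pP : partition P setT := equivalence_partitionP joined_equivalence.
have tP : trivIset P by case/and3P: pP.
have cP : cover P = setT by case/and3P: pP => /eqP.
have -> : size (pieces V E) = #|P| by rewrite size_map -cardE.
rewrite -card_powerset.
pose F (Q : {set {set seq_sub V}}) : {ffun seq_sub V -> bool} :=
  [ffun x => pblock P x \in Q].
have jP x y : joined E x y -> pblock P x = pblock P y.
  move=> xy; apply/eqP; rewrite eq_pblock ?cP ?inE //.
  by rewrite (pblock_equivalence_partition joined_equivalence) ?inE.
have <- : F @: powerset P = colorings.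
  apply/setP => f; apply/imsetP/idP => [[Q _ ->]|].
    rewrite inE; apply/forallP => x; apply/forallP => y; apply/implyP => e.
    by rewrite !ffunE (jP x y) //; apply: connect1.
  move=> fc; exists [set A in P | [exists x in A, f x]].
    by rewrite powersetE; apply/subsetP => A; rewrite inE => /andP[].
  apply/ffunP => x; rewrite ffunE inE pblock_mem ?cP ?inE //=.
  apply/idP/existsP => [fx|[y /andP[yx fy]]].
    by exists x; rewrite fx mem_pblock cP inE.
  have xy : joined E x y by rewrite -(pblock_equivalence_partition
    joined_equivalence) ?inE.
  have := respects_joined (color_of_respects fc) xy.
  by rewrite /color_of !valK => ->.
rewrite card_in_imset // => Q1 Q2; rewrite !powersetE => s1 s2 e.
have key A : A \in P -> (A \in Q1) = (A \in Q2).
  move=> AP; have /set0Pn[x xA] : A != set0 by apply: contraTneq AP => ->;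
    case/and3P: pP.
  have := congr1 (fun f : {ffun seq_sub V -> bool} => f x) e; rewrite !ffunE.
  by rewrite (def_pblock tP AP xA).
apply/setP => A; apply/idP/idP => h.
  by rewrite -key ?h // (subsetP s1).
by rewrite key ?h // (subsetP s2).
Qed.

End Pieces.

(** Colorings count components, so a relation which is total on the colorings
    of the first graph and injective compares the two numbers. The finite types
    A and B add a factor to one side: a factor 2 is worth one component. *)
Lemma pieces_count (T T' : choiceType) (V : seq T) (E : seq (T * T))
    (V' : seq T') (E' : seq (T' * T')) (A B : finType)
    (R : (T -> bool) -> A -> (T' -> bool) -> B -> Prop) :
  (forall f a, respects V E f -> exists f' b, respects V' E' f' /\
    R f a f' b) ->
  (forall f1 a1 f2 a2 f1' f2' b, respects V E f1 -> respects V E f2 ->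
     R f1 a1 f1' b -> R f2 a2 f2' b ->
     {in V', f1' =1 f2'} -> {in V, f1 =1 f2} /\ a1 = a2) ->
  (#|A| * 2 ^ size (pieces V E) <= #|B| * 2 ^ size (pieces V' E'))%N.
Proof.
move=> ex un; rewrite -!card_colorings -!cardsT [X in (X <= _)%N]mulnC
  [X in (_ <= X)%N]mulnC.
rewrite -!cardsX.
have fE (p : {ffun seq_sub V -> bool} * A) : exists q : {ffun seq_sub V' ->
  bool} * B,
    p.1 \in colorings V E -> q.1 \in colorings V' E' /\
      exists2 f', to_color V' f' = q.1 & R (color_of p.1) p.2 f' q.2.
  case: (boolP (p.1 \in colorings V E)) => [pc|_].
    have [f' [b [rf' h]]] := ex _ p.2 (color_of_respects pc).
    exists (to_color V' f', b) => _ /=; split; first exact/mem_colorings.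
    by exists f'.
  by have [_ [b _]] := ex (fun=> false) p.2 (fun _ _ _ _ _ => erefl);
    exists ([ffun=> false], b).
pose h p := proj1_sig (constructive_indefinite_description _ (fE p)).
have hP p : p.1 \in colorings V E -> (h p).1 \in colorings V' E' /\
      exists2 f', to_color V' f' = (h p).1 & R (color_of p.1) p.2 f' (h p).2.
  exact: proj2_sig (constructive_indefinite_description _ (fE p)).
have h_inj : {in setX (colorings V E) [set: A] &, injective h}.
  move=> [f1 a1] [f2 a2]; rewrite !in_setX !in_setT !andbT => c1 c2 e.
  have [_ [f1' e1 R1]] := hP (f1, a1) c1; have [_ [f2' e2 R2]] := hP (f2, a2)
    c2.
  rewrite -e in R2 e2; have [|ef ea] := un _ _ _ _ _ _ _ (color_of_respects c1)
    (color_of_respects c2) R1 R2.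
    move=> x xV; have := congr1 (fun f : {ffun seq_sub V' -> bool} =>
      f (SeqSub xV)) (etrans e1 (esym e2)).
    by rewrite !ffunE.
  move: ea => /= ->; congr pair; rewrite -(color_ofK f1) -(color_ofK f2).
  by apply/ffunP => x; rewrite !ffunE ef // (valP x).
rewrite -(card_in_imset h_inj); apply/subset_leq_card/subsetP => q /imsetP[p].
case: p => f a; rewrite !in_setX !in_setT !andbT => pc ->;
  rewrite [h _]surjective_pairing in_setX in_setT andbT;
  exact: (hP (f, a) pc).1.
Qed.

(** * Labelings across an arbitrary move *)

Lemma size_apply_layer l s s' : apply_layer l s = Some s' ->
  (l.1 + ins l.2 <= size s)%N /\ size s' = (size s - ins l.2 + outs l.2)%N.
Proof.
case: l => i g /=; case: ifP => // le.
case E: apply_event => [t|] //= [<-].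
have [st szt] : size (take (ins g) (drop i s)) = ins g /\ size t = outs g.
  case: g E => [o||k] /=; case: (take _ _) => [|a [|b []]] //=.
  - by case=> <-.
  - by case: ifP => // _ [<-].
  - by case=> <-.
have h : (i + ins g <= size s)%N.
  move: st; rewrite size_take size_drop; case: ltnP; lia.
by split=> //; rewrite !size_cat size_takel // size_drop szt; lia.
Qed.

Lemma indexed_layersE (D : word) :
  indexed_layers D = [seq (j, nth (0%N, Cap) D j) | j <- iota 0 (size D)].
Proof.
apply: (@eq_from_nth _ (0%N, (0%N, Cap))).
  by rewrite size_zip size_map !size_iota minnn.
move=> j; rewrite size_zip size_iota minnn => lj.
by rewrite nth_zip ?size_iota // (nth_map 0%N) ?size_iota // nth_iota.
Qed.

Lemma mem_crossings (D : word) (P : crossing -> Prop) :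
  (forall j c, (j < size D)%N ->
     layer_crossing j (section D j) (nth (0%N, Cap) D j) = Some c -> P c) ->
  forall e, e \in flatten [seq [:: (left_in c, right_out c);
    (right_in c, left_out c)] | c <- crossings D] ->
  exists2 c, P c & e \in [:: (left_in c, right_out c);
    (right_in c, left_out c)].
Proof.
rewrite /crossings indexed_layersE => hP.
have {hP} : forall j c, j \in iota 0 (size D) ->
     layer_crossing j (section D j) (nth (0%N, Cap) D j) = Some c -> P c.
  by move=> j c; rewrite mem_iota; apply: hP.
elim: (iota _ _) => [|j t IH] //= hP e.
case E: (layer_crossing j) => [c|] /=.
  have Pc : P c by apply: hP E; rewrite inE eqxx.
  rewrite !inE => /or3P[h|h|]; try by exists c; rewrite // !inE h ?orbT.
  by apply: IH => j' c' m; apply: hP; rewrite inE m orbT.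
by apply: IH => j' c' m; apply: hP; rewrite inE m orbT.
Qed.

(** In the definition of components, links outside the set of vertices are
    ignored; for a diagram nothing is lost. *)
Lemma curve_links_points (D : word) e : run D [::] -> e \in curve_links D ->
  (e.1 \in points D) /\ (e.2 \in points D).
Proof.
have pt j x : (j <= size D)%N -> (x < size (section D j))%N -> (j, x) \in points
  D.
  by move=> lj lx; rewrite mem_points /= lj.
move: (points D) pt => P pt rD; rewrite mem_cat => /orP[ | ].
  rewrite /arc_links indexed_layersE -map_comp => /flatten_mapP[j].
  rewrite mem_iota /= add0n => lj.
  have := size_apply_layer (section_succ rD lj).
  case: (nth _ _ _) => i g /= [h1 h2].
  have pj x : (x < size (section D j))%N -> (j, x) \in P by move=> lx;
    apply: pt => //; apply: ltnW.
  have pj1 x : (x < size (section D j.+1))%N -> (j.+1, x) \in P by move=> lx;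
    apply: pt.
  rewrite !mem_cat => /or3P[/mapP[x]|/mapP[x]|].
  -  rewrite mem_iota => lx ->; split;  [apply: pj|apply: pj1]; lia.
  - by rewrite mem_iota => lx ->; split; [apply: pj|apply: pj1]; lia.
  case: g h1 h2 => [o||[]] h1 h2; rewrite ?inE //; rewrite /= in h1 h2.
  - by move=> /eqP ->; split; apply: pj1; lia.
  - by move=> /eqP ->; split; apply: pj; lia.
  - by case/orP=> /eqP ->; split; (apply: pj || apply: pj1); lia.
case/(@mem_crossings _ (fun c => [/\ left_in c \in P, right_out c \in P,
    right_in c \in P & left_out c \in P])).
  move=> j c lj; have := size_apply_layer (section_succ rD lj).
  case: (nth _ _ _) => i g /= [h1 h2].
  have pj x : (x < size (section D j))%N -> (j, x) \in P by move=> lx;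
    apply: pt => //; apply: ltnW.
  have pj1 x : (x < size (section D j.+1))%N -> (j.+1, x) \in P by move=> lx;
    apply: pt.
  have hk k : g = Cross k -> [/\ (j, i) \in P, (j, i.+1) \in P,
      (j.+1, i) \in P & (j.+1, i.+1) \in P].
    by move=> eg; subst g; rewrite /= in h1 h2; split;
      (apply: pj || apply: pj1); lia.
  case: g hk {h1 h2} => [o||[]] // /(_ _ erefl) [p1 p2 p3 p4];
  by case: (nth _ _ i); case: (nth _ _ i.+1) => /= -[<-].
move=> c [p1 p2 p3 p4]; rewrite !inE => /orP[] /eqP -> /=; by split.
Qed.

Section Rules.

Variable r : labeling_rule.
Notation X := (label r).
Implicit Types (C : point -> X) (D : word).

(** As shifts are injective, whether two labelings agree is constant along
    curves. *)
Lemma labels_eq_links D C1 C2 : labels r D C1 -> labels r D C2 ->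
  all (fun e => (C1 e.1 == C2 e.1) == (C1 e.2 == C2 e.2)) (curve_links D).
Proof.
move=> /andP[a1 c1] /andP[a2 c2]; rewrite all_cat; apply/andP; split.
  apply/allP => e he; move/allP/(_ _ he)/eqP: a1 => ->.
  by move/allP/(_ _ he)/eqP: a2 => ->.
rewrite all_flatten_map; elim: (crossings D) c1 c2 => //= c t IH /andP[h1 t1]
  /andP[h2 t2].
rewrite IH // andbT; move: h1 h2 => /andP[/eqP -> /eqP ->] /andP[/eqP ->
  /eqP ->].
by rewrite !(inj_eq (@shift_inj _ _)) !eqxx.
Qed.

(** The set where two labelings agree is a union of curves, so one point of
    agreement on each curve is enough. *)
Lemma labels_unique_on_curves D C1 C2 : labels r D C1 -> labels r D C2 ->
  (forall A, A \in curves D -> exists2 x, x \in A & C1 x = C2 x) ->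
  {in points D, C1 =1 C2}.
Proof.
move=> l1 l2 h x xD; have [A AD xA] := piece_of (curve_links D) xD.
have [y yA ey] := h A AD.
have rf : respects (points D) (curve_links D) (fun z => C1 z == C2 z).
  by move=> z t e _ _; move/allP/(_ _ e)/eqP: (labels_eq_links l1 l2).
by apply/eqP; rewrite (piece_constant rf AD xA yA) ey.
Qed.

(** Each curve has a point outside the marked arc, where the label is inherited
    from the other side of the detour. *)
Lemma detour_unique a a' C C1 C2 : marked_arc a -> marked_arc a' ->
  erase a = erase a' ->
  labels r (underlying a) C -> labels r (underlying a') C1 ->
    labels r (underlying a') C2 ->
  agree (Detour a a') C C1 -> agree (Detour a a') C C2 ->
    {in points (underlying a'), C1 =1 C2}.
Proof.
move=> ma ma' ee lC l1 l2 h1 h2; apply: labels_unique_on_curves => // A AD.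
have [C' [er [_ ec ec' _]]] := detour_transport ma ma' ee lC.
case: ma' (ma') => [ra' _ cl] _; case: ma => ra _ _.
have /hasP[p pA /mapP[[p' e] pe /= ep]] := cl A AD; subst p'.
have [q qe] := unerased_realized ra ra' ee ec ec' pe.
exists p => //.
have pts b t z : marked_run b [::] = Some [::] -> (t, z) \in unerased b ->
  t \in points (underlying b).
  move=> rb /mem_unerased[k [i [lk li _ -> _]]]; rewrite mem_points /=
    size_underlying_take.
  by rewrite -(marked_section_unzip k rb) size_map.
have sp : same_point (Detour a a') q p.
  rewrite /same_point /source /target /= !cats0 (pts _ _ _ ra qe)
    (pts _ _ _ ra' pe) /=.
  by apply/hasP; exists (q, e) => //=; rewrite eqxx pe.
by rewrite -(h1 _ _ sp) (h2 _ _ sp).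
Qed.

End Rules.

(** Reversing moves exchanges births with deaths and the two directions of time
    in the schema, which halves the work on genus. *)
Definition rev_move (mv : move) : move :=
  match mv with
  | Isotopy u m m' v => Isotopy u m' m v
  | Detour a a' => Detour a' a
  | Birth u i o v => Death u i o v
  | Death u i o v => Birth u i o v
  | Saddle u i o b v => Saddle u i o (~~ b) v
  end.

Lemma rev_moveK : involutive rev_move.
Proof. by case=> // u i o b v; rewrite /= negbK. Qed.

Lemma site_rev mv :
  site (rev_move mv) = let: (u, m, m', v) := site mv in (u, m', m, v).
Proof. by case: mv => //= u i o []. Qed.

Lemma source_rev mv : source (rev_move mv) = target mv.
Proof. by rewrite /source /target site_rev; case: site => [[[u m] m'] v]. Qed.

Lemma target_rev mv : target (rev_move mv) = source mv.
Proof. by rewrite -source_rev rev_moveK. Qed.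

Lemma valid_target mv : valid_move mv -> run (target mv) [::] = Some [::].
Proof.
case; rewrite /source /target; case: site => [[[u m] m'] v].
by rewrite /closed_word !run_cat; case: run => //= s; rewrite !run_cat => +
  <- => /eqP.
Qed.

Lemma valid_source mv : valid_move mv -> run (source mv) [::] = Some [::].
Proof. by case; rewrite /closed_word => /eqP. Qed.

Lemma valid_rev mv : valid_move mv -> valid_move (rev_move mv).
Proof.
move=> va; have := valid_target va; case: va => [_ e h] /eqP rt; split.
- by rewrite source_rev.
- by rewrite site_rev; move: e; case: site => [[[u m] m'] v].
case: mv h {e rt} => //=; first by move=> *; tauto.
by move=> a a' [].
Qed.

Lemma same_point_rev mv x y : same_point (rev_move mv) y x = same_point mv x y.
Proof.
rewrite /same_point source_rev target_rev andbCA; congr [&& _, _ & _].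
have sym u m m' : ((y.1 <= size u)%N && (x == y)) ||
  ((size u + size m' <= y.1)%N
    && (x == ((y.1 - size m' + size m)%N, y.2)))
  = ((x.1 <= size u)%N && (y == x)) || ((size u + size m <= x.1)%N
    && (y == ((x.1 - size m + size m')%N, x.2))) :> bool.
  case: x y => [j i] [j' i']; rewrite /= !xpair_eqE.
  by apply/idP/idP => /orP[|] /and3P[h1 /eqP h2 /eqP h3]; apply/orP;
    [left|right|left|right]; apply/and3P; split; apply/eqP; lia.
case: mv => [u m m' v|a a'|u i o v|u i o v|u i o b v].
- by rewrite /=; exact: sym.
- apply/hasP/hasP => -[[p e] /= pe /andP[/eqP <- h]].
    by exists (x, e) => //=; rewrite eqxx.
  by exists (y, e) => //=; rewrite eqxx.
- exact: (@sym layer layer layer u [::] (circle i o)).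
- exact: (@sym layer layer layer u (circle i o) [::]).
- by case: b; [exact: (@sym layer layer layer u [::] (turnbacks i o))|exact:
  (@sym layer layer layer u (turnbacks i o) [::])].
Qed.

Lemma agree_rev (X : Type) mv (C C' : point -> X) : agree mv C C' <->
  agree (rev_move mv) C' C.
Proof.
split=> h x y; first by rewrite same_point_rev => /h.
by rewrite -same_point_rev => /h.
Qed.

Section MoveLemmas.

Variable r : labeling_rule.
Notation X := (label r).
Implicit Types (C : point -> X).

Lemma move_extend mv C (x0 : X) : valid_move mv -> labels r (source mv) C ->
  feet_agree mv C ->
  exists C', [/\ labels r (target mv) C', agree mv C C' &
    circle_label mv C' x0].
Proof.
move=> va; case: (boolP (is_detour mv)) => [|nd]; last exact: site_move_extend.
case: mv va => // a a' [_ _ [ma ma' ee]] _; rewrite /source /target /= !cats0 =>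
  lC _.
have [C' [er [l' ec ec' _]]] := detour_transport ma ma' ee lC.
exists C'; split=> //; case: ma ma' => ra _ _ [ra' _ _].
exact: agree_detour x0 _ _ _ _ _ ra ra' ec ec'.
Qed.

Lemma move_unique mv C C1 C2 : valid_move mv ->
  labels r (source mv) C -> labels r (target mv) C1 ->
    labels r (target mv) C2 ->
  agree mv C C1 -> agree mv C C2 -> circles_agree mv C1 C2 ->
  {in points (target mv), C1 =1 C2}.
Proof.
move=> va; case: (boolP (is_detour mv)) => [|nd]; last exact: site_move_unique.
case: mv va => // a a' [_ _ [ma ma' ee]] _; rewrite /source /target /= !cats0 =>
  lC l1 l2 h1 h2 _.
exact: detour_unique ma ma' ee lC l1 l2 h1 h2.
Qed.

(** For a detour, the given labeling of the target is, by uniqueness, the one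
    which is transported through the erased picture. *)
Lemma move_sum mv C C' : valid_move mv ->
  labels r (source mv) C -> labels r (target mv) C' -> agree mv C C' ->
  state_sum r (source mv) C = state_sum r (target mv) C'.
Proof.
move=> va; case: (boolP (is_detour mv)) => [|nd]; last exact: site_move_sum.
case: mv va => // a a' [_ _ [ma ma' ee]] _; rewrite /source /target /= !cats0 =>
  lC l1 h1.
have [C2 [er [l2 ec ec' ->]]] := detour_transport ma ma' ee lC.
have [[ra _ _] [ra' _ _]] := (ma, ma').
have rD' : run (underlying a') [::] by rewrite (run_underlying ra').
apply: state_sum_ext => //.
apply: (detour_unique ma ma' ee lC l2 l1) => //.
exact: (agree_detour (C (0%N, 0%N)) ra ra' ec ec').
Qed.

End MoveLemmas.

(** * Affine labelings, two-colorings and Stokes' formula *)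

Section AffineRule.

Variable c : int.

Definition affine_shift (o : bool) (a : int) : int :=
  if o then a + c else a - c.

Definition affine_value (s : bool) (l r : int) : {fraction {poly int}} :=
  let d := l - r - c in
  if s then laurent_t ^ d - 1 else - (laurent_t ^ (- d) - 1).

Lemma affine_shiftK o : cancel (affine_shift o) (affine_shift (~~ o)).
Proof. by case: o => a; rewrite /affine_shift /= ?addrK ?subrK. Qed.

Lemma affine_value_shift s o l r :
  affine_value s (affine_shift o l) (affine_shift o r) = affine_value s l r.
Proof.
have e : affine_shift o l - affine_shift o r = l - r.
  by rewrite /affine_shift; case: o; ring.
by rewrite /affine_value e.
Qed.

Lemma affine_value_kink s l : affine_value s l (affine_shift false l) = 0.
Proof.
rewrite /affine_value /affine_shift opprB addrCA addrN addr0 subrr oppr0 expr0z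
  subrr.
by case: s; rewrite ?oppr0.
Qed.

Lemma affine_value_undo s l r : affine_value s l r
  + affine_value (~~ s) (affine_shift true r) (affine_shift false l) = 0.
Proof.
rewrite /affine_value /affine_shift.
have -> : r + c - (l - c) - c = - (l - r - c) by ring.
by case: s; rewrite /= ?opprK ?subrr ?addNr.
Qed.

(** The affine labelings are those for c = 1. For c = 0, the labels are
    integers constant along curves, for which Stokes' formula has no
    intersection term. *)
Definition affine_rule : labeling_rule :=
  LabelingRule affine_shiftK affine_value_shift affine_value_kink
    affine_value_undo.

End AffineRule.

(** Added over the crossings of a diagram, this is the intersection number of
    the uncolored part with the colored one. *)
Definition flux_value (s l r : bool) : int := r%:Z - l%:Z.

Lemma flux_value_kink s l : flux_value s l l = 0.
Proof. exact: subrr. Qed.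

Lemma flux_value_undo s l r : flux_value s l r + flux_value (~~ s) r l = 0.
Proof. by rewrite /flux_value addrA subrK subrr. Qed.

(** A union of components is the same as a coloring by booleans; its
    intersection number with the rest being a state sum, it is invariant under
    moves for the same reason as the polynomial. *)
Definition coloring_rule : labeling_rule :=
  @LabelingRule bool (fun _ => id) int flux_value (fun _ _ => erefl)
    (fun _ _ _ _ => erefl) flux_value_kink flux_value_undo.

Section Pairing.

Variable c : int.
Notation astrand := (bool * int)%type.
Notation cstrand := (bool * bool)%type.
Implicit Types (S T : seq astrand) (U V : seq cstrand).

(** The integral over a horizontal section of the labeling S along the curves
    colored by U. *)
Definition pairing S U : int :=
  \sum_(p <- zip S U) orientation_sign p.1.1 * p.1.2 * (p.2.2)%:Z.

Lemma pairing_cons A S B U :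
  pairing (A :: S) (B :: U) = orientation_sign A.1 * A.2 * (B.2)%:Z +
    pairing S U.
Proof. by rewrite /pairing /= big_cons. Qed.

Lemma pairing_cat S1 S2 U1 U2 : size S1 = size U1 ->
  pairing (S1 ++ S2) (U1 ++ U2) = pairing S1 U1 + pairing S2 U2.
Proof. by move=> e; rewrite /pairing zip_cat // big_cat. Qed.

(** At a crossing of a colored strand with an uncolored one, the label of the
    colored strand changes by c up to sign; two colored strands have opposite
    changes, and extrema do not contribute since their two strands have
    opposite orientations. *)
Lemma pairing_step l S T U V : unzip1 S = unzip1 U ->
  step (r := affine_rule c) l S T -> step (r := coloring_rule) l U V ->
  pairing T V = pairing S U + c * step_value (r := coloring_rule) l U.
Proof.
case: l => i g; elim: i S T U V => [|i IH] S T U V; last first.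
  case: S T => [|A S] [|A' T] //; case: U V => [|B U] [|B' V] // [_ e] [<- s1]
    [<- s2].
  by rewrite !pairing_cons (IH _ _ _ _ e s1 s2) addrA.
rewrite /step /step_value /= drop0; case: g => [o||k] e /=.
- case=> x -> [z ->]; rewrite !pairing_cons /= mulr0 addr0 orientation_signN.
  by rewrite addrA !mulNr subrr add0r.
- case: S U e => [|[p a] [|B S]] [|[p' x] [|B' U]] // [_ _ _] [-> ->] [-> ->].
  rewrite !pairing_cons /= mulr0 addr0 orientation_signN.
  by rewrite addrA !mulNr subrr add0r.
case: S U e => [|[p a] [|[q b] S]] [|[p' x] [|[q' y] U]] // [-> -> _] -> ->.
rewrite /cross /cross_value; case: is_classical => /=.
  rewrite !pairing_cons /= /flux_value /affine_shift.
  by case: p'; case: q' => /=; rewrite /orientation_sign /=; ring.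
by rewrite !pairing_cons /= mulr0 addr0 addrCA.
Qed.

Lemma pairing_path w S U R Q : unzip1 S = unzip1 U ->
  lpath (r := affine_rule c) w S R -> lpath (r := coloring_rule) w U Q ->
  pairing (last S R) (last U Q)
  = pairing S U + c * lpath_value (r := coloring_rule) w U Q.
Proof.
elim: w S U R Q => [|l w IH] S U [|T R] [|V Q] //= e.
  by rewrite mulr0 addr0.
move=> [s1 p1] [s2 p2]; rewrite (IH _ _ _ _ _ p1 p2); last first.
  have := step_section s1; rewrite e (step_section s2).
  by case.
by rewrite (pairing_step e s1 s2) mulrDr addrA.
Qed.

Lemma pairing_two_ends u v S S' U U' R Q R' Q' :
  unzip1 S = unzip1 U -> unzip1 S' = unzip1 U' ->
  lpath (r := affine_rule c) u [::] R -> last [::] R = S ->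
  lpath (r := coloring_rule) u [::] Q -> last [::] Q = U ->
  lpath (r := affine_rule c) v S' R' -> last S' R' = [::] ->
  lpath (r := coloring_rule) v U' Q' -> last U' Q' = [::] ->
  pairing S U - pairing S' U'
  = c * (lpath_value (r := coloring_rule) u [::] Q +
    lpath_value (r := coloring_rule) v U' Q').
Proof.
move=> e e' p1 l1 p2 l2 p3 l3 p4 l4.
have h1 := pairing_path (S := [::]) (U := [::]) erefl p1 p2; have h2 :=
  pairing_path e' p3 p4.
rewrite l1 l2 in h1; rewrite l3 l4 in h2.
rewrite h1 mulrDr /pairing /= big_nil add0r; congr (_ + _).
by apply/eqP; rewrite eq_sym -subr_eq0 opprK addrC -h2 /pairing big_nil.
Qed.

End Pairing.

Lemma nth_last_cons (A : Type) (x : A) (s : seq A) :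
  last x s = nth x (x :: s) (size s).
Proof. by rewrite -[in LHS](cats0 s) -[size s]addn0 -[X in nth _ (_ :: X)]cats0
  nth_cat_last cats0. Qed.

Lemma unzip1_split2 (X : Type) (S : seq (bool * X)) L0 p q R0 :
  unzip1 S = L0 ++ [:: p, q & R0] ->
  exists L a b R, S = L ++ [:: (p, a), (q, b) & R] /\ size L = size L0.
Proof.
elim: L0 S => [|o L0 IH] [|A S] //=.
  case: A S => p' a [|[q' b] S] // [-> ->] _.
  by exists [::], a, b, S.
case=> _ /IH [L [a [b [R [-> <-]]]]]; by exists (A :: L), a, b, R.
Qed.

(** The labeling lives before the saddle and the coloring after it, so that
    they cannot be compared inside the site. Below and above it they can, and
    the integral over a section, which starts and ends with 0, changes outside
    the site by the intersection number and across the site by the contribution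
    of the two turnbacks, which is the jump of the labels times the jump of the
    colors. *)
Lemma saddle_stokes (c : int) u i o b v (C : point -> int) (f : point -> bool) :
  valid_move (Saddle u i o b v) ->
  labels (affine_rule c) (source (Saddle u i o b v)) C ->
  labels coloring_rule (target (Saddle u i o b v)) f ->
  c * state_sum coloring_rule (target (Saddle u i o b v)) f =
  orientation_sign o * (C (feet u i b).1 - C (feet u i b).2)
    * ((f (feet u i (~~ b)).1)%:Z - (f (feet u i (~~ b)).2)%:Z).
Proof.
move=> va; case es: (site _) => [[[u' m] m'] v'].
have [s1 [s2 [ru rm rm' rv]]] := valid_site va es.
rewrite /source /target es => lC lf.
have [|Ra [Rm [Rb [eR sa sm [pa pm pb _]]]]] := rows_of_split _ lC;
  first by rewrite (site_run ru rm rv).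
have [|Qa [Qm [Qb [eQ ta tm [qa qm qb ->]]]]] := rows_of_split _ lf;
  first by rewrite (site_run ru rm' rv).
set S := last [::] Ra in pm pb *; set S' := last S Rm in pb *.
set U := last [::] Qa in qm qb *; set U' := last U Qm in qb *.
have uS : unzip1 S = s1 by have := lpath_run pa; rewrite ru => -[].
have uU : unzip1 U = s1 by have := lpath_run qa; rewrite ru => -[].
have uS' : unzip1 S' = s2 by have := lpath_run pm; rewrite uS rm => -[].
have uU' : unzip1 U' = s2 by have := lpath_run qm; rewrite uU rm' => -[].
have lS : last S' Rb = [::].
  by have := lpath_run pb; rewrite uS' rv => -[]; case: last.
have lU : last U' Qb = [::].
  by have := lpath_run qb; rewrite uU' rv => -[]; case: last.
have key := pairing_two_ends (etrans uS (esym uU)) (etrans uS' (esym uU')) pa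
  erefl qa erefl pb lS qb lU.
have vm : lpath_value m' U Qm = 0.
  by case: (b) es qm tm => -[_ _ <- _]; [move/turnbacks_value|case: (Qm)].
rewrite vm add0r -key.
have [C1 C2] : (forall k, (k < size S)%N -> C (size u', k)
  = (nth (true, 0) S k).2) /\
    (forall k, (k < size S')%N -> C ((size u' + size m)%N, k)
      = (nth (true, 0) S' k).2).
  have lS1 : level (r := affine_rule c) C (u' ++ m ++ v') (size u') = S.
    by rewrite (level_low eR) ?sa // -sa -nth_last_cons.
  have lS2 : level (r := affine_rule c) C (u' ++ m ++ v') (size u' + size m)
    = S'.
    by have := level_high eR (leq0n _); rewrite addn0 sa sm.
  by split=> k lk; rewrite -?lS1 -?lS2 (nth_level (r := affine_rule c)) //
    -(unzip1_level (r := affine_rule c) C) ?lS1 ?lS2 size_map.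
have [F1 F2] : (forall k, (k < size U)%N -> f (size u', k)
  = (nth (true, false) U k).2) /\
    (forall k, (k < size U')%N -> f ((size u' + size m')%N, k)
      = (nth (true, false) U' k).2).
  have lU1 : level (r := coloring_rule) f (u' ++ m' ++ v') (size u') = U.
    by rewrite (level_low eQ) ?ta // -ta -nth_last_cons.
  have lU2 : level (r := coloring_rule) f (u' ++ m' ++ v') (size u' + size m')
    = U'.
    by have := level_high eQ (leq0n _); rewrite addn0 ta tm.
  by split=> k lk; rewrite -?lU1 -?lU2 (nth_level (r := coloring_rule)) //
    -(unzip1_level (r := coloring_rule) f) ?lU1 ?lU2 size_map.
have nthL (A : Type) (d x y : A) (L R : seq A) : size L = i ->
    nth d (L ++ [:: x, y & R]) i = x /\ nth d (L ++ [:: x, y & R]) i.+1 = y.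
  by move=> <-; split; [rewrite nth_cat ltnn subnn|rewrite nth_cat ltnNge leqnSn
    subSnn].
have ltL (A : Type) (x y : A) (L R : seq A) : size L = i ->
    (i < size (L ++ [:: x, y & R]))%N /\ (i.+1 < size (L ++ [:: x, y & R]))%N.
  by move=> <-; rewrite size_cat /=; split; lia.
case: b va es => va /= [? ? ? ?]; subst u' m m' v'; rewrite /feet /=.
  have eRm : Rm = [::] by case: (Rm) sm.
  have eS' : S' = S by rewrite /S' eRm.
  have [L' [R' [p [x [y [sL' eU eQm]]]]]] := iffLR (turnbacks_path _ _ _ _) qm.
  have eU' : U' = L' ++ [:: (o, y), (~~ o, y) & R'] by rewrite /U' eQm.
  have e12 : s1 = s2 by case: rm.
  have ep : p = o.
    move: uU'; rewrite -e12 -uU eU eU' /unzip1 !map_cat => /eqP.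
    by rewrite eqseq_cat // eqxx /= => /andP[/eqP ->].
  have [L [a [b [R [eS sL]]]]] := @unzip1_split2 _ S (unzip1 L') p (~~ p)
    (unzip1 R')
     (etrans uS (etrans (esym uU) (etrans (congr1 unzip1 eU) (map_cat _ _ _)))).
  rewrite size_map sL' in sL.
  rewrite eS'.
  have [t1 t2] := ltL _ (p, a) (~~ p, b) L R sL; rewrite -eS in t1 t2.
  have [r1 r2] := nthL _ (true, 0) (p, a) (~~ p, b) L R sL.
  rewrite (C1 _ t1) (C1 _ t2) eS r1 r2 /=.
  have [t3 _] := ltL _ (p, x) (~~ p, x) L' R' sL'; rewrite -eU in t3.
  have [t4 _] := ltL _ (o, y) (~~ o, y) L' R' sL'; rewrite -eU' in t4.
  have f2 := F2 _ t4; rewrite addn2 in f2.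
  rewrite (F1 _ t3) f2 eU eU'.
  rewrite (nthL _ (true, false) (p, x) (~~ p, x) L' R' sL').1
    (nthL _ (true, false) (o, y) (~~ o, y) L' R' sL').1 /=.
  rewrite !pairing_cat ?sL ?sL' // !pairing_cons /= ep orientation_signN; ring.
have eQm : Qm = [::] by case: (Qm) tm.
have eU' : U' = U by rewrite /U' eQm.
have [L [R [p [a [b [sL eS eRm]]]]]] := iffLR (turnbacks_path _ _ _ _) pm.
have eS' : S' = L ++ [:: (o, b), (~~ o, b) & R] by rewrite /S' eRm.
have e12 : s1 = s2 by case: rm'.
have ep : p = o.
  move: uS'; rewrite -e12 -uS eS eS' /unzip1 !map_cat => /eqP.
  by rewrite eqseq_cat // eqxx /= => /andP[/eqP ->].
have [L' [x [y [R' [eU sL']]]]] := @unzip1_split2 _ U (unzip1 L) p (~~ p)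
  (unzip1 R)
   (etrans uU (etrans (esym uS) (etrans (congr1 unzip1 eS) (map_cat _ _ _)))).
rewrite size_map sL in sL'.
rewrite eU'.
have [t1 t2] := ltL _ (p, x) (~~ p, y) L' R' sL'; rewrite -eU in t1 t2.
have [r1 r2] := nthL _ (true, false) (p, x) (~~ p, y) L' R' sL'.
rewrite (F1 _ t1) (F1 _ t2) eU r1 r2 /=.
have [t3 _] := ltL _ (p, a) (~~ p, a) L R sL; rewrite -eS in t3.
have [t4 _] := ltL _ (o, b) (~~ o, b) L R sL; rewrite -eS' in t4.
have c2 := C2 _ t4; rewrite addn2 in c2.
rewrite (C1 _ t3) c2 eS eS'.
rewrite (nthL _ (true, 0) (p, a) (~~ p, a) L R sL).1 (nthL _ (true, 0) (o, b)
  (~~ o, b) L R sL).1 /=.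
rewrite !pairing_cat ?sL ?sL' // !pairing_cons /= ep orientation_signN; ring.
Qed.

(** * Labelings along a cobordism *)

(** Only a default value for positions beyond the end of a sequence of moves. *)
Definition move0 : move := Birth [::] 0 true [::].

Notation move_at M k := (nth move0 M k).

Lemma zip_iota (T : Type) (x0 : T) (t : seq T) :
  zip (iota 0 (size t)) t = [seq (j, nth x0 t j) | j <- iota 0 (size t)].
Proof.
apply: (@eq_from_nth _ (0%N, x0)); first by rewrite size_zip size_map !size_iota
  minnn.
move=> j; rewrite size_zip size_iota minnn => lj.
by rewrite nth_zip ?size_iota // (nth_map 0%N) ?size_iota // nth_iota.
Qed.

Lemma cobordism_at D M D' k : cobordism D M D' -> (k < size M)%N ->
  [/\ valid_move (move_at M k), source (move_at M k) = movie D M k &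
      target (move_at M k) = movie D M k.+1].
Proof.
elim: M D k => [|mv M IH] D [|k] //= [va es co] lk; last exact: IH co lk.
by split=> //; case: M {IH co lk}.
Qed.

Lemma cobordism_end D M D' : cobordism D M D' -> movie D M (size M) = D'.
Proof.
elim: M D => [|mv M IH] D //= [va es co]; exact: IH co.
Qed.

Lemma run_movie D M D' k : run D [::] = Some [::] -> cobordism D M D' ->
  (k <= size M)%N -> run (movie D M k) [::] = Some [::].
Proof.
case: k => [|k] rD co lk //; have [va _ <-] := cobordism_at co lk.
exact: valid_target.
Qed.

Section Chains.

Variables (D D' : word) (M : seq move).
Hypotheses (rD : run D [::] = Some [::]) (co : cobordism D M D').

Definition chain (r : labeling_rule) (k k' : nat)
  (L : nat -> point -> label r) : Prop :=
  (forall j, (k <= j <= k')%N -> labels r (movie D M j) (L j)) /\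
  (forall j, (k <= j < k')%N -> agree (move_at M j) (L j) (L j.+1)).

Lemma labels_coloring E f :
  labels coloring_rule E f <-> forall x y, (x, y) \in curve_links E ->
    f x = f y.
Proof.
have -> : labels coloring_rule E f = all (fun e => f e.1 == f e.2)
  (curve_links E).
  rewrite /labels /curve_links all_cat; congr (_ && _).
  by rewrite all_flatten_map; apply: eq_all => c; rewrite /crossing_rule /=
    andbT (eq_sym (f (right_out c))) (eq_sym (f (left_out c))).
split=> [/allP h x y /h /eqP //|h]; apply/allP => -[x y] /h /= ->; exact: eqxx.
Qed.

Lemma mem_schema_points j x : ((j, x) \in schema_points D M)
  = (j <= size M)%N && (x \in points (movie D M j)).
Proof.
apply/flatten_mapP/andP => [[k]|[lj xp]].
  by rewrite mem_iota ltnS => /= lk /mapP[y yp [-> ->]].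
by exists j; [rewrite mem_iota | apply/mapP; exists x].
Qed.

Lemma mem_schema_links j x j' y : ((j, x), (j', y)) \in schema_links D M <->
  [/\ j = j', (j <= size M)%N & (x, y) \in curve_links (movie D M j)] \/
  [/\ j' = j.+1, (j < size M)%N & same_point (move_at M j) x y].
Proof.
rewrite mem_cat (zip_iota move0) -map_comp; split.
  case/orP=> /flatten_mapP[k]; rewrite mem_iota add0n => lk.
    by case/mapP=> -[z t] h [-> -> -> ->]; left.
  case/mapP=> -[z t] /=; rewrite mem_filter => /= /andP[h _] [-> -> -> ->].
  by right.
case=> [[<- lj h]|[-> lj h]]; apply/orP; [left|right]; apply/flatten_mapP;
  exists j;
  rewrite ?mem_iota //=.
  by apply/mapP; exists (x, y).
apply/mapP; exists (x, y) => //; rewrite mem_filter h /=.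
by case/and3P: h => hx hy _; apply/allpairsP; exists (x, y).
Qed.

Definition window k k' := [seq x <- schema_points D M | (k <= x.1 <= k')%N].

Lemma mem_window k k' j x : (k' <= size M)%N -> ((j, x) \in window k k')
  = (k <= j <= k')%N && (x \in points (movie D M j)).
Proof.
move=> lk; rewrite mem_filter /= mem_schema_points.
by case: (boolP (k <= j <= k')%N) => //= /andP[_ lj]; rewrite (leq_trans lj lk).
Qed.

(** Unions of components of a part of the schema are the same as compatible
    two-colorings of its diagrams. *)
Lemma window_respects k k' (f : nat * point -> bool) : (k' <= size M)%N ->
  respects (window k k') (schema_links D M) f
  <-> chain (r := coloring_rule) k k' (fun j x => f (j, x)).
Proof.
move=> lk; split=> [rf|[h1 h2] [j x] [j' y] /mem_schema_links]; last first.
  rewrite !mem_window //; case=> [[<- lj e]|[-> lj e]] /andP[hj _] /andP[hj' _].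
    by have /labels_coloring h := h1 j hj; apply: h.
  by apply: h2 => //; lia.
split=> j hj; have lj : (j <= size M)%N by lia.
  apply/labels_coloring => x y e; apply: rf.
  - by apply/mem_schema_links; left.
  - by rewrite mem_window // hj; case: (curve_links_points _ e);
    rewrite ?(run_movie rD co).
  - by rewrite mem_window // hj; case: (curve_links_points _ e);
    rewrite ?(run_movie rD co).
have lj' : (j < size M)%N by lia.
move=> x y e; have [_ es et] := cobordism_at co lj'.
case/and3P: (e); rewrite es et => hx hy _; apply: rf.
- by apply/mem_schema_links; right.
- by rewrite mem_window // hx andbT; lia.
- by rewrite mem_window // hy andbT; lia.
Qed.

Lemma labels_affineP c E (C : point -> int) : labels (affine_rule c) E C <->
  (forall x y, (x, y) \in arc_links E -> C x = C y) /\
  all (fun x => (C (right_out x) == C (left_in x) - c) &&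
    (C (left_out x) == C (right_in x) + c)) (crossings E).
Proof.
split=> [/andP[/allP h1 h2]|[h1 h2]].
  by split=> // x y /h1/eqP.
by apply/andP; split=> //; apply/allP => -[x y] /h1 /= ->.
Qed.

Lemma labels_shift c d E C f : labels (affine_rule c) E C ->
  labels coloring_rule E f ->
  labels (affine_rule c) E (fun x => C x + d * (f x)%:Z).
Proof.
case/labels_affineP=> h1 h2 lf; have /andP[/allP /= a1 a2] := lf;
  apply/labels_affineP; split.
  by move=> x y e; rewrite (h1 _ _ e) (eqP (a1 _ e)).
elim: (crossings E) h2 a2 => //= x t IH /andP[/andP[/eqP e1 /eqP e2] t1]
  /andP[/andP[/eqP e3 /eqP e4] t2].
rewrite IH // andbT e1 e2 e3 e4 /=; apply/andP; split; apply/eqP;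
  rewrite addrAC //.
Qed.

Lemma chain_state_sum r k k' L j : (k <= j <= k')%N -> (k' <= size M)%N ->
  chain (r := r) k k' L ->
  state_sum r (movie D M j) (L j) = state_sum r (movie D M k') (L k').
Proof.
move=> hj lk [h1 h2]; have -> : k' = (j + (k' - j))%N by lia.
have : (j + (k' - j) <= k')%N by lia.
elim: (k' - j)%N => [|n IH] le; first by rewrite addn0.
rewrite IH ?addnS; last by lia.
have [|va es et] := cobordism_at co (_ : (j + n < size M)%N); first by lia.
rewrite -es -et; apply: move_sum => //.
- by rewrite es; apply: h1; lia.
- by rewrite et; apply: h1; lia.
- by apply: h2; lia.
Qed.

(** The coloring A is the indicator of a union of components of the schema up
    to the level s, which misses the initial diagram and contains exactly one
    of p and q. *)
Definition separated_below s (p q : point) := exists A : nat -> point -> bool,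
  [/\ chain (r := coloring_rule) 0 s A, forall x, x \in points D ->
    A 0%N x = false &
      A s p != A s q].

Definition separated_above s (p q : point) := exists A : nat -> point -> bool,
  [/\ chain (r := coloring_rule) s (size M) A,
      forall x, x \in points (movie D M (size M)) -> A (size M) x = false &
        A s p != A s q].

Definition good_saddle s := forall u i o b v, move_at M s = Saddle u i o b v ->
  separated_below s (feet u i b).1 (feet u i b).2 \/
  separated_above s.+1 (feet u i (~~ b)).1 (feet u i (~~ b)).2.

Lemma state_sum_zero E f : run E [::] -> labels coloring_rule E f ->
  {in points E, forall x, f x = false} -> state_sum coloring_rule E f = 0.
Proof.
move=> rE lf z; rewrite (@state_sum_ext coloring_rule f (fun=> false) E rE lf
  z).
by rewrite /state_sum big1.
Qed.

(** In the first case the labels are shifted along the coloring by the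
    difference of the labels of the feet. In the second one, the intersection
    number of the coloring is that of its last level, where the coloring is
    zero, and Stokes' formula leaves no difference. *)
Lemma good_saddle_label s L : (s < size M)%N -> good_saddle s ->
  chain (r := affine_rule 1) 0 s L ->
  exists L', [/\ chain (r := affine_rule 1) 0 s L',
    {in points D, L' 0%N =1 L 0%N} &
    feet_agree (move_at M s) (L' s)].
Proof.
move=> ls gs ch; have [va es et] := cobordism_at co ls.
case em: (move_at M s) => [||||u i o b v]; try by exists L.
have /= := gs _ _ _ _ _ em; set p := (feet u i b).1; set q := (feet u i b).2.
case=> [[A [[a1 a2] a0 ne]]|[A [cA aM ne]]].
  (* The constant d is added where A is true, at exactly one of the feet. *)
  pose d := if A s p then L s q - L s p else L s p - L s q.
  exists (fun j x => L j x + d * (A j x)%:Z); split.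
  - case: ch => h1 h2; split=> j hj; first by apply: labels_shift; auto.
    by move=> x y e; rewrite (h2 j hj _ _ e) (a2 j hj _ _ e).
  - by move=> x xD; rewrite a0 // mulr0 addr0.
  rewrite /= -/p -/q /d; case: (A s p) ne; case: (A s q) => //= _;
  by rewrite mulr1 mulr0 addr0 addrC subrK.
exists L; split=> //; rewrite /= -/p -/q.
case: (cA) => h1 _; have lT : labels coloring_rule (target (Saddle u i o b v))
  (A s.+1).
  by rewrite -em et; apply: h1; rewrite leqnn.
have lS : labels (affine_rule 1) (source (Saddle u i o b v)) (L s).
  by rewrite -em es; case: ch => h _; apply: h; rewrite leqnn.
rewrite em in va; have := saddle_stokes va lS lT; rewrite -em et.
rewrite (chain_state_sum (k := s.+1) (k' := size M)) ?leqnn //.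
have rM : run (movie D M (size M)) [::] by rewrite (run_movie rD co).
have lM : labels coloring_rule (movie D M (size M)) (A (size M)).
  by apply: h1; rewrite ls leqnn.
rewrite (state_sum_zero rM lM aM).
rewrite mulr0 => /esym/eqP; rewrite !mulf_eq0 => /orP[/orP[]|].
- by case: (o).
- by rewrite subr_eq0 => /eqP.
by move: ne; case: (A s.+1 _); case: (A s.+1 _).
Qed.

(** Modifying labels at a saddle affects all the lower diagrams except the
    initial one, hence an induction which rebuilds the whole chain at each
    step. *)
Lemma good_chain C : labels (affine_rule 1) D C ->
  (forall s, (s < size M)%N -> good_saddle s) ->
  exists L, chain (r := affine_rule 1) 0 (size M) L /\
    {in points D, L 0%N =1 C}.
Proof.
move=> lC gs; suff H k : (k <= size M)%N ->
    exists L, chain (r := affine_rule 1) 0 k L /\ {in points D, L 0%N =1 C}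
      by exact: H.
elim: k => [|k IH] lk.
  exists (fun _ => C); split=> //; split=> j; last by rewrite ltn0 andbF.
  by rewrite leqn0 => /eqP ->.
have [L [ch e0]] := IH (ltnW lk).
have [L' [[h1 h2] e1 fa]] := good_saddle_label lk (gs _ lk) ch.
have [va es et] := cobordism_at co lk.
have lS : labels (affine_rule 1) (source (move_at M k)) (L' k) by rewrite es;
  apply: h1; rewrite leqnn.
have [C' [l' ag _]] := @move_extend (affine_rule 1) _ _ 0 va lS fa.
exists (fun j => if (j <= k)%N then L' j else C'); split; last by move=> x xD;
  rewrite /= e1 ?e0.
split=> j hj.
  case: ifP => lj; first by apply: h1; lia.
  have -> : j = k.+1 by lia.
  by rewrite -et.
have lj : (j <= k)%N by lia.
rewrite lj; case: ltnP => // lj'; first by apply: h2; lia.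
have -> : j = k by lia.
exact: ag.
Qed.

End Chains.

Lemma onth_all (T : Type) (p : pred T) (s : seq T) :
  (forall j c, onth s j = Some c -> p c) <-> all p s.
Proof.
elim: s => [|x s IH] /=; first by split=> // _ [].
split=> [h|/andP[px ps] [|j] c /=]; last first.
- by move/IH: ps; apply.
- by case=> <-.
by rewrite (h 0%N) //=; apply/IH => j c; apply: (h j.+1).
Qed.

Lemma affine_labelingP (D : word) (C : labeling) :
  affine_labeling D C <-> labels (affine_rule 1) D C.
Proof.
rewrite labels_affineP /affine_labeling; split=> -[h1 h2]; split=> //.
  by apply/onth_all => j c /h2 [-> ->]; rewrite !eqxx.
by move=> j c e; have /onth_all/(_ j c e)/andP[/eqP -> /eqP ->] := h2.
Qed.

(** At a negative crossing the weight is the opposite of the one at a positive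
    crossing with the same labels. *)
Lemma affine_polynomialE (D : word) (C : labeling) :
  affine_polynomial D C = state_sum (affine_rule 1) D C.
Proof.
apply: eq_bigr => c _; rewrite /= /affine_value /sgn /weight.
case: (positive c); first by rewrite mul1r opprD addrA.
rewrite mulrN1z mulN1r; congr (- (laurent_t ^ _ - 1)); ring.
Qed.

Lemma chain_corresponds D M L : chain D M (r := affine_rule 1) 0 (size M) L ->
  corresponds D M (L 0%N) (L (size M)).
Proof.
elim: M D L => [|mv M IH] D L [h1 h2] /=.
  by split=> //; apply/affine_labelingP; apply: (h1 0%N).
split; first by apply/affine_labelingP; apply: (h1 0%N).
exists (L 1%N); first exact: (h2 0%N).
apply: (IH (target mv) (fun j => L j.+1)); split=> j hj; first exact: (h1 j.+1).
exact: (h2 j.+1).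
Qed.

Lemma cobordism_invariance D D' M C : run D [::] = Some [::] ->
  cobordism D M D' ->
  (forall s, (s < size M)%N -> good_saddle D M s) -> affine_labeling D C ->
  exists C' : labeling, [/\ affine_labeling D' C', corresponds D M C C' &
    affine_polynomial D C = affine_polynomial D' C'].
Proof.
move=> rD co gs /affine_labelingP lC.
have [L [[h1 h2] e0]] := good_chain rD co lC gs.
pose L' j := if j is 0 then C else L j.
have ch : chain D M (r := affine_rule 1) 0 (size M) L'.
  split=> [[|j] hj|[|j] hj] //; try exact: h1; try exact: h2.
  move=> x y e; rewrite /L' -(h2 0%N hj _ _ e) -e0 //.
  have lM : (0 < size M)%N by []; have [_ es _] := cobordism_at co lM.
  by case/and3P: e; rewrite es.
exists (L' (size M)); rewrite !affine_polynomialE -(cobordism_end co); split.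
- by apply/affine_labelingP; case: ch => h _; apply: h; rewrite leqnn.
- by rewrite -[C]/(L' 0%N); apply: chain_corresponds.
by rewrite -(chain_state_sum co (j := 0%N) _ (leqnn _) ch) ?leq0n.
Qed.

Lemma indicesE (p : pred move) M :
  indices p M = [seq j <- iota 0 (size M) | p (move_at M j)].
Proof. by rewrite /indices (zip_iota move0) filter_map -map_comp map_id. Qed.

Lemma cancel_good D D' M s : run D [::] = Some [::] -> cobordism D M D' ->
  critical_points_cancel D M -> (s < size M)%N -> good_saddle D M s.
Proof.
move=> rD co [pairs [_ p2 hp]] ls u i o b v em.
have : s \in indices is_saddle M.
  by rewrite indicesE mem_filter em mem_iota.
rewrite -(perm_mem p2) => /mapP[[e s'] hes /= es]; subst s'.
have := hp e s hes; rewrite /canceling_pair.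
have os : onth M s = Some (Saddle u i o b v) by rewrite -em; elim: (M) (s) ls =>
  [|y t IH] [|k] //=; apply: IH.
rewrite os; case oe: (onth M e) => [[| | u0 i0 o0 v0 | u0 i0 o0 v0 |]|] //.
  case=> A hA [_ a0 ne]; left; exists (fun j x => (j, x) \in A); split=> //.
    exact: iffLR (window_respects rD co 0 (fun x => x \in A) (ltnW ls))
      (piece_respects hA).
  by move=> x _; apply/negP => h; move/allP/(_ _ h): a0.
case=> A hA [_ a0 ne]; right; exists (fun j x => (j, x) \in A); split=> //.
  exact: iffLR (window_respects rD co s.+1 (fun x => x \in A) (leqnn _))
    (piece_respects hA).
by move=> x _; apply/negP => h; move/allP/(_ _ h): a0; rewrite /= eqxx.
Qed.

Lemma invariance_links (L L' : diagram) (M : seq move) :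
  cobordism L M L' -> critical_points_cancel L M ->
  forall C : labeling, affine_labeling L C ->
  exists C' : labeling, [/\ affine_labeling L' C', corresponds L M C C' &
    affine_polynomial L C = affine_polynomial L' C'].
Proof.
move=> co cc C lC; have rL : run L [::] = Some [::] by apply/eqP/word_of_closed.
exact: cobordism_invariance rL co (fun s => cancel_good rL co cc) lC.
Qed.

(** * How a move changes the number of curves *)

Lemma respects_labels D f : run D [::] ->
  respects (points D) (curve_links D) f <-> labels coloring_rule D f.
Proof.
move=> rD; rewrite labels_coloring; split=> [h x y e|h x y e _ _];
  last exact: h.
by have [] := curve_links_points rD e; apply: h.
Qed.

Lemma agree_ext (X : Type) mv (C C1 C' C1' : point -> X) :
  {in points (source mv), C =1 C1} -> {in points (target mv), C' =1 C1'} ->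
  agree mv C C' -> agree mv C1 C1'.
Proof.
move=> e e' h x y sp; case/and3P: (sp) => hx hy _.
by rewrite -e // -e' // (h _ _ sp).
Qed.

Definition xor_color (T : Type) (f g : T -> bool) (x : T) := f x (+) g x.

Lemma respects_xor (T : choiceType) V E (f g : T -> bool) :
  respects V E f -> respects V E g -> respects V E (xor_color f g).
Proof. by move=> hf hg x y e xV yV; rewrite /xor_color (hf x y) ?(hg x y). Qed.

Lemma labels_xor D f g : run D [::] -> labels coloring_rule D f ->
  labels coloring_rule D g ->
  labels coloring_rule D (xor_color f g).
Proof. by move=> rD; rewrite -!respects_labels //; apply: respects_xor. Qed.

Section PiecesLeq.

Variables (T T' : choiceType) (V : seq T) (E : seq (T * T))
  (V' : seq T') (E' : seq (T' * T')).

Lemma pieces_leq (R : (T -> bool) -> (T' -> bool) -> Prop) :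
  (forall f, respects V E f -> exists2 f', respects V' E' f' & R f f') ->
  (forall f1 f2 f1' f2', respects V E f1 -> respects V E f2 ->
     R f1 f1' -> R f2 f2' -> {in V', f1' =1 f2'} -> {in V, f1 =1 f2}) ->
  (size (pieces V E) <= size (pieces V' E'))%N.
Proof.
move=> ex un; rewrite -(leq_exp2l (m := 2)) //.
have := @pieces_count _ _ V E V' E' unit unit (fun f _ f' _ => R f f').
rewrite card_unit !mul1n; apply=> [f _ rf | f1 [] f2 [] f1' f2' _ r1 r2 R1 R2
  e].
  by have [f' rf' Rf] := ex f rf; exists f', tt.
by split=> //; apply: un R1 R2 e.
Qed.

Lemma pieces_leS (R : (T -> bool) -> (T' -> bool) -> bool -> Prop) :
  (forall f, respects V E f -> exists f' b, respects V' E' f' /\ R f f' b) ->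
  (forall f1 f2 f1' f2' b, respects V E f1 -> respects V E f2 ->
     R f1 f1' b -> R f2 f2' b -> {in V', f1' =1 f2'} -> {in V, f1 =1 f2}) ->
  (size (pieces V E) <= (size (pieces V' E')).+1)%N.
Proof.
move=> ex un; rewrite -(leq_exp2l (m := 2)) // expnS.
have := @pieces_count _ _ V E V' E' unit bool (fun f _ f' b => R f f' b).
rewrite card_unit card_bool mul1n; apply=> [f _ rf | f1 [] f2 [] f1' f2' b r1 r2
  R1 R2 e].
  exact: ex f rf.
by split=> //; apply: un R1 R2 e.
Qed.

Lemma pieces_lt (R : (T -> bool) -> bool -> (T' -> bool) -> Prop) :
  (forall f b, respects V E f -> exists2 f', respects V' E' f' & R f b f') ->
  (forall f1 b1 f2 b2 f1' f2', respects V E f1 -> respects V E f2 ->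
     R f1 b1 f1' -> R f2 b2 f2' -> {in V', f1' =1 f2'} -> {in V, f1 =1 f2} /\
       b1 = b2) ->
  (size (pieces V E) < size (pieces V' E'))%N.
Proof.
move=> ex un; rewrite -(leq_exp2l (m := 2)) // expnS.
have := @pieces_count _ _ V E V' E' bool unit (fun f b f' _ => R f b f').
rewrite card_unit card_bool mul1n; apply=> [f b rf | f1 b1 f2 b2 f1' f2' _ r1 r2
  R1 R2 e].
  by have [f' rf' Rf] := ex f b rf; exists f', tt.
exact: un R1 R2 e.
Qed.

End PiecesLeq.

Lemma circle_point_in u i o v : valid_move (Birth u i o v) ->
  ((size u).+1, i) \in points (target (Birth u i o v)).
Proof.
move=> /valid_target; rewrite [target _](_ : _ = u ++ [:: (i, Cup o), (i, Cap) &
  v]) // => rT.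
set D := u ++ _ in rT *; have lu : (size u < size D)%N by rewrite size_cat /=
  addnS ltnS leq_addr.
have rD : run D [::] by rewrite rT.
have := size_apply_layer (section_succ rD lu).
rewrite [nth _ _ _](_ : _ = (i, Cup o)) => [[/= h1 h2]|];
  last by rewrite nth_cat ltnn subnn.
by rewrite mem_points lu h2 /=; lia.
Qed.

Lemma feet_in u i o b v : valid_move (Saddle u i o b v) ->
  (feet u i b).1 \in points (source (Saddle u i o b v)) /\
  (feet u i b).2 \in points (source (Saddle u i o b v)).
Proof.
move=> va; case: b va => va.
  have [s1 [s2 [ru rm rm' rv]]] := valid_site va (erefl _).
  have li : (i + 2 <= size s1)%N.
    move: rm'; rewrite /turnbacks [run _ _]/= -/(apply_layer (i, Cap) s1).
    by case E: apply_layer => [s|] // _; case: (size_apply_layer E).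
  by rewrite !mem_points /source /= size_cat leq_addr (section_site _ ru);
    split; lia.
have [s1 [s2 [ru rm rm' rv]]] := valid_site va (erefl _).
have e12 : s1 = s2 by case: rm'.
have li : (i + 2 <= size s1)%N.
  move: rm; rewrite /turnbacks [run _ _]/= -/(apply_layer (i, Cap) s1).
  by case E: apply_layer => [s|] // _; case: (size_apply_layer E).
rewrite !mem_points /source /= size_cat leq_addr (section_site _ ru) /=.
rewrite (_ : (size u).+2 = size u + size (turnbacks i o) + 0)%N;
  last by rewrite addn0 addn2.
rewrite (site_section_high v ru rm) take0 /= -e12 addn0 addn2; split; first lia.
rewrite -addn2 leq_add2l /=; lia.
Qed.

Lemma turnbacks_linked u i o v :
  ((size u, i), (size u, i.+1)) \in curve_links (u ++ turnbacks i o ++ v).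
Proof.
rewrite mem_cat /arc_links indexed_layersE -map_comp; apply/orP; left.
apply/flatten_mapP; exists (size u).
  by rewrite mem_iota size_cat /= addnS ltnS leq_addr.
rewrite /= nth_cat ltnn subnn /= !mem_cat inE eqxx !orbT //.
Qed.

(** The feet lie just below or just above the site of the saddle, so they are
    still points of the target; there, the maximum links them, or they are both
    on the same vertical strand. *)
Lemma saddle_agree (X : Type) u i o b v (g f : point -> X) :
  valid_move (Saddle u i o b v) ->
  agree (Saddle u i o b v) g f ->
  [/\ g (size u, i) = f (size u, i), g (size u, i.+1) = f (size u, i.+1) &
     if b then True else g ((size u).+2, i) = f (size u, i)].
Proof.
move=> va ag; have [pS qS] := feet_in va.
have [pT qT] := feet_in (valid_rev va : valid_move (Saddle u i o (~~ b) v)).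
have eT : source (Saddle u i o (~~ b) v) = target (Saddle u i o b v).
  by rewrite -source_rev.
rewrite eT in pT qT.
have low k : (size u, k) \in points (source (Saddle u i o b v)) ->
    (size u, k) \in points (target (Saddle u i o b v)) ->
    g (size u, k) = f (size u, k).
  move=> h1 h2; apply: ag; rewrite /same_point h1 h2 /=.
  by case: (b); rewrite /= leqnn eqxx.
have same k : ((size u, k) \in points (source (Saddle u i o b v)))
   = ((size u, k) \in points (target (Saddle u i o b v))).
  rewrite !mem_points /source /target /=.
  by case: (b); rewrite /= !size_cat !leq_addr /= !section_size_cat.
case: b va ag pS qS pT qT low same {eT} => va ag pS qS pT qT low same.
  by split=> //; apply: low => //; rewrite -same.
split; [exact: low | by apply: low => //; rewrite same | ].
apply: ag; rewrite /same_point qS pT /=; apply/orP; right.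
by rewrite addn2 leqnn addn0 -addn2 addnK eqxx.
Qed.

Section CurveCounts.

Variable mv : move.
Hypothesis va : valid_move mv.

Let n := size (curves (source mv)).
Let n' := size (curves (target mv)).

Let rS : run (source mv) [::]. Proof. by rewrite valid_source. Qed.
Let rT : run (target mv) [::]. Proof. by rewrite valid_target. Qed.

(** Two-colorings can be transported by a move read backward, which gives
    relations from colorings of the target to colorings of the source. *)
Lemma color_back f x0 : labels coloring_rule (target mv) f ->
  feet_agree (rev_move mv) f ->
  exists g, [/\ labels coloring_rule (source mv) g, agree mv g f &
    circle_label (rev_move mv) g x0].
Proof.
move=> lf fa; have := @move_extend coloring_rule _ f x0 (valid_rev va).
rewrite source_rev target_rev => /(_ lf fa) [g [lg ag cl]].
by exists g; split=> //; apply/agree_rev.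
Qed.

Lemma color_unique g g' f f' : labels coloring_rule (source mv) g ->
  labels coloring_rule (target mv) f -> labels coloring_rule (target mv) f' ->
  {in points (source mv), g =1 g'} -> agree mv g f -> agree mv g' f' ->
  circles_agree mv f f' -> {in points (target mv), f =1 f'}.
Proof.
move=> lg lf lf' e a a' ci; apply: (move_unique (r := coloring_rule) va lg lf
  lf' a _ ci).
by apply: agree_ext a' => // x xS; rewrite e.
Qed.

Lemma curves_le : ~~ is_extremum mv -> ~~ is_saddle mv -> (n' <= n)%N.
Proof.
move=> ne ns.
apply: (pieces_leq (R := fun f g => agree mv g f /\ labels coloring_rule
  (source mv) g)).
  move=> f /(respects_labels _ rT) lf.
  have [|g [lg ag _]] := color_back false lf; first by case: (mv) ns.
  by exists g; first exact/respects_labels.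
move=> f1 f2 g1 g2 /(respects_labels _ rT) l1 /(respects_labels _ rT) l2
  [a1 lg1] [a2 lg2] e.
by apply: color_unique lg1 l1 l2 e a1 a2 _; case: (mv) ne.
Qed.

Lemma curves_birth u i o v : mv = Birth u i o v -> (n' <= n.+1)%N.
Proof.
move=> em.
apply: (pieces_leS (R := fun f g b => [/\ agree mv g f, labels coloring_rule
  (source mv) g
   & circle_label mv f b])).
  move=> f /(respects_labels _ rT) lf.
  have [|g [lg ag _]] := color_back false lf; first by rewrite em.
  by exists g, (f ((size u).+1, i)); split; [exact/respects_labels|split=> //;
    rewrite em].
move=> f1 f2 g1 g2 b /(respects_labels _ rT) l1 /(respects_labels _ rT) l2
  [a1 lg1 c1] [a2 lg2 c2] e.
by apply: color_unique lg1 l1 l2 e a1 a2 _; rewrite em /= in c1 c2 *;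
  rewrite c1 c2.
Qed.

Lemma curves_death u i o v : mv = Death u i o v -> (n' < n)%N.
Proof.
move=> em.
apply: (pieces_lt (R := fun f b g => [/\ agree mv g f, labels coloring_rule
  (source mv) g
   & g ((size u).+1, i) = b])).
  move=> f b /(respects_labels _ rT) lf.
  have [|g [lg ag cg]] := color_back b lf; first by rewrite em.
  by exists g; [exact/respects_labels|split=> //; move: cg; rewrite em].
move=> f1 b1 f2 b2 g1 g2 /(respects_labels _ rT) l1 /(respects_labels _ rT) l2
  [a1 lg1 c1] [a2 lg2 c2] e.
split; first by apply: color_unique lg1 l1 l2 e a1 a2 _; rewrite em.
rewrite -c1 -c2 e // em.
by have := @circle_point_in u i o v;
  rewrite -[Birth _ _ _ _]/(rev_move (Death u i o v)) target_rev;
  apply; rewrite -em; apply: valid_rev.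
Qed.

Section SaddleCount.

Variables (u v : word) (i : nat) (o b : bool).
Hypothesis em : mv = Saddle u i o b v.

Let p := (feet u i b).1.
Let q := (feet u i b).2.
Let p' := (feet u i (~~ b)).1.
Let q' := (feet u i (~~ b)).2.

Lemma feet_source : p \in points (source mv) /\ q \in points (source mv).
Proof. by rewrite em; apply: feet_in; rewrite -em. Qed.

(** This is the fact that an oriented saddle cannot turn two curves into two
    curves. Take the coloring g as an integer label constant along curves: the
    product of the jumps of g and f at the saddle is zero by Stokes' formula
    without intersection term. *)
Lemma feet_separated g f : labels coloring_rule (source mv) g ->
  labels coloring_rule (target mv) f -> g p != g q -> f p' = f q'.
Proof.
move=> lg lf ne; have := va; rewrite em => va'.
(* No shift: an integer constant along curves is a labeling. *)
have lC : labels (affine_rule 0) (source mv) (fun x => (g x)%:Z).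
  case/andP: lg => /allP h1 h2; apply/labels_affineP; split.
    by move=> x y /h1 /= /eqP ->.
  apply: sub_all h2 => c /andP[/eqP /= -> /eqP /= ->].
  by rewrite subr0 addr0 !eqxx.
rewrite em in lC lf; have := saddle_stokes va' lC lf; rewrite mul0r -/p -/q -/p'
  -/q'.
move/esym/eqP; rewrite !mulf_eq0 => /orP[/orP[]|].
- by case: (o).
- by move: ne; case: (g p); case: (g q).
by case: (f p'); case: (f q').
Qed.

Lemma saddle_extend_back f : labels coloring_rule (target mv) f ->
  f p' = f q' ->
  exists2 g, labels coloring_rule (source mv) g & agree mv g f.
Proof.
move=> lf e; have [|g [lg ag _]] := color_back false lf; first by rewrite em.
by exists g.
Qed.

Lemma agree_feet_source g f : labels coloring_rule (target mv) f ->
  agree mv g f -> g p = g q.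
Proof.
move=> lf ag; move: (va) (ag) lf; rewrite em => va' ag' lf.
have [e1 e2 e3] := saddle_agree va' ag'; move: lf e1 e2 e3.
rewrite /p /q; case: (b) => lf /= e1 e2 e3; last by rewrite e1 e3.
by rewrite e1 e2; move/labels_coloring: lf; apply; apply: turnbacks_linked.
Qed.

Lemma curves_saddle_le :
  (forall f, labels coloring_rule (target mv) f -> f p' = f q') -> (n' <= n)%N.
Proof.
move=> sep.
apply: (pieces_leq (R := fun f g => agree mv g f /\ labels coloring_rule
  (source mv) g)).
  move=> f /(respects_labels _ rT) lf.
  have [g lg ag] := saddle_extend_back lf (sep f lf).
  by exists g; first exact/respects_labels.
move=> f1 f2 g1 g2 /(respects_labels _ rT) l1 /(respects_labels _ rT) l2
  [a1 lg1] [a2 lg2] e.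
by apply: color_unique lg1 l1 l2 e a1 a2 _; rewrite em.
Qed.

(** A coloring which takes different values at the new feet does not come from
    the source; adding the separating coloring f0 modulo 2 corrects it, at the
    expense of one bit. *)
Lemma curves_saddle_leS f0 : labels coloring_rule (target mv) f0 ->
  f0 p' != f0 q' -> (n' <= n.+1)%N.
Proof.
(* The bit remembers whether f has been corrected. *)
move=> l0 s0; pose adj f := if f p' == f q' then f else xor_color f f0.
have adjP f : labels coloring_rule (target mv) f ->
    labels coloring_rule (target mv) (adj f) /\ adj f p' = adj f q'.
  rewrite /adj => lf; case: eqP => // /eqP ne; split; first exact: labels_xor.
  by move: ne s0; rewrite /xor_color; case: (f p'); case: (f q'); case: (f0 p');
    case: (f0 q').
apply: (pieces_leS (R := fun f g b => [/\ agree mv g (adj f),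
  labels coloring_rule (source mv) g
   & b = (f p' == f q')])).
  move=> f /(respects_labels _ rT) lf; have [la ea] := adjP f lf.
  have [g lg ag] := saddle_extend_back la ea.
  by exists g, (f p' == f q'); split; first exact/respects_labels.
move=> f1 f2 g1 g2 c /(respects_labels _ rT) l1 /(respects_labels _ rT) l2
  [a1 lg1 ->] [a2 lg2 ec] e x xT.
have [la1 _] := adjP _ l1; have [la2 _] := adjP _ l2.
have : adj f1 x = adj f2 x by apply: color_unique lg1 la1 la2 e a1 a2 _ x xT;
  rewrite em.
by rewrite /adj ec; case: ifP => // _; apply: addIb.
Qed.

(** Colorings of the target give equal values at the feet; adding g0 modulo 2
    produces as many colorings of the source with different values. *)
Lemma curves_saddle_lt g0 : labels coloring_rule (source mv) g0 ->
  g0 p != g0 q -> (n' < n)%N.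
Proof.
move=> l0 s0.
apply: (pieces_lt (R := fun f c g =>
  [/\ agree mv (if c then xor_color g g0 else g) f,
   labels coloring_rule (source mv) g & (g p != g q) = c])).
  move=> f c /(respects_labels _ rT) lf.
  have [g lg ag] := saddle_extend_back lf (feet_separated l0 lf s0).
  have eg := agree_feet_source lf ag.
  exists (if c then xor_color g g0 else g).
    by apply/respects_labels => //; case: (c) => //; apply: labels_xor.
  split; last 1 first.
  - by case: (c); rewrite /xor_color eg ?eqxx // (inj_eq (@addbI _)).
  - by move=> x y sp; rewrite -(ag x y sp); case: (c); rewrite // /xor_color
    addbK.
  - by case: (c) => //; apply: labels_xor.
move=> f1 c1 f2 c2 g1 g2 /(respects_labels _ rT) l1 /(respects_labels _ rT) l2
  [a1 lg1 e1] [a2 lg2 e2] e.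
have [pS qS] := feet_source.
have ec : c1 = c2 by rewrite -e1 -e2 (e _ pS) (e _ qS).
split=> //; subst c2.
apply: (@color_unique _ _ f1 f2 _ l1 l2 _ a1 a2); last by rewrite em.
  by case: (c1) => //; apply: labels_xor.
by move=> x xS; rewrite -ec; case: (c1); rewrite /xor_color /= (e _ xS).
Qed.

End SaddleCount.

End CurveCounts.

(** * How a move changes the number of components of the schema *)

Section Extension.

Variable mv : move.
Hypothesis va : valid_move mv.

Variables (T : choiceType) (V V' : seq T) (E E' : seq (T * T))
  (bottom top : point -> T).
Hypothesis sub : {subset V <= V'}.
Hypothesis top_in : forall x, x \in points (target mv) -> top x \in V'.
Hypothesis restrict : forall f : T -> bool, respects V E f ->
  labels coloring_rule (source mv) (fun x => f (bottom x)).
Hypothesis glue : forall (f : T -> bool) (g : point -> bool), respects V E f ->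
  labels coloring_rule (target mv) g -> agree mv (fun x => f (bottom x)) g ->
  exists f', [/\ respects V' E' f', {in V, f' =1 f} &
     {in points (target mv), forall x, f' (top x) = g x}].

Let n := size (curves (source mv)).
Let n' := size (curves (target mv)).
Let c := size (pieces V E).
Let c' := size (pieces V' E').

Lemma glue_extend (f : T -> bool) (x0 : bool) : respects V E f ->
  feet_agree mv (fun x => f (bottom x)) ->
  exists f', [/\ respects V' E' f', {in V, f' =1 f} &
    circle_label mv (fun x => f' (top x)) x0].
Proof.
move=> rf fa; have [g [lg ag cg]] := @move_extend coloring_rule _ _ x0 va
  (restrict rf) fa.
have [f' [rf' e e']] := glue rf lg ag; exists f'; split=> //.
case: (mv) va e' cg => //= u i o v va' e' cg; rewrite e' //.
exact: circle_point_in.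
Qed.

Lemma pieces_le_extend :
  (forall f : T -> bool, respects V E f ->
    feet_agree mv (fun x => f (bottom x))) -> (c <= c')%N.
Proof.
move=> fa; apply: (pieces_leq (R := fun f f' => {in V, f' =1 f})).
  by move=> f rf; have [f' [rf' e _]] := glue_extend false rf (fa f rf);
    exists f'.
by move=> f1 f2 f1' f2' _ _ e1 e2 e x xV; rewrite -e1 // -e2 // e // sub.
Qed.

Lemma pieces_lt_birth u i o v : mv = Birth u i o v -> (c < c')%N.
Proof.
move=> em; apply: (pieces_lt (R := fun f b f' => {in V, f' =1 f} /\
  f' (top ((size u).+1, i)) = b)).
  move=> f b rf; have [|f' [rf' e cf]] := glue_extend b rf; first by rewrite em.
  by exists f' => //; split=> //; move: cf; rewrite em.
move=> f1 b1 f2 b2 f1' f2' _ _ [e1 <-] [e2 <-] e; split.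
  by move=> x xV; rewrite -e1 // -e2 // e // sub.
apply: e; apply: top_in; rewrite em; apply: circle_point_in; by rewrite -em.
Qed.

Lemma pieces_saddle_leS u i o b v (f0 : T -> bool) : mv = Saddle u i o b v ->
  respects V E f0 ->
  f0 (bottom (feet u i b).1) != f0 (bottom (feet u i b).2) -> (c <= c'.+1)%N.
Proof.
move=> em r0; set p := bottom _; set q := bottom _ => s0.
pose adj (f : T -> bool) := if f p == f q then f else xor_color f f0.
have adjP f : respects V E f -> respects V E (adj f) /\ adj f p = adj f q.
  rewrite /adj => rf; case: eqP => // /eqP ne; split; first exact: respects_xor.
  by move: ne s0; rewrite /xor_color; case: (f p); case: (f q); case: (f0 p);
    case: (f0 q).
apply: (pieces_leS (R := fun f f' d => {in V, f' =1 adj f} /\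
  d = (f p == f q))).
  move=> f rf; have [ra ea] := adjP f rf.
  have [|f' [rf' e _]] := glue_extend false ra; first by rewrite em.
  by exists f', (f p == f q).
move=> f1 f2 f1' f2' d _ _ [e1 ->] [e2 ed] e x xV.
have : adj f1 x = adj f2 x by rewrite -e1 // -e2 // e // sub.
by rewrite /adj ed; case: ifP => // _; apply: addIb.
Qed.

(** V and E describe a part of the schema ending at the source of the move, V'
    and E' the same part with the target added. With Euler characteristics
    taken into account, the inequality says that the genus does not decrease;
    each case of a saddle gains or loses components and curves in a way
    compatible with it, and the only cases of equality are those where a
    component below, or a curve above, is cut. *)
Lemma extension_count :
  (2 * c + n' + is_extremum mv <= 2 * c' + n + is_saddle mv)%N /\
  forall u i o b v, mv = Saddle u i o b v -> (2 * c' + n + 1 <= 2 * c + n')%N ->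
    (exists2 f : T -> bool, respects V E f & f (bottom (feet u i b).1)
      != f (bottom (feet u i b).2)) \/
    (exists2 f : point -> bool, labels coloring_rule (target mv) f &
       f (feet u i (~~ b)).1 != f (feet u i (~~ b)).2).
Proof.
have plain : ~~ is_saddle mv -> (c <= c')%N.
  by move=> ns; apply: pieces_le_extend => f _; case: (mv) ns.
have same : ~~ is_extremum mv -> ~~ is_saddle mv -> (n' <= n)%N := curves_le va.
case: (boolP (is_saddle mv)) => [|ns]; last first.
  have lc := plain ns; split; last by move=> u i o b v em; rewrite em in ns.
  case: (boolP (is_extremum mv)) => [ex|nex]; last by have := same nex ns; lia.
  case em: mv ex => [||u i o v|u i o v|] // _.
    by have := curves_birth va em; have := pieces_lt_birth em;
      rewrite -/n -/n' -/c -/c'; lia.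
  by have := curves_death va em; rewrite -/n -/n'; lia.
case em: mv => [||||u i o b v] // _.
rewrite [nat_of_bool (is_extremum _)]/= addn0.
set p := (feet u i b).1; set q := (feet u i b).2.
set p' := (feet u i (~~ b)).1; set q' := (feet u i (~~ b)).2.
case: (classic (exists2 f : T -> bool, respects V E f & f (bottom p)
  != f (bottom q))) => [[f rf sf]|nsep].
  have := pieces_saddle_leS em rf sf.
  have := curves_saddle_lt va em (restrict rf) sf.
  rewrite -/n -/n' -/c -/c' => h1 h2.
  split; first by lia.
  by move=> u1 i1 o1 b1 v1 [<- <- _ <- _] _; left; exists f.
have le : (c <= c')%N.
  apply: pieces_le_extend => f rf; rewrite em /=; apply/eqP/negPn/negP => h.
  by apply: nsep; exists f.
case: (classic (exists2 f : point -> bool, labels coloring_rule (target mv) f &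
  f p' != f q')) => [[f lf sf]|nsep'].
  have := curves_saddle_leS va em lf sf; rewrite -/n -/n' => h1; split;
    first by lia.
  by move=> u1 i1 o1 b1 v1 [<- <- _ <- _] _; right; rewrite -em; exists f.
have le' : (n' <= n)%N.
  apply: (curves_saddle_le va em) => f lf; apply/eqP/negPn/negP => h.
  by apply: nsep'; exists f.
by split; first (by lia); move=> u1 i1 o1 b1 v1 _; lia.
Qed.

End Extension.

(** * Genus zero between knots *)

Lemma knot_constant (A : Type) D (f : point -> A) : is_knot D ->
  respects (points D) (curve_links D) f ->
  {in points D &, forall x y, f x = f y}.
Proof.
rewrite /is_knot => k1 rf x y xD yD.
have [A1 h1 x1] := piece_of (curve_links D) xD; have [A2 h2 y2] :=
  piece_of (curve_links D) yD.
have e : A1 = A2.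
  by move: k1 h1 h2; rewrite /curves; case: pieces => [|B []] // _;
    rewrite !inE => /eqP -> /eqP ->.
by subst A2; apply: piece_constant rf h1 x1 y2.
Qed.

Lemma is_extremum_rev mv : is_extremum (rev_move mv) = is_extremum mv.
Proof. by case: mv. Qed.

Lemma is_saddle_rev mv : is_saddle (rev_move mv) = is_saddle mv.
Proof. by case: mv. Qed.

(** The genus of the part of the schema below a level is nonnegative at the
    first level and zero at the last one, so that every inequality on the way
    is an equality. *)
Lemma monotone_constant (G : nat -> int) m k :
  (forall j, (j < m)%N -> G j <= G j.+1) -> G m <= G 0%N -> (k < m)%N ->
  G k = G k.+1.
Proof.
move=> mono e lk.
have up i j : (i <= j <= m)%N -> G i <= G j.
  elim: j => [|j IH]; first by rewrite leqn0 => /andP[/eqP -> _].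
  rewrite leq_eqVlt => /andP[/orP[/eqP -> //|le] lj].
  by apply: le_trans (mono j lj); apply: IH; rewrite -ltnS le ltnW.
have h1 := up 0%N k; have h2 := up k.+1 m; have h3 := mono k lk.
have {}h1 : G 0%N <= G k by apply: h1; rewrite leq0n ltnW.
have {}h2 : G k.+1 <= G m by apply: h2; rewrite lk leqnn.
by apply/eqP; rewrite eq_le h3 (le_trans h2) // (le_trans e).
Qed.

Section Genus.

Variables (D D' : word) (M : seq move).
Hypotheses (rD : run D [::] = Some [::]) (co : cobordism D M D').

Let n k := size (curves (movie D M k)).
Let c k k' := size (schema_between D M k k').

Lemma respects_level k f : (k <= size M)%N ->
  respects (points (movie D M k)) (curve_links (movie D M k)) f
  <-> labels coloring_rule (movie D M k) f.
Proof. by move=> lk; apply: respects_labels; rewrite (run_movie rD co). Qed.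

Lemma level_components k : (k <= size M)%N -> (n k <= c k k)%N.
Proof.
move=> lk; apply: (pieces_leq (R := fun f f' => {in points (movie D M k),
  forall x, f' (k, x) = f x})).
  move=> f /(respects_level _ lk) lf; exists (fun p => f p.2) => //.
  apply/(window_respects rD co _ _ lk); split=> j; last by lia.
  by move=> hj; have -> : j = k by lia.
move=> f1 f2 f1' f2' _ _ e1 e2 e x xV; rewrite -e1 // -e2 //; apply: e.
by rewrite mem_window // leqnn xV.
Qed.

Lemma extend_up k : (k < size M)%N ->
  let mv := move_at M k in
  (2 * c 0 k + n k.+1 + is_extremum mv <= 2 * c 0 k.+1 + n k +
    is_saddle mv)%N /\
  forall u i o b v, mv = Saddle u i o b v ->
    (2 * c 0 k.+1 + n k + 1 <= 2 * c 0 k + n k.+1)%N ->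
    (exists2 A, chain D M (r := coloring_rule) 0 k A &
      A k (feet u i b).1 != A k (feet u i b).2) \/
    (exists2 f : point -> bool, labels coloring_rule (target mv) f &
       f (feet u i (~~ b)).1 != f (feet u i (~~ b)).2).
Proof.
move=> lk mv; have [va es et] := cobordism_at co lk; rewrite -/mv in va es et.
have lk' := ltnW lk.
have [] := @extension_count mv va _ (window D M 0 k) (window D M 0 k.+1)
  (schema_links D M) (schema_links D M) (fun x => (k, x)) (fun x => (k.+1, x)).
- by move=> [j x]; rewrite !mem_window // => /andP[h ->]; rewrite andbT; lia.
- by move=> x; rewrite et mem_window // => ->; rewrite andbT leqnn.
- move=> f /(window_respects rD co _ _ lk') [h _]; rewrite es.
  by apply: h; rewrite leqnn.
- move=> f g /(window_respects rD co _ _ lk') [h1 h2] lg ag.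
  exists (fun p => if (p.1 <= k)%N then f p else g p.2); split;
    last by move=> x _; rewrite /= ltnn.
    apply/(window_respects rD co _ _ lk); split=> j hj /=.
      case lj: (j <= k)%N; first by apply: h1.
      have -> : j = k.+1 by lia.
      by rewrite -et.
    have lj : (j <= k)%N by lia.
    rewrite lj; case lj': (j < k)%N; first by apply: h2; lia.
    have -> : j = k by lia.
    exact: ag.
  by move=> [j x]; rewrite mem_window // => /andP[/andP[_ h] _] /=; rewrite h.
rewrite -[size (pieces (window D M 0 k) _)]/(c 0 k)
  -[size (pieces (window D M 0 k.+1) _)]/(c 0 k.+1).
rewrite es et -/(n k) -/(n k.+1) => h1 h2; split=> // u i o b v em le.
have [[f rf sf]|] := h2 _ _ _ _ _ em le; last by right.
by left; exists (fun j x => f (j, x)) => //; apply/(window_respects rD co).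
Qed.

(** The part of the schema above a level is extended downward by the reversed
    move. *)
Lemma extend_down k : (k < size M)%N ->
  let mv := move_at M k in
  (2 * c k.+1 (size M) + n k + is_extremum mv <= 2 * c k (size M) + n k.+1 +
    is_saddle mv)%N /\
  forall u i o b v, mv = Saddle u i o b v ->
    (2 * c k (size M) + n k.+1 + 1 <= 2 * c k.+1 (size M) + n k)%N ->
    (exists2 A, chain D M (r := coloring_rule) k.+1 (size M) A &
       A k.+1 (feet u i (~~ b)).1 != A k.+1 (feet u i (~~ b)).2) \/
    (exists2 f : point -> bool, labels coloring_rule (source mv) f &
       f (feet u i b).1 != f (feet u i b).2).
Proof.
move=> lk mv; have [va es et] := cobordism_at co lk; rewrite -/mv in va es et.
have lm := leqnn (size M).
have [] := @extension_count _ (valid_rev va) _ (window D M k.+1 (size M))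
  (window D M k (size M))
  (schema_links D M) (schema_links D M) (fun x => (k.+1, x)) (fun x => (k, x)).
- by move=> [j x]; rewrite !mem_window // => /andP[h ->]; rewrite andbT; lia.
- by move=> x; rewrite target_rev es mem_window // => ->; rewrite andbT leqnn
  ltnW.
- move=> f /(window_respects rD co _ _ lm) [h _]; rewrite source_rev et.
  by apply: h; rewrite leqnn.
- move=> f g /(window_respects rD co _ _ lm) [h1 h2] lg /agree_rev;
  rewrite rev_moveK => ag.
  exists (fun p => if (k < p.1)%N then f p else g p.2); split;
    last by move=> x _; rewrite /= ltnn.
    apply/(window_respects rD co _ _ lm); split=> j hj /=.
      case lj: (k < j)%N; first by apply: h1; lia.
      have -> : j = k by lia.
      by move: lg; rewrite target_rev es.
    have lj : (k < j.+1)%N by lia.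
    rewrite lj; case lj': (k < j)%N; first by apply: h2; lia.
    have -> : j = k by lia.
    exact: ag.
  by move=> [j x]; rewrite mem_window // => /andP[/andP[h _] _] /=; rewrite h.
rewrite -[size (pieces (window D M k.+1 _) _)]/(c k.+1 (size M))
  -[size (pieces (window D M k _) _)]/(c k (size M)).
rewrite source_rev target_rev es et -/(n k) -/(n k.+1) is_extremum_rev
  is_saddle_rev => h1 h2.
split=> // u i o b v em le.
have em' : rev_move mv = Saddle u i o (~~ b) v by rewrite em.
have [[f rf sf]|[f lf sf]] := h2 _ _ _ _ _ em' le.
- by left; exists (fun j x => f (j, x)) => //; apply/(window_respects rD co).
- by right; exists f => //; move: sf; rewrite negbK.
Qed.

Lemma genus_up k : has_genus D M 0 -> (k < size M)%N ->
  (2 * c 0 k + n k.+1 + is_extremum (move_at M k)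
   = 2 * c 0 k.+1 + n k + is_saddle (move_at M k))%N.
Proof.
move=> hg lk.
pose G j : int := (2 * c 0 j)%:Z - (n j)%:Z - euler_char (take j M).
suff : G k = G k.+1.
  by rewrite /G /euler_char (take_nth move0 lk) -cats1 !count_cat /=; lia.
apply: (@monotone_constant G (size M)) => // [j lj|].
  have [h _] := extend_up lj.
  by rewrite /G /euler_char (take_nth move0 lj) -cats1 !count_cat /=; lia.
have := level_components (leq0n (size M)); move: hg.
rewrite /has_genus /G take_size take0 /euler_char /=.
rewrite -[size (schema D M)]/(c 0 (size M)) -[size (curves (movie _ _ _))]/(n
  (size M)).
rewrite -[size (curves D)]/(n 0); lia.
Qed.

Lemma genus_down k : has_genus D M 0 -> (k < size M)%N ->
  (2 * c k.+1 (size M) + n k + is_extremum (move_at M k)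
   = 2 * c k (size M) + n k.+1 + is_saddle (move_at M k))%N.
Proof.
move=> hg lk.
pose G j : int := (n j)%:Z + euler_char (drop j M) - (2 * c j (size M))%:Z.
suff : G k = G k.+1 by rewrite /G /euler_char (drop_nth move0 lk) /=; lia.
apply: (@monotone_constant G (size M)) => // [j lj|].
  have [h _] := extend_down lj.
  by rewrite /G /euler_char (drop_nth move0 lj) /=; lia.
have := level_components (leqnn (size M)); move: hg.
rewrite /has_genus /G drop_size drop0 /euler_char /=.
rewrite -[size (schema D M)]/(c 0 (size M)) -[size (curves (movie _ _ _))]/(n
  (size M)).
rewrite -[size (curves D)]/(n 0); lia.
Qed.

Lemma chain_negb k k' A : chain D M (r := coloring_rule) k k' A ->
  chain D M (r := coloring_rule) k k' (fun j x => ~~ A j x).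
Proof.
case=> h1 h2; split=> j hj.
  by apply/labels_coloring => x y e; have /labels_coloring/(_ x y e) -> :=
    h1 j hj.
by move=> x y e; rewrite (h2 j hj x y e).
Qed.

(** On a knot the coloring is constant, and complementing it makes it zero. *)
Lemma normalize_level (k k' j : nat) (A : nat -> point -> bool) s p q :
  (j <= size M)%N ->
  (k <= j <= k')%N -> is_knot (movie D M j) ->
  chain D M (r := coloring_rule) k k' A -> A s p != A s q ->
  exists A' : nat -> point -> bool, [/\ chain D M (r := coloring_rule) k k' A',
    forall x, x \in points (movie D M j) -> A' j x = false & A' s p != A' s q].
Proof.
move=> lj hj kn ch ne; have rf : respects (points (movie D M j))
  (curve_links (movie D M j)) (A j).
  by apply/respects_level => //; case: ch => h _; apply: h.
have kc := knot_constant kn rf.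
case: (boolP (has (A j) (points (movie D M j)))) =>
  [/hasP[x xD ax]|/hasPn none].
  exists (fun j x => ~~ A j x); split; first exact: chain_negb.
  - by move=> y yD; rewrite (kc y x yD xD) ax.
  - by rewrite (inj_eq negb_inj).
by exists A; split=> // x xD; apply/negbTE/none.
Qed.

(** If neither the feet are separated below nor the new arcs above, the two
    equalities of genus say that the feet lie on different curves and so do the
    new arcs, which is impossible. *)
Lemma genus_zero_good s : is_knot D -> is_knot D' -> has_genus D M 0 ->
  (s < size M)%N -> good_saddle D M s.
Proof.
move=> kD kD' hg ls u i o b v em; have [va es et] := cobordism_at co ls.
have [_ hu] := extend_up ls; have [_ hd] := extend_down ls.
have := genus_up hg ls; have := genus_down hg ls; rewrite em /= => gd gu.
case: (hu _ _ _ _ _ em) => [|[A ch ne]|[f lf nf]]; first by lia.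
  by left; apply: (@normalize_level 0 s 0 A) => //.
case: (hd _ _ _ _ _ em) => [|[A ch ne]|[g lg ng]]; first by lia.
  right; apply: (@normalize_level s.+1 (size M) (size M) A) => //;
    first by rewrite ls leqnn.
  by rewrite (cobordism_end co).
by rewrite (feet_separated va em lg lf ng) eqxx in nf.
Qed.

End Genus.

(** * Affine labelings of a knot diagram *)

Section Potential.

Variables (T : choiceType) (V : seq T).
Hypothesis uV : uniq V.
Implicit Types (E : seq ((T * T) * int)) (C : T -> int).

Definition violated C (e : (T * T) * int) := C e.1.2 != C e.1.1 + e.2.

Lemma pieces_nil : size V = size (pieces V [::]).
Proof.
apply/eqP; rewrite -(eqn_exp2l _ _ (ltnSn 1)) -card_colorings.
have -> : colorings V [::] = [set: {ffun seq_sub V -> bool}].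
  by apply/setP => f; rewrite !inE; apply/forallP => x; apply/forallP.
by rewrite cardsT card_ffun card_bool card_seq_sub.
Qed.

(** Links are added one at a time. A link between different components can be
    satisfied by shifting the labels on one of them, and it lowers the number
    of components by at most one; any other link may remain violated. *)
Lemma potential E : {subset unzip1 (unzip1 E) <= V} ->
  {subset unzip2 (unzip1 E) <= V} ->
  exists C, (count (violated C) E + size V <= size E +
    size (pieces V (unzip1 E)))%N.
Proof.
elim: E => [|[[p q] w] E IH] h1 h2; first by exists (fun=> 0);
  rewrite /= -pieces_nil.
have {}IH : exists C, (count (violated C) E + size V <= size E +
  size (pieces V (unzip1 E)))%N.
  apply: IH => x h; [apply: h1 | apply: h2]; by rewrite /= inE h orbT.
have [pV qV] : p \in V /\ q \in V by split; [apply: h1|apply: h2];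
  rewrite /= inE eqxx.
case: IH => C hC; set E' := _ :: E.
case: (classic (exists2 f : T -> bool, respects V (unzip1 E) f & f p != f q)) =>
  [[f rf sf]|nsep].
  pose d := if f p then C q - C p - w else C p + w - C q.
  pose C' x := C x + d * (f x)%:Z.
  have c0 : ~~ violated C' ((p, q), w).
    rewrite /violated negbK /C' /d /=; case: (f p) sf; case: (f q) => //= _;
    by rewrite !mulr0 !mulr1 ?addr0; apply/eqP; ring.
  have cE : count (violated C') E = count (violated C) E.
    apply: eq_in_count => -[[x y] v] e; rewrite /violated /C' /=.
    have xy : (x, y) \in unzip1 E by apply/mapP; exists ((x, y), v).
    have xV : x \in V by apply: h1; rewrite /= inE; apply/orP; right;
      apply/mapP; exists (x, y).
    have yV : y \in V by apply: h2; rewrite /= inE; apply/orP; right;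
      apply/mapP; exists (x, y).
    by rewrite (rf _ _ xy xV yV) addrAC (inj_eq (addIr _)).
  exists C'; rewrite /= (negbTE c0) cE add0n.
  suff : (size (pieces V (unzip1 E)) <= (size (pieces V (unzip1 E'))).+1)%N
    by rewrite /E' /=; lia.
  pose adj (g : T -> bool) := if g p == g q then g else xor_color g f.
  apply: (pieces_leS (R := fun g g' b => g' = adj g /\ b = (g p == g q))).
    move=> g rg; exists (adj g), (g p == g q); split=> // x y.
    have ra : respects V (unzip1 E) (adj g).
      by rewrite /adj; case: ifP => // _; apply: respects_xor.
    rewrite /= inE => /orP[/eqP [-> ->] _ _|]; last exact: ra.
    rewrite /adj; case: eqP => // /eqP ne; move: ne sf.
    by rewrite /xor_color; case: (g p); case: (g q); case: (f p); case: (f q).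
  move=> g1 g2 _ _ b _ _ [-> ->] [-> eb] e x xV; have := e x xV.
  by rewrite /adj eb; case: ifP => // _; apply: addIb.
exists C; suff : (size (pieces V (unzip1 E)) <= size (pieces V (unzip1 E')))%N.
  by rewrite /= /E' /=; case: (violated _ _) => /=; lia.
apply: (pieces_leq (R := fun g g' => g' = g)); last by move=> g1 g2 _ _ _ _ ->
  ->.
move=> g rg; exists g => // x y; rewrite /= inE => /orP[/eqP [-> ->] _ _|];
  last exact: rg.
by apply/eqP/negPn/negP => h; apply: nsep; exists g.
Qed.

End Potential.

Definition layer_links j s l : seq (point * point) :=
  layer_arc_links j s l
  ++ oapp (fun c => [:: (left_in c, right_out c); (right_in c, left_out c)])
    [::]
       (layer_crossing j s l).

Definition weighted_links j s l : seq ((point * point) * int) :=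
  [seq (e, 0) | e <- layer_arc_links j s l]
  ++ oapp (fun c => [:: ((left_in c, right_out c), -1);
    ((right_in c, left_out c), 1)]) [::]
       (layer_crossing j s l).

Lemma mem_curve_links D e : run D [::] ->
  (e \in curve_links D) = (e \in flatten (scan layer_links 0 [::] D)).
Proof.
move=> rD; rewrite /curve_links /arc_links /crossings -(scanE layer_links) //.
elim: (indexed_layers D) => // jl t IH.
rewrite /= [in RHS]mem_cat -IH /layer_links.
case: layer_crossing => [c|] /=; rewrite !(mem_cat, inE) ?orbF -!orbA;
  congr (_ || _).
by rewrite orbCA; congr (_ || _); rewrite orbCA.
Qed.

Lemma unzip1_weighted j s w :
  unzip1 (flatten (scan weighted_links j s w))
    = flatten (scan layer_links j s w).
Proof.
rewrite /unzip1; elim: w j s => //= l w IH j s; rewrite map_cat IH;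
  congr (_ ++ _).
rewrite /weighted_links /layer_links map_cat -map_comp map_id.
by case: layer_crossing.
Qed.

Lemma weighted_labels C j s w :
  all id (scan (layer_labels (r := affine_rule 1) C) j s w)
  = all (predC (violated C)) (flatten (scan weighted_links j s w)).
Proof.
elim: w j s => //= l w IH j s; rewrite all_cat IH; congr (_ && _).
rewrite /layer_labels /weighted_links all_cat all_map; congr (_ && _).
  by apply: eq_all => e; rewrite /= /violated negbK addr0 eq_sym.
by case: layer_crossing => //= c; rewrite /violated !negbK andbT.
Qed.

Lemma coloring_labels f j s w :
  all id (scan (layer_labels (r := coloring_rule) f) j s w)
  = all (fun e => f e.1 == f e.2) (flatten (scan layer_links j s w)).
Proof.
elim: w j s => //= l w IH j s; rewrite all_cat IH; congr (_ && _).
rewrite /layer_labels /layer_links all_cat; congr (_ && _).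
by case: layer_crossing => //= c; rewrite /crossing_rule /= andbT
  (eq_sym (f (right_out c))) (eq_sym (f (left_out c))).
Qed.

Lemma map_iota_succ (A : Type) (F : nat -> A) n :
  [seq F k | k <- iota 0 n.+1] = F 0%N :: [seq F k.+1 | k <- iota 0 n].
Proof. by rewrite /= -[1%N]/(1 + 0)%N iotaDl -map_comp. Qed.

Lemma sumn_cons x t : sumn (x :: t) = (x + sumn t)%N.
Proof. by []. Qed.

(** Each point is an end of two links, one below and one above it, except for
    the first and the last section. *)
Lemma size_weighted j s w s' : run w s = Some s' ->
  (2 * size (flatten (scan weighted_links j s w)) + size s + size s'
   = 2 * sumn [seq size (odflt [::] (run (take k w) s)) |
     k <- iota 0 (size w).+1])%N.
Proof.
elim: w j s => [|l w IH] j s; first by case=> <- /=; lia.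
rewrite [run _ _]/=; case E: (apply_layer l s) => [s1|] // rw.
rewrite map_iota_succ take0 [scan _ _ _ _]/= E [flatten _]/= size_cat sumn_cons.
have -> : [seq size (odflt [::] (run (take k.+1 (l :: w)) s)) |
  k <- iota 0 (size (l :: w))]
   = [seq size (odflt [::] (run (take k w) s1)) | k <- iota 0 (size w).+1].
  by apply: eq_map => k; rewrite /= E.
have := IH j.+1 _ rw; have [h1 h2] := size_apply_layer E.
have hl : (2 * size (weighted_links j s l) = size s + size s1)%N.
  rewrite /weighted_links size_cat size_map; move: h1 h2; case: (l) => i g.
  rewrite /layer_arc_links !size_cat !size_map !size_iota /=.
  by case: g => [o||[]] /= h1 h2; lia.
rewrite -[odflt _ (run [::] s)]/s; lia.
Qed.

Lemma uniq_points D : uniq (points D).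
Proof.
apply: allpairs_uniq_dep; [exact: iota_uniq | by move=> j _;
  apply: iota_uniq |].
by move=> [j i] [j' i'] _ _ /= [-> ->].
Qed.

Lemma size_points D : size (points D) = sumn [seq size (section D j) |
  j <- iota 0 (size D).+1].
Proof.
rewrite size_flatten /shape -map_comp; congr sumn; apply: eq_map => j /=.
by rewrite size_map size_iota.
Qed.

Lemma closed_first D : run D [::] = Some [::] -> D <> [::] ->
  exists o w, D = (0%N, Cup o) :: w.
Proof.
case: D => [|[i g] w] // rD _.
have rD1 : run ((i, g) :: w) [::] by rewrite rD.
have [/= h _] := size_apply_layer (section_succ rD1 (ltn0Sn _)).
rewrite leqn0 addn_eq0 in h.
by case/andP: h => /eqP ->; case: g {rD rD1} => // o _; exists o, w.
Qed.

(** The link of the first minimum is set aside. Stokes' formula, for the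
    constant label 1, shows that its two ends are still connected by the other
    links; so a knot still has one component, with one link less than points,
    and a potential violates none of the links. Stokes' formula for this
    potential and the constant color then settles the link set aside. *)
Lemma knot_labeling D : run D [::] = Some [::] -> is_knot D ->
  exists C : labeling, affine_labeling D C.
Proof.
move=> rD kD; have [|o [w eD]] := closed_first rD.
  move=> eD; move: kD; rewrite /is_knot /curves eD => h.
  have [A hA] : exists A, A \in pieces (points [::]) (curve_links [::]).
    by move: h; case: pieces => // A t _; exists A; rewrite inE eqxx.
  by case/piecesP: hA => -[].
have rw : run w [:: o; ~~ o] = Some [::] by move: rD; rewrite eD.
have rD1 : run D [::] by rewrite rD.
set s1 := [:: o; ~~ o] in rw *.
pose E := flatten (scan weighted_links 1 s1 w).
have eL : flatten (scan layer_links 0 [::] D) = ((1, 0), (1, 1))%N :: unzip1 E.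
  by rewrite /E unzip1_weighted eD.
have inV e : e \in unzip1 E -> (e.1 \in points D) /\ (e.2 \in points D).
  by move=> h; apply: curve_links_points => //; rewrite mem_curve_links //
    eL inE h orbT.
have h1 : {subset unzip1 (unzip1 E) <= points D}.
  by move=> x /mapP[e /inV[h _] ->].
have h2 : {subset unzip2 (unzip1 E) <= points D}.
  by move=> x /mapP[e /inV[_ h] ->].
have [C hC] := potential (uniq_points D) h1 h2.
have szE : ((size E).+1 = size (points D))%N.
  have := size_weighted 1 rw; rewrite -/E size_points eD.
  rewrite (map_iota_succ (fun j => size (section ((0%N, Cup o) :: w) j)))
    sumn_cons.
  have s0 : size (section ((0%N, Cup o) :: w) 0) = 0%N by rewrite /section
    take0.
  have -> : [seq size (section ((0%N, Cup o) :: w) k.+1) |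
    k <- iota 0 (size ((0%N, Cup o) :: w))]
     = [seq size (odflt [::] (run (take k w) s1)) | k <- iota 0 (size w).+1].
    by apply: eq_map.
  rewrite [size s1]/= [size [::]]/=; lia.
have lrun0 (r : labeling_rule) (L : point -> label r) :
    all id (scan (layer_labels L) 1 s1 w) ->
    lpath w [:: (o, L (1, 0)%N); (~~ o, L (1, 1)%N)] (lrows L 1 s1 w) /\
    last [:: (o, L (1, 0)%N); (~~ o, L (1, 1)%N)] (lrows L 1 s1 w) = [::].
  move/labels_lpath_from; rewrite rw => /(_ isT) p; split; first exact: p.
  have := lpath_run p; rewrite [unzip1 _]/= rw => -[]; by case: last.
have sep (f : point -> bool) : respects (points D) (unzip1 E) f ->
  f (1, 0)%N = f (1, 1)%N.
  move=> rf; have lf : all id (scan (layer_labels (r := coloring_rule) f) 1 s1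
    w).
    rewrite coloring_labels -unzip1_weighted; apply/allP => -[x y] e.
    by have [hx hy] := inV _ e; apply/eqP; apply: rf e hx hy.
  have [pR lR] := lrun0 coloring_rule f lf.
  have l1 : all id (scan (layer_labels (r := affine_rule 0) (fun=> 1)) 1 s1 w).
    suff H t j s : all id (scan (layer_labels (r := affine_rule 0) (fun=> 1)) j
      s t) by exact: H.
    elim: t j s => //= l t IH j s; rewrite IH andbT /layer_labels.
    apply/andP; split; first by apply/allP => e _; rewrite eqxx.
    by case: layer_crossing => //= c; rewrite /crossing_rule /= subr0 addr0
      eqxx.
  have [pQ lQ] := lrun0 (affine_rule 0) (fun=> 1) l1.
  have := pairing_path (c := 0) _ pQ pR; rewrite lR lQ => /(_ erefl).
  rewrite !pairing_cons /pairing !big_nil /= mul0r !addr0 !mulr1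
    orientation_signN.
  by case: (o); case: (f _); case: (f _).
have comp1 : (size (pieces (points D) (unzip1 E)) <= 1)%N.
  rewrite -[X in (_ <= X)%N]kD; apply: (pieces_leq (R := fun g g' => g' = g));
    last by move=> g1 g2 _ _ _ _ -> ->.
  move=> f rf; exists f => // x y; rewrite mem_curve_links // eL inE =>
    /orP[/eqP[-> ->] _ _|]; first exact: sep.
  exact: rf.
have cnt : count (violated C) E = 0%N.
  have := leq_trans hC (_ : (_ <= size E + 1)%N); rewrite leq_add2l =>
    /(_ comp1).
  by rewrite -szE addnS addn1 ltnS -[X in (_ <= X)%N]add0n leq_add2r leqn0 =>
    /eqP.
have lC : all id (scan (layer_labels (r := affine_rule 1) C) 1 s1 w).
  by rewrite weighted_labels -/E all_predC has_count cnt.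
have [pR lR] := lrun0 (affine_rule 1) C lC.
have lt : all id (scan (layer_labels (r := coloring_rule) (fun=> true)) 1 s1 w).
  by rewrite coloring_labels; apply/allP => e _; rewrite eqxx.
have [pQ lQ] := lrun0 coloring_rule (fun=> true) lt.
have := pairing_path (c := 1) _ pR pQ; rewrite lR lQ => /(_ erefl).
rewrite !pairing_cons /pairing !big_nil /= !addr0 !mulr1 mul1r
  orientation_signN.
rewrite [lpath_value _ _ _](_ : _ = 0); last first.
  have := lpath_value_scan (r := coloring_rule) (C := fun=> true) (j := 1%N)
    (s := s1) (w := w).
  rewrite rw => /(_ isT lt) /= ->.
  suff H t j s : \sum_(x <- scan (layer_total (r := coloring_rule) (fun=> true))
    j s t) x = 0 by exact: H.
  elim: t j s => [|l t IH] j s; rewrite /= ?big_nil // big_cons IH addr0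
    /layer_total.
  by case: layer_crossing.
move=> e; have e1 : C (1, 0)%N = C (1, 1)%N by move: e; case: (o);
  rewrite /orientation_sign /=; lia.
exists C; apply/affine_labelingP; rewrite labels_scan // eD [scan _ _ _ _]/=
  [all _ _]/=.
rewrite lC andbT; apply/layer_labelsP; split=> //=.
Qed.

(** * Invariance *)

Lemma knot_polynomial_unique D (C C' : labeling) : run D [::] = Some [::] ->
  is_knot D ->
  affine_labeling D C -> affine_labeling D C' ->
  affine_polynomial D C = affine_polynomial D C'.
Proof.
move=> rD kD /affine_labelingP lC /affine_labelingP lC'.
have rD1 : run D [::] by rewrite rD.
have rf : respects (points D) (curve_links D) (fun x => C x - C' x).
  move=> x y e _ _; case/labels_affineP: lC => a1 c1; case/labels_affineP:
    lC' => a2 c2.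
  move: e; rewrite mem_cat => /orP[e|]; first by rewrite (a1 _ _ e) (a2 _ _ e).
  elim: (crossings D) c1 c2 => //= c t IH /andP[/andP[/eqP h1 /eqP h2] t1]
    /andP[/andP[/eqP h3 /eqP h4] t2].
  rewrite !inE => /or3P[/eqP[-> ->]|/eqP[-> ->]|]; last exact: IH.
    by rewrite h1 h3; ring.
  by rewrite h2 h4; ring.
have kc := knot_constant kD rf.
have [d hd] : exists d, {in points D, forall x, C x = C' x + d}.
  case E: (points D) => [|x0 t]; first by exists 0.
  have x0D : x0 \in points D by rewrite E inE eqxx.
  exists (C x0 - C' x0) => x xD; rewrite -E in xD.
  by rewrite -(kc x x0 xD x0D); ring.
rewrite !affine_polynomialE (state_sum_ext rD1 lC hd).
apply: eq_bigr => c _; rewrite /= /affine_value.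
by have -> : C' (left_in c) + d - (C' (right_in c) + d) = C' (left_in c) -
  C' (right_in c) by ring.
Qed.

Lemma knot_invariance (K K' : diagram) : is_knot K -> is_knot K' ->
  knots_concordant K K' ->
  affine_index_polynomial K = affine_index_polynomial K'.
Proof.
move=> kK kK' [M [co _ hg]].
have rK : run K [::] = Some [::] by apply/eqP/word_of_closed.
have rK' : run K' [::] = Some [::] by apply/eqP/word_of_closed.
have lK := epsilon_spec (inhabits (fun=> 0)) _ (knot_labeling rK kK).
rewrite /affine_index_polynomial; have [C' [lC' _ ->]] := cobordism_invariance
  rK co (fun s => genus_zero_good rK co kK kK' hg) lK.
apply: knot_polynomial_unique => //.
exact: epsilon_spec (ex_intro _ C' lC').
Qed.

Theorem theorem4p9 :
  (forall K K' : diagram,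
      is_knot K -> is_knot K' -> knots_concordant K K' ->
      affine_index_polynomial K = affine_index_polynomial K') /\
  (forall (L L' : diagram) (M : seq move),
      compatible L -> compatible L' ->
      cobordism L M L' -> has_genus L M 0 -> critical_points_cancel L M ->
      forall C : labeling, affine_labeling L C ->
      exists C' : labeling,
        [/\ affine_labeling L' C', corresponds L M C C' &
            affine_polynomial L C = affine_polynomial L' C']).
Proof.
split; first exact: knot_invariance.
by move=> L L' M _ _ co _ cc; apply: invariance_links.
Qed.
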